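(* Let $\psi\in\Psi$. Then $\Gamma_{\rm iid}(\Lambda(\psi))\neq\{1\}$ if and only if there exist integers $k,l\ge2$ such that $$\limsup_{u\rightarrow0}\frac{\psi(ku)}{\psi(u)}<k\quad\text{and}\quad\limsup_{u\rightarrow0}\frac{\psi(u^l)}{\psi(u)}<1.$$
   Context: $\Psi$ is the set of all increasing continuous concave functions $\psi$ on $[0,1]$ with $\psi(0)=0$. For measurable $x$ on $[0,1]$ with Lebesgue measure $m$, $x^*(t)=\inf\{s\ge0:m(|x|>s)\le t\}$. The Lorentz space $\Lambda(\psi)$ on $[0,1]$ has norm $\|x\|_{\Lambda(\psi)}=\int_0^1x^*(t)\,d\psi(t)$. For a Banach function space $E$ on $[0,1]$ and $p\ge1$, a bounded sequence $\{x_n\}\subset E$ is a $p$-BS-sequence if for every subsequence $\{y_k\}\subset\{x_n\}$ one has $\sup_{j\in\mathbb N}j^{-1/p}\|\sum_{k=1}^jy_k\|_E<\infty$. $\Gamma_{\rm iid}(E)$ is the set of all $p\ge1$ such that every weakly null sequence in $E$ of independent identically distributed random variables contains a subsequence which is a $p$-BS-sequence. *)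

(* Defs.v *)
From HB Require Import structures.
From mathcomp Require Import all_boot all_order all_algebra finmap.
From mathcomp Require Import all_classical all_reals all_analysis.

Set Implicit Arguments.
Unset Strict Implicit.
Unset Printing Implicit Defensive.

Import Order.TTheory GRing.Theory Num.Theory.
Import numFieldNormedType.Exports.

Local Open Scope classical_set_scope.
Local Open Scope ring_scope.

(* The values of psi : Psi R outside [0,1] are irrelevant. "Increasing" is
   read in the wide sense, which makes it necessary to exclude the zero
   function: there the Lorentz functional is not a norm. *)
Record Psi (R : realType) := MkPsi {
  Psi_fun :> R -> R;
  Psi_nondecreasing : {in `[0, 1] &, {homo Psi_fun : s t / s <= t}};
  Psi_continuous : {within `[0, 1], continuous Psi_fun};
  Psi_concave : forall a s t : R,
    a \in `[0, 1] -> s \in `[0, 1] -> t \in `[0, 1] ->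
    a * Psi_fun s + (1 - a) * Psi_fun t <= Psi_fun (a * s + (1 - a) * t);
  Psi0 : Psi_fun 0 = 0;
  Psi_neq0 : exists2 t, t \in `[0, 1] & Psi_fun t != 0
}.

(* psi extended by constants to the left of 0 and to the right of 1, so that
   d psi becomes a Lebesgue-Stieltjes measure on R carried by [0,1]. *)
Definition Psi_ext (R : realType) (psi : Psi R) (t : R) : R :=
  psi (Num.max 0 (Num.min t 1)).

Lemma clamp01 (R : realType) (t : R) : Num.max 0 (Num.min t 1) \in `[0, 1].
Proof.
by rewrite in_itv /= le_max lexx /= ge_max ler01 ge_min lexx orbT.
Qed.

Lemma Psi_ext_nondecreasing (R : realType) (psi : Psi R) :
  nondecreasing (Psi_ext psi).
Proof.
move=> s t st; apply: Psi_nondecreasing; rewrite ?clamp01//.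
by rewrite ge_max !le_max lexx /= le_min !ge_min st lexx !orbT.
Qed.

Lemma Psi_ext_right_continuous (R : realType) (psi : Psi R) :
  right_continuous (Psi_ext psi).
Proof.
apply: right_continuousW => x.
pose clamp (t : R) := Num.max 0 (Num.min t 1).
have /subspace_continuousP/(_ _ (clamp01 x)) cpsi := @Psi_continuous _ psi.
apply: (@cvg_comp _ _ _ clamp psi _ _ _ _ cpsi) => A /= A01.
have cclamp : {for x, continuous clamp}.
  apply: (@continuous_max _ _ (cst 0) (fun t : R => Num.min t 1)).
    exact: cvg_cst.
  by apply: (@continuous_min _ _ id (cst 1)); [exact: cvg_id|exact: cvg_cst].
have : nbhs x (fun t => `[0, 1]%classic (clamp t) -> A (clamp t)).
  exact: cclamp _ A01.
by apply: filterS => t; apply; exact: clamp01.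
Qed.

HB.instance Definition _ (R : realType) (psi : Psi R) :=
  isCumulative.Build R _ R (Psi_ext psi)
    (@Psi_ext_nondecreasing R psi) (@Psi_ext_right_continuous R psi).

(* Functions on [0,1] are represented by functions R -> R of which only the
   restriction to [0,1] matters. *)
Definition m01 (R : realType) : set R -> \bar R :=
  mrestr (@lebesgue_measure R) (measurable_itv `[0, 1]).

(* Extended-real valued: if x is essentially unbounded, x^*(0) is the infimum
   of the empty set, +oo; d psi has no atom at 0. *)
Definition rearrangement (R : realType) (x : R -> R) (t : R) : \bar R :=
  ereal_inf [set s%:E | s in
    [set s : R | 0 <= s /\ (m01 [set u | (s < `|x u|)%R] <= t%:E)%E]].

Definition lorentz_norm (R : realType) (psi : Psi R) (x : R -> R) : \bar R :=
  \int[lebesgue_stieltjes_measure (Psi_ext psi)]_(t in `[0, 1])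
    rearrangement x t.

(* A Banach function space E on [0,1] is given by its norm N, with value +oo
   outside E. Functions at
   N-distance 0 are not identified by a quotient; elements of the dual space
   below take equal values at them. *)
Definition fspace (R : realType) (N : (R -> R) -> \bar R) : set (R -> R) :=
  [set x : R -> R | measurable_fun `[0 : R, 1] x /\ (N x < +oo)%E].

(* The continuous linear functionals on E; the values of phi outside E are
   irrelevant. *)
Definition dual_space (R : realType) (N : (R -> R) -> \bar R) :
    set ((R -> R) -> R) :=
  [set phi |
    (forall (a : R) (x y : R -> R), fspace N x -> fspace N y ->
      phi (fun t => a * x t + y t) = a * phi x + phi y) /\
    (exists C : R, forall x, fspace N x -> (`|phi x|%:E <= C%:E * N x)%E)].

Definition weakly_null (R : realType) (N : (R -> R) -> \bar R)
    (x : nat -> R -> R) : Prop :=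
  (forall n, fspace N (x n)) /\
  (forall phi, dual_space N phi -> phi (x n) @[n --> \oo] --> (0 : R)).

Definition independent (R : realType) (x : nat -> R -> R) : Prop :=
  forall (J : {fset nat}) (B : nat -> set R), (forall i, measurable (B i)) ->
    m01 (\bigcap_(i in [set` J]) (x i @^-1` B i)) =
    (\prod_(i <- J) m01 (x i @^-1` B i))%E.

Definition identically_distributed (R : realType) (x : nat -> R -> R) : Prop :=
  forall (i j : nat) (B : set R), measurable B ->
    m01 (x i @^-1` B) = m01 (x j @^-1` B).

Definition subsequence (T : Type) (y x : nat -> T) : Prop :=
  exists2 f : nat -> nat, {homo f : i j / (i < j)%N} & y = x \o f.

Definition BS_sequence (R : realType) (N : (R -> R) -> \bar R) (p : R)
    (x : nat -> R -> R) : Prop :=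
  [/\ forall n, fspace N (x n),
      exists C : R, forall n, (N (x n) <= C%:E)%E &
      forall y, subsequence y x ->
        (ereal_sup [set (j%:R `^ (- p^-1))%:E *
                        N (fun t => (\sum_(k < j) y k t)%R)
                   | j in [set j | (1 <= j)%N]] < +oo)%E].

Definition Gamma_iid (R : realType) (N : (R -> R) -> \bar R) : set R :=
  [set p | 1 <= p /\
    forall x : nat -> R -> R,
      weakly_null N x -> independent x -> identically_distributed x ->
      exists2 y, subsequence y x & BS_sequence N p y].

(* Main.v *)
Require Import Defs.
From mathcomp Require Import all_boot all_order all_algebra finmap.
From mathcomp Require Import all_classical all_reals all_analysis.
From mathcomp Require Import measurable_realfun.
From mathcomp Require Import ring lra.

(** Write F_x(s) = m(|x| > s). The layer-cake formula gives the norm of x as the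
    integral of psi(F_x(s)) over s >= 0 (lorentzE), so that only distribution
    functions matter. That this functional satisfies the triangle inequality is
    clear for psi(v) = min(v, b), where it is a K-functional; the piecewise
    linear interpolations of a concave psi are positive combinations of these,
    and Fatou's lemma gives the general case (lorentz_triangle). By the triangle
    inequality p = 1 always belongs to the set of admissible exponents
    (Gamma_iid_1), and the question is whether there is another one.

    Sufficiency. Concavity gives psi(n u) <= n psi(u) only. Iterating the first
    condition improves this to psi(n u) <= C n^th psi(u) with th < 1
    (psi_growth); iterating the second one gives, for each a > 0, an exponent
    L <= n^a with psi(u^L) <= C n^(-eps) psi(u) (psi_decay). Let the x_k be
    independent with the same law, and y a function with values in [-1, 1] such
    that y(x_0) vanishes outside a set of measure u. Then the norm of
    sum_(k < n) y(x_k) - n E y(x_0) is at most C n^(1-e) psi(u), with e and C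
    independent of n, u and y (iid_estimate). If u is much smaller than 1/n, few
    terms are nonzero: their number exceeds a multiple of L only with
    probability u^L or so (few_nonzero, sparse_estimate). Otherwise the
    exponential inequality (deviation) shows that the sum exceeds
    n^(1-a) psi(u) only with probability (n^-2)^L (dense_estimate). In both cases
    psi_decay makes the exceptional set negligible. An unbounded x_0 of mean zero
    is cut into dyadic layers, and the sum over i of 2^i psi(F(2^i)) is at most
    twice the norm (layer_sum); hence the sums of n terms have norm O(n^(1-e))
    (iid_sum_bound), which is the property for p = 1/(1-e). It applies to all
    weakly null sequences of this kind, because they have mean zero
    (weakly_null_mean).

    Necessity. If no k, l satisfy the conditions, then for each K there are
    arbitrarily small u = 1/m such that psi(u^K) or psi(K u / 2) / K is at least
    psi(u) / 8 (no_gain_near). Superpose spikes of height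
    c_i = 2^-i / psi(1/m_i) on sets of measure 1/m_i, where K_i grows very fast
    and the pair (K_i, m_i) has this property. Among K_i independent copies of
    the result, all are above c_i with probability m_i^(-K_i), and at least one
    is with probability about K_i/m_i; in either case the sum has norm at least
    of order K_i 2^-i (lorentz_sum_ge_no_gain), which is not O(K_i^(1/p)) for any
    p > 1 (Gamma_iid_no_gain). The copies are functions of the successive digits of
    the Lueroth expansion, which are independent (luroth_seq_independent).
    Centered, they form a weakly null sequence: a functional that stays away
    from zero on a subsequence would be at least of order n on the sums of n of
    its terms, against the law of large numbers in norm (lorentz_lln,
    iid_weakly_null). *)

Set Implicit Arguments.
Unset Strict Implicit.
Unset Printing Implicit Defensive.

Import Order.TTheory GRing.Theory Num.Theory.
Import numFieldNormedType.Exports.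

Local Open Scope classical_set_scope.
Local Open Scope ring_scope.

(** * The layer-cake formula *)

Section LayerCake.
Local Open Scope ereal_scope.

Lemma lebesgue_measure_between (R : realType) (c : R) (r : \bar R) : c%:E <= r ->
  lebesgue_measure [set s : R | (c <= s)%R /\ s%:E < r] = r - c%:E.
Proof.
case: r => [r| |] //= r0.
- rewrite (_ : [set _ | _] = `[c, r[%classic).
    rewrite lebesgue_measure_itv/= lte_fin; case: ifPn => //.
    rewrite -leNgt => r0'; have -> : r = c.
      by apply/eqP; rewrite eq_le r0' -lee_fin r0.
    by rewrite -EFinB subrr.
  by apply/seteqP; split => s /=; rewrite in_itv/= lte_fin => /andP.
- rewrite (_ : [set _ | _] = `[c, +oo[%classic).
    by rewrite lebesgue_measure_itv/= ltry.
  apply/seteqP; split => s /=; rewrite in_itv/= andbT; first by case.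
  by move=> ?; rewrite ltry.
Qed.

(** Both sides are the product measure of the region below the graph of f and
    above height c, computed by vertical and by horizontal sections. The base
    level c is arbitrary so that it also computes the integral of the part of
    a function above c. *)
Lemma layer_cake d (T : measurableType d) (R : realType)
    (mu : {sigma_finite_measure set T -> \bar R}) (D : set T)
    (c : R) (f : T -> \bar R) :
  measurable D -> measurable_fun D f -> (forall x, D x -> c%:E <= f x) ->
  \int[mu]_(x in D) (f x - c%:E) =
  \int[lebesgue_measure]_(s in `[c, +oo[) mu (D `&` [set x | s%:E < f x]).
Proof.
move=> mD mf f0.
pose g x := ((fun x => f x - c%:E) \_ D) x + c%:E.
have gE x : g x = if x \in D then f x else c%:E.
  by rewrite /g patchE; case: ifPn => // _; rewrite ?subeK ?add0e.
have mg : measurable_fun setT g.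
  apply: emeasurable_funD => //; apply/(measurable_restrictT _ mD).
  exact: emeasurable_funB.
have g0 x : c%:E <= g x by rewrite gE; case: ifPn => // /set_mem; exact: f0.
(* The region between height c and the graph of f, extended by c outside D. *)
pose A : set (T * measurableTypeR R) := [set p | (c <= p.2)%R /\ p.2%:E < g p.1].
have mA : measurable A.
  rewrite (_ : A = (setT `&` [set p | (c <= p.2 :> R)%R]) `&`
                   (setT `&` [set p | 0 < g p.1 - p.2%:E])).
    apply: measurableI.
      apply: (@measurable_fun_ler _ _ _ _ (cst c) (@snd T (measurableTypeR R)) _ _ measurableT [set true]) => //.
    apply: emeasurable_fun_o_infty => //.
    apply: emeasurable_funB.
      exact: measurableT_comp.
    apply/measurable_EFinP; exact: measurable_snd.
  by rewrite !setTI; apply/seteqP; split => p [] /= ? ?; split => //=;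
    move: (sube_gt0 p.2%:E (g p.1)) => /= E; rewrite ?E// -E.
transitivity (\int[mu]_x (g x - c%:E)).
  rewrite integral_mkcond; apply: eq_integral => x _; rewrite patchE gE.
  by case: ifPn => // _; rewrite -EFinB subrr.
have := @indic_fubini_tonelli _ _ _ _ R mu (@lebesgue_measure R) A mA.
rewrite /= -/(fubini_F _ _) -/(fubini_G _ _).
rewrite (indic_fubini_tonelli_FE _ mA) (indic_fubini_tonelli_GE _ mA) => E.
transitivity (\int[mu]_x (lebesgue_measure \o xsection A) x).
  apply: eq_integral => x _ /=.
  rewrite -[LHS](lebesgue_measure_between (g0 x)); congr lebesgue_measure.
  by apply/seteqP; split => s; rewrite /= /xsection/= inE.
rewrite E [RHS]integral_mkcond; apply: eq_integral => s _ /=.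
rewrite patchE; case: ifPn => [|].
  rewrite inE/= in_itv/= andbT => s0; congr (mu _).
  apply/seteqP; split => x; rewrite /= /ysection/= inE /A/= gE.
    case: ifPn => [/set_mem Dx [_ ?]|_ [_]]; first by split.
    by rewrite lte_fin ltNge s0.
  by move=> [Dx sf]; rewrite mem_set.
rewrite notin_setE/= in_itv/= andbT => /negP s0.
rewrite (_ : ysection _ _ = set0) ?measure0//.
by apply/seteqP; split => x //; rewrite /= /ysection/= inE /A/= (negbTE s0) => -[].
Qed.

End LayerCake.

(** * Concave functions and their Stieltjes measures *)

Section PsiFacts.
Variables (R : realType) (psi : Psi R).

Lemma psi_le (s t : R) : 0 <= s -> s <= t -> t <= 1 -> psi s <= psi t.
Proof.
move=> s0 st t1; apply: Psi_nondecreasing => //; rewrite in_itv/=.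
  by rewrite s0 (le_trans st).
by rewrite (le_trans s0).
Qed.

Lemma psi_ge0 (t : R) : 0 <= t <= 1 -> 0 <= psi t.
Proof. by case/andP=> t0 t1; rewrite -(Psi0 psi); apply: psi_le. Qed.

Lemma psi_scale (a t : R) : 0 <= a <= 1 -> 0 <= t <= 1 ->
  a * psi t <= psi (a * t).
Proof.
move=> a01 t01; have := @Psi_concave _ psi a t 0.
by rewrite Psi0 !mulr0 !addr0; apply; rewrite in_itv/= ?lexx ?ler01.
Qed.

Lemma psi_gt0 (t : R) : 0 < t <= 1 -> 0 < psi t.
Proof.
case/andP=> t0 t1; have [s] := Psi_neq0 psi; rewrite in_itv/= => /andP[s0 s1] ps.
have {}ps : 0 < psi s by rewrite lt_neqAle eq_sym ps psi_ge0// s0.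
have : t * psi s <= psi (t * s) by rewrite psi_scale ?s0// ltW.
move=> /(lt_le_trans (mulr_gt0 t0 ps)) /lt_le_trans; apply.
by rewrite psi_le// ?mulr_ge0// ?(ltW t0)// ler_piMr// ltW.
Qed.

(** The chord from (0, 0) to (1, psi 1) lies below the graph; this is the
    embedding of the Lorentz space into the integrable functions. *)
Lemma psi_id_le (t : R) : 0 <= t <= 1 -> t * psi 1 <= psi t.
Proof. by move=> t01; rewrite -{2}(mulr1 t) psi_scale// ler01 lexx. Qed.

Lemma psi_dilate (a t : R) : 1 <= a -> 0 <= t -> a * t <= 1 ->
  psi (a * t) <= a * psi t.
Proof.
move=> a1 t0 at1; have a0 : 0 < a by rewrite (lt_le_trans ltr01).
have := @psi_scale a^-1 (a * t).
rewrite mulKf ?gt_eqF// invr_ge0 (ltW a0) invf_le1// a1 at1 mulr_ge0 ?(ltW a0)//.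
by move=> /(_ isT isT); rewrite ler_pdivrMl.
Qed.

Lemma psi_small (e : R) : 0 < e ->
  exists2 d, 0 < d <= 1 & forall t, 0 <= t -> t <= d -> psi t < e.
Proof.
move=> e0; have /subspace_continuousP := @Psi_continuous _ psi.
move=> /(_ 0); rewrite /= in_itv/= lexx ler01 => /(_ isT).
move=> /(@cvgr_dist_lt _ _ _ _ _) => /(_ _ e0).
rewrite /prop_near1 /within/= => -[d /= d0 H].
exists (Num.min (d / 2) 1).
  by rewrite lt_min divr_gt0//= ltr01/= ge_min lexx orbT.
move=> t t0; rewrite le_min => /andP[td t1].
have := H t; rewrite /ball/= sub0r normrN ger0_norm// in_itv/= t0 t1.
rewrite /from_subspace Psi0 sub0r normrN ger0_norm ?psi_ge0 ?t0//; apply => //.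
by rewrite (le_lt_trans td)// ltr_pdivrMr// ltr_pMr// ltr1n.
Qed.

Lemma Psi_extE (t : R) : 0 <= t <= 1 -> Psi_ext psi t = psi t.
Proof.
case/andP=> t0 t1; rewrite /Psi_ext; congr (psi _).
by rewrite (min_idPl t1) (max_idPr t0).
Qed.

Lemma Psi_ext_le0 (t : R) : t <= 0 -> Psi_ext psi t = 0.
Proof.
move=> t0; rewrite /Psi_ext -[RHS](Psi0 psi); congr (psi _).
by rewrite (min_idPl _) ?(max_idPl _)// (le_trans t0).
Qed.

Lemma Psi_ext_continuous : continuous (Psi_ext psi : R -> R).
Proof.
move=> x.
pose clamp (t : R) := Num.max 0 (Num.min t 1).
have /subspace_continuousP/(_ _ (clamp01 x)) cpsi := @Psi_continuous _ psi.
apply: (@cvg_comp _ _ _ clamp psi _ _ _ _ cpsi) => A /= A01.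
have cclamp : {for x, continuous clamp}.
  apply: (@continuous_max _ _ (cst 0) (fun t : R => Num.min t 1)).
    exact: cvg_cst.
  by apply: (@continuous_min _ _ id (cst 1)); [exact: cvg_id|exact: cvg_cst].
have : nbhs x (fun t => `[0, 1]%classic (clamp t) -> A (clamp t)).
  exact: cclamp _ A01.
by apply: filterS => t; apply; exact: clamp01.
Qed.

Let LS := lebesgue_stieltjes_measure (Psi_ext psi).

Lemma stieltjes_oc (a b : R) : a <= b ->
  LS `]a, b] = (Psi_ext psi b - Psi_ext psi a)%:E.
Proof.
move=> ab; rewrite /LS /lebesgue_stieltjes_measure /measure_extension/= measurable_mu_extE/=.
  by rewrite wlength_itv_bnd.
exact: is_ocitv.
Qed.

(** The intervals ]a - h, a] have mass psi(a) - psi(a - h), which is small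
    because psi is continuous. Hence [0, v[ and ]0, v] have the same mass. *)
Lemma stieltjes_set1 (a : R) : LS [set a] = 0%E.
Proof.
apply/eqP; rewrite eq_le measure_ge0 andbT.
apply/lee_addgt0Pr => e e0; rewrite add0e.
have /cvgr_dist_lt/(_ _ e0) := Psi_ext_continuous (x := a).
move=> [d /= d0 H].
apply: (@le_trans _ _ (LS `]a - d / 2, a])).
  apply: le_measure; rewrite ?inE//.
  by move=> x /= ->; rewrite in_itv/= lexx andbT ltrBlDr ltrDl divr_gt0.
rewrite stieltjes_oc ?gerBl ?divr_ge0// ?(ltW d0)// lee_fin.
have := H (a - d / 2); rewrite /ball/= opprB addrCA subrr addr0.
rewrite gtr0_norm ?divr_gt0// ltr_pdivrMr// ltr_pMr// ltr1n => /(_ isT).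
by rewrite ltr_norml => /andP[_ /ltW].
Qed.

Lemma stieltjes_initial (v : R) : 0 <= v <= 1 -> LS `[0, v[ = (psi v)%:E.
Proof.
case/andP => v0 v1; transitivity (LS `]0, v]).
  have [->|v_gt0] := eqVneq v 0; first by rewrite set_itvco0 ?set_itvoc0.
  have {}v_gt0 : 0 < v by rewrite lt_neqAle eq_sym v_gt0.
  have E1 : `[0, v]%classic = `[0, v[%classic `|` [set v] :> set R.
    by rewrite setUitv1// bnd_simp.
  have E2 : `[0, v]%classic = 0 |` `]0, v]%classic :> set R.
    by rewrite setU1itv// bnd_simp.
  have H1 : LS `[0, v] = (LS `[0%R, v[ + LS [set v])%E.
    rewrite E1 /LS; apply: measureU => //.
    by apply/seteqP; split => x //= [H xv]; move: H; rewrite in_itv/= xv ltxx andbF.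
  have H2 : LS `[0, v] = (LS [set 0%R] + LS `]0%R, v])%E.
    rewrite E2 /LS; apply: measureU => //.
    by apply/seteqP; split => x //= [->]; rewrite in_itv/= ltxx.
  by move: H1; rewrite H2 !stieltjes_set1 adde0 add0e.
by rewrite stieltjes_oc// (Psi_ext_le0 (lexx 0)) subr0 Psi_extE// v0.
Qed.

End PsiFacts.

(** * Distribution functions and decreasing rearrangements *)

Section Distribution.
Variable R : realType.
Implicit Types (x y : R -> R) (s t : R) (A B : set R).

Let mu := @lebesgue_measure R.
Let D : set R := `[0, 1]%classic.

Lemma m01E A : m01 A = mu (D `&` A).
Proof. by rewrite /m01 /mrestr setIC. Qed.

Lemma m01_ge0 A : (0 <= m01 A)%E.
Proof. by rewrite m01E measure_ge0. Qed.

Lemma le_m01 A B : measurable (D `&` A) -> measurable (D `&` B) ->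
  A `&` D `<=` B -> (m01 A <= m01 B)%E.
Proof.
move=> mA mB AB; rewrite !m01E; apply: le_measure; rewrite ?inE//.
by move=> u [Du Au]; split => //; exact: AB.
Qed.

Lemma m01T : m01 setT = 1%E :> \bar R.
Proof. by rewrite m01E setIT /mu lebesgue_measure_itv/= lte_fin ltr01 sube0. Qed.

Lemma m01_le1 A : measurable (D `&` A) -> (m01 A <= 1)%E.
Proof.
move=> mA; rewrite -m01T; apply: le_m01 => //; rewrite setIT.
exact: measurable_itv.
Qed.

Definition prob A : R := fine (m01 A).

Lemma probE A : measurable (D `&` A) -> m01 A = (prob A)%:E.
Proof.
move=> mA; rewrite /prob fineK// ge0_fin_numE ?m01_ge0//.
by rewrite (le_lt_trans (m01_le1 mA))// ltry.
Qed.

Lemma prob_ge0 A : 0 <= prob A.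
Proof. by rewrite fine_ge0// m01_ge0. Qed.

Lemma prob_le1 A : measurable (D `&` A) -> prob A <= 1.
Proof. by move=> mA; rewrite -lee_fin -probE// m01_le1. Qed.

Lemma prob_01 A : measurable (D `&` A) -> 0 <= prob A <= 1.
Proof. by move=> mA; rewrite prob_ge0 prob_le1. Qed.

Lemma le_prob A B : measurable (D `&` A) -> measurable (D `&` B) ->
  A `&` D `<=` B -> prob A <= prob B.
Proof. by move=> mA mB AB; rewrite -lee_fin -!probE// le_m01. Qed.

Definition above x s : set R := [set u | s < `|x u|].

Lemma measurable_above x s : measurable_fun D x ->
  measurable (D `&` above x s).
Proof.
move=> mx; rewrite (_ : above x s = ((@Num.norm R R) \o x) @^-1` `]s, +oo[).
  have mn : measurable_fun D ((@Num.norm R R) \o x).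
    by apply: measurableT_comp mx; exact: normr_measurable.
  by apply: mn; exact: measurable_itv.
by apply/seteqP; split => u /=; rewrite in_itv/= andbT.
Qed.

Definition dist x s : R := prob (above x s).

Lemma distE x s : measurable_fun D x -> m01 (above x s) = (dist x s)%:E.
Proof. by move=> mx; rewrite probE//; exact: measurable_above. Qed.

Lemma dist_01 x s : measurable_fun D x -> 0 <= dist x s <= 1.
Proof. by move=> mx; rewrite prob_01//; exact: measurable_above. Qed.

Lemma le_dist x s t : measurable_fun D x -> s <= t -> dist x t <= dist x s.
Proof.
move=> mx st; apply: le_prob; [exact: measurable_above..|].
by move=> u [/= tu _]; exact: le_lt_trans tu.
Qed.

(** The distribution function is right-continuous, by continuity from below of
    the measure along the sets where |x| > s + 1/(n+1). *)
Lemma dist_rcont x s t : measurable_fun D x -> t < dist x s ->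
  exists2 s', s < s' & t < dist x s'.
Proof.
move=> mx ts; pose F n := D `&` above x (s + n.+1%:R^-1).
have mF n : measurable (F n) by exact: measurable_above.
have cF : bigcup setT F = D `&` above x s.
  apply/seteqP; split => u.
    by move=> [n _ [Du H]]; split => //; apply: lt_trans H; rewrite ltrDl.
  move=> [Du]; rewrite /above/= => su.
  have /ltr_add_invr[k] : s < `|x u| by [].
  by move=> H; exists k.
have ndF : nondecreasing_seq F.
  move=> m n mn; apply/subsetPset => u [Du /= H]; split => //=.
  by apply: le_lt_trans H; rewrite lerD2l lef_pV2 ?posrE ?ltr0n// ler_nat.
have mcF : measurable (\bigcup_n F n) by rewrite cF; exact: measurable_above.
have muF : mu (\bigcup_n F n) = (dist x s)%:E by rewrite cF -distE// m01E.
have cv : (fun n => (dist x (s + n.+1%:R^-1))%:E) n @[n --> \oo] --> (dist x s)%:E.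
  rewrite -muF (_ : (fun n => _) = mu \o F); first exact: nondecreasing_cvg_mu.
  by apply/funext => n; rewrite /= /F -m01E distE.
have {cv} := cv; move=> /fine_cvgP[_ /cvgr_gt/(_ _ ts)[n _ /(_ n (leqnn n)) /= H]].
by exists (s + n.+1%:R^-1) => //; rewrite ltrDl.
Qed.

(** The duality between x^* and the distribution function; right-continuity
    gives the strict inequality on the left. *)
Lemma rearrangement_gt x s t : measurable_fun D x -> 0 <= s ->
  (s%:E < rearrangement x t)%E = (t < dist x s).
Proof.
move=> mx s0; apply/idP/idP.
  rewrite !ltNge; apply: contra => H; apply: ereal_inf_lbound.
  by exists s => //; split => //; rewrite -/(above x s) distE// lee_fin.
move=> /(dist_rcont mx)[s' ss' ts'].
apply: (@lt_le_trans _ _ s'%:E); first by rewrite lte_fin.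
apply: le_ereal_inf_tmp => _ [r [r0 +]] <-.
rewrite -/(above x r) distE// !lee_fin => rt; rewrite leNgt; apply/negP => rs'.
by have := le_lt_trans (le_trans (le_dist mx (ltW rs')) rt) ts'; rewrite ltxx.
Qed.

Lemma rearrangement_ge0 x t : (0 <= rearrangement x t)%E.
Proof. by apply: le_ereal_inf_tmp => _ [r [r0 _]] <-; rewrite lee_fin. Qed.

Lemma measurable_rearrangement x : measurable_fun D x ->
  measurable_fun D (rearrangement x).
Proof.
move=> mx; apply: (measurability _ (ErealGenOInfty.measurableE R)).
move=> _ [_ [r ->] <-].
have [r0|r0] := leP 0 r.
  rewrite (_ : _ @^-1` _ = `]-oo, dist x r[%classic); first by apply: measurableI; exact: measurable_itv.
  by apply/seteqP; split => u /=; rewrite !in_itv/= ?andbT rearrangement_gt.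
rewrite (_ : _ @^-1` _ = setT); first by rewrite setIT; exact: measurable_itv.
apply/seteqP; split => u //= _; rewrite in_itv/= andbT.
by rewrite (lt_le_trans _ (rearrangement_ge0 x u))// lte_fin.
Qed.

Variable psi : Psi R.

(** The form of the Lorentz norm used throughout. Since s < x^*(t) exactly when
    t < m(|x| > s), the set where x^* exceeds s is an initial interval of
    d psi-measure psi(m(|x| > s)). *)
Lemma lorentzE x : measurable_fun D x ->
  lorentz_norm psi x = (\int[mu]_(s in `[0%R, +oo[) (psi (dist x s))%:E)%E.
Proof.
move=> mx; rewrite /lorentz_norm.
under eq_integral do rewrite -[rearrangement _ _]sube0.
rewrite (@layer_cake _ _ _ _ _ 0)//.
- apply: eq_integral => s; rewrite inE/= in_itv/= andbT => s0.
  rewrite -stieltjes_initial ?dist_01//; congr (lebesgue_stieltjes_measure _ _).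
  apply/seteqP; split => t /=; rewrite !in_itv/= rearrangement_gt//.
    by move=> [/andP[-> _] ->].
  move=> /andP[t0 td]; rewrite t0 td; split => //=.
  by rewrite (le_trans (ltW td))//; case/andP: (dist_01 s mx).
- exact: measurable_rearrangement.
- by move=> t _; exact: rearrangement_ge0.
Qed.

End Distribution.

(** * Elementary estimates of the Lorentz norm *)

Section NormBasics.
Variables (R : realType).
Implicit Types (x y z : R -> R) (s t : R).

Let mu := @lebesgue_measure R.
Let D : set R := `[0, 1]%classic.

Lemma integral_step (c a : R) : 0 <= c -> 0 <= a ->
  (\int[mu]_(s in `[0%R, +oo[) (c * \1_(`[0%R, a[%classic) s)%:E = (c * a)%:E)%E.
Proof.
move=> c0 a0; under eq_integral do rewrite EFinM.
rewrite ge0_integralZl_EFin//=.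
- rewrite integral_indic//=.
  rewrite (_ : _ `&` _ = `[0%R, a[%classic).
    rewrite lebesgue_measure_itv/= lte_fin; case: ifPn => [_|]; first by rewrite sube0.
    rewrite -leNgt => a0'; have -> : a = 0 by apply/eqP; rewrite eq_le a0 a0'.
    by rewrite mulr0 mule0.
  by apply/seteqP; split => s /=; rewrite !in_itv/= andbT;
    [move=> []|move=> /andP[-> ->]].
- by apply/measurable_EFinP; apply/measurable_funTS/measurable_indic.
Qed.

Lemma measurable_monotone_dist x (f : R -> R) (E : set R) :
  measurable_fun D x -> measurable E -> {in `[0, 1] &, {homo f : s t / s <= t}} ->
  measurable_fun E (fun s => (f (dist x s))%:E).
Proof.
move=> mx mE fnd; apply/measurable_EFinP; apply: nonincreasing_measurable => //.
by move=> s t st; apply: fnd; rewrite ?in_itv/= ?dist_01//; exact: le_dist.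
Qed.

Lemma measurable_dist x (E : set R) :
  measurable_fun D x -> measurable E -> measurable_fun E (fun s => (dist x s)%:E).
Proof. by move=> mx mE; exact: (@measurable_monotone_dist x id). Qed.

Lemma dist_small x (e : R) : measurable_fun D x -> 0 < e ->
  exists2 s : R, 0 <= s & dist x s < e.
Proof.
move=> mx e0; pose F (n : nat) := D `&` above x n%:R.
have mF n : measurable (F n) by exact: measurable_above.
have F0 : \bigcap_n F n = set0.
  apply/seteqP; split => // u /= H.
  have [_] := H (Num.bound `|x u|) I.
  rewrite /above/= => /lt_trans /(_ (archi_boundP _)).
  by rewrite ltxx => /(_ (normr_ge0 _)).
have muF n : mu (F n) = (dist x n%:R)%:E by rewrite -distE// m01E.
have niF : nonincreasing_seq F.
  move=> m n mn; apply/subsetPset => u [Du /= H]; split => //.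
  by apply: le_lt_trans H; rewrite ler_nat.
have cv : (fun n => (dist x n%:R)%:E) n @[n --> \oo] --> 0%:E.
  rewrite (_ : 0%:E = mu (\bigcap_n F n)); last by rewrite F0 /mu measure0.
  rewrite (_ : (fun n => _) = mu \o F).
    apply: nonincreasing_cvg_mu => //; last by rewrite F0.
    by change (mu (F 0%N) < +oo)%E; rewrite muF ltry.
  by apply/funext => n; rewrite /= muF.
have {}cv := cv; move: cv => /fine_cvgP[_ /cvgr_lt/(_ _ e0)[n _ /(_ n (leqnn n)) /= H]].
by exists n%:R.
Qed.

Lemma dist_eq0 x s : measurable_fun D x -> {in `[0, 1], forall u, `|x u| <= s} ->
  dist x s = 0.
Proof.
move=> mx xs; rewrite /dist /prob m01E (_ : _ `&` _ = set0) ?measure0//.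
apply/seteqP; split => // u /= [Du]; rewrite /above/= => su.
by move: (xs _ Du); rewrite leNgt su.
Qed.

Section Psi.
Variable psi : Psi R.
Local Notation N := (lorentz_norm psi).

Lemma measurable_psi_dist x (E : set R) :
  measurable_fun D x -> measurable E -> measurable_fun E (fun s => (psi (dist x s))%:E).
Proof.
by move=> mx mE; apply: measurable_monotone_dist => //; exact: Psi_nondecreasing.
Qed.

Lemma psi_dist_ge0 x s : measurable_fun D x -> 0 <= psi (dist x s).
Proof. by move=> mx; rewrite psi_ge0// dist_01. Qed.

Lemma lorentz_ge0 x : measurable_fun D x -> (0 <= N x)%E.
Proof.
move=> mx; rewrite lorentzE//; apply: integral_ge0 => s _.
by rewrite lee_fin psi_dist_ge0.
Qed.

Lemma lorentz_le x y : measurable_fun D x -> measurable_fun D y ->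
  (forall s, 0 <= s -> dist x s <= dist y s) -> (N x <= N y)%E.
Proof.
move=> mx my xy; rewrite !lorentzE//; apply: ge0_le_integral => //.
- by move=> s _; rewrite lee_fin psi_dist_ge0.
- exact: measurable_psi_dist.
- exact: measurable_psi_dist.
- move=> s /=; rewrite in_itv/= andbT => s0; rewrite lee_fin.
  have /andP[? ?] := dist_01 s mx; have /andP[? ?] := dist_01 s my.
  by rewrite psi_le// xy.
Qed.

Lemma lorentz_le_abs x y : measurable_fun D x -> measurable_fun D y ->
  {in `[0, 1], forall u, `|x u| <= `|y u|} -> (N x <= N y)%E.
Proof.
move=> mx my xy; apply: lorentz_le => // s s0.
apply: le_prob; [exact: measurable_above..|].
by move=> u [/= su Du]; apply: lt_le_trans su _; exact: xy.
Qed.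

(** The rearrangement x^* dominates the step of height a and width v. *)
Lemma lorentz_ge_level x (a v : R) : measurable_fun D x -> 0 <= a -> 0 <= v ->
  (forall s, 0 <= s -> s < a -> v <= dist x s) -> v <= 1 ->
  ((a * psi v)%:E <= N x)%E.
Proof.
move=> mx a0 v0 H v1; rewrite mulrC -integral_step ?psi_ge0 ?v0//.
rewrite lorentzE//; apply: ge0_le_integral => //.
- by move=> s _; rewrite lee_fin mulr_ge0 ?psi_ge0 ?v0.
- exact/measurable_EFinP/measurable_funM.
- exact: measurable_psi_dist.
- move=> s /=; rewrite in_itv/= andbT => s0; rewrite lee_fin indicE.
  rewrite mem_setE in_itv/= s0/=.
  have [sa|_] := ltP s a; last by rewrite mulr0 psi_dist_ge0.
  rewrite mulr1.
  by rewrite psi_le// ?H//; have /andP[] := dist_01 s mx.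
Qed.

(** The layers below height T have measure at most m(x <> 0), those between T
    and M at most m(|x| > T), and there are none above M. Choosing T well turns
    a tail estimate into a norm estimate. *)
Lemma lorentz_bounded x (T M : R) : measurable_fun D x -> 0 <= T -> 0 <= M ->
  {in `[0, 1], forall u, `|x u| <= M} ->
  (N x <= (T * psi (dist x 0) + M * psi (dist x T))%:E)%E.
Proof.
move=> mx T0 M0 xM; have psi0 s : 0 <= psi (dist x s) by exact: psi_dist_ge0.
rewrite EFinD 2!(mulrC _ (psi _)) -!integral_step//.
rewrite -ge0_integralD//=; first last.
- exact/measurable_EFinP/measurable_funM.
- by move=> s _; rewrite lee_fin mulr_ge0.
- exact/measurable_EFinP/measurable_funM.
- by move=> s _; rewrite lee_fin mulr_ge0.
rewrite lorentzE//; apply: ge0_le_integral => //.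
- by move=> s _; rewrite lee_fin.
- exact: measurable_psi_dist.
- by apply: emeasurable_funD; apply/measurable_EFinP/measurable_funM.
move=> s /=; rewrite in_itv/= andbT => s0; rewrite -EFinD lee_fin.
have psi_s r : r <= s -> psi (dist x s) <= psi (dist x r).
  move=> rs; have /andP[? ?] := dist_01 s mx; have /andP[? ?] := dist_01 r mx.
  by rewrite psi_le//; exact: le_dist.
rewrite !indicE !mem_setE !in_itv/= s0/=; have [sT|Ts] := ltP s T.
  by rewrite mulr1 (le_trans (psi_s 0 s0))// lerDl mulr_ge0.
rewrite mulr0 add0r; have [sM|Ms] := ltP s M; first by rewrite mulr1 psi_s.
rewrite mulr0 (dist_eq0 mx) ?Psi0//.
by move=> u Du; rewrite (le_trans _ Ms)// xM.
Qed.

Lemma lorentz_le_cst x (M : R) : measurable_fun D x -> 0 <= M ->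
  {in `[0, 1], forall u, `|x u| <= M} -> (N x <= (M * psi 1)%:E)%E.
Proof.
move=> mx M0 xM; apply: (le_trans (lorentz_bounded mx M0 M0 xM)).
rewrite (dist_eq0 mx xM) Psi0 mulr0 addr0 lee_fin ler_wpM2l// psi_le//;
  by have /andP[] := dist_01 0 mx.
Qed.

Lemma lorentz_cst (c : R) : (N (cst c) <= (`|c| * psi 1)%:E)%E.
Proof. by apply: lorentz_le_cst => // u _. Qed.

End Psi.
End NormBasics.

(** * The K-functional between the integrable and the bounded functions *)

Section KFunctional.
Variables (R : realType).
Implicit Types (x y z : R -> R) (s t b c : R).

Let mu := @lebesgue_measure R.
Let D : set R := `[0, 1]%classic.
Let mD : measurable D. Proof. exact: measurable_itv. Qed.

(** The distance from x to the ball of radius c of the bounded functions, in the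
    norm of the integrable functions. *)
Definition excess x c : \bar R := (\int[mu]_(t in D) (Num.max (`|x t| - c) 0)%:E)%E.

Lemma measurable_excess x c : measurable_fun D x ->
  measurable_fun D (fun t => (Num.max (`|x t| - c) 0)%:E).
Proof.
move=> mx; apply/measurable_EFinP; apply: measurable_maxr => //.
by apply: measurable_funB => //; apply: measurableT_comp mx; exact: normr_measurable.
Qed.

Lemma excessE x c : measurable_fun D x ->
  excess x c = (\int[mu]_(s in `[c, +oo[) (dist x s)%:E)%E.
Proof.
move=> mx; pose f t := (Num.max `|x t| c)%:E.
transitivity (\int[mu]_(t in D) (f t - c%:E))%E.
  apply: eq_integral => t _; rewrite /f -EFinB; congr EFin.
  by rewrite addr_maxl subrr.
rewrite layer_cake//; last first.
- by move=> t _; rewrite /f lee_fin le_max lexx orbT.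
- apply/measurable_EFinP; apply: measurable_maxr => //.
  by apply: measurableT_comp mx; exact: normr_measurable.
apply: eq_integral => s; rewrite inE/= in_itv/= andbT => cs.
rewrite -distE// m01E; congr (mu _); congr (_ `&` _).
apply/seteqP; split => t; rewrite /above /f/= lte_fin lt_max.
  by rewrite orbC ltNge cs.
by move=> ->.
Qed.

(** Pointwise, (|x + y| - c - d)_+ <= (|x| - c)_+ + (|y| - d)_+. *)
Lemma excess_sub x y c d : measurable_fun D x -> measurable_fun D y ->
  (excess (fun t => x t + y t)%R (c + d)%R <= excess x c + excess y d)%E.
Proof.
move=> mx my; rewrite /excess -ge0_integralD//.
- apply: ge0_le_integral => //.
  + by move=> t _; rewrite lee_fin le_max lexx orbT.
  + by apply: measurable_excess; exact: measurable_funD.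
  + by apply: emeasurable_funD; exact: measurable_excess.
  + move=> t _; rewrite -EFinD lee_fin ge_max.
    have h1 : `|x t| - c <= Num.max (`|x t| - c) 0 by rewrite le_max lexx.
    have h2 : `|y t| - d <= Num.max (`|y t| - d) 0 by rewrite le_max lexx.
    have h3 : 0 <= Num.max (`|x t| - c) 0 by rewrite le_max lexx orbT.
    have h4 : 0 <= Num.max (`|y t| - d) 0 by rewrite le_max lexx orbT.
    by have := ler_normD (x t) (y t); lra.
- by move=> t _; rewrite lee_fin le_max lexx orbT.
- exact: measurable_excess.
- by move=> t _; rewrite lee_fin le_max lexx orbT.
- exact: measurable_excess.
Qed.

(** The integral of x^* over [0, b], by the layer-cake formula. It is the Lorentz
    norm for psi(v) = min(v, b), of which every concave function is a limit of
    positive combinations. *)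
Definition Kfun x b : \bar R :=
  (\int[mu]_(s in `[0%R, +oo[) (Num.min (dist x s) b)%:E)%E.

Lemma measurable_min_dist x b (E : set R) : measurable_fun D x -> measurable E ->
  measurable_fun E (fun s => (Num.min (dist x s) b)%:E).
Proof.
move=> mx mE; apply: (@measurable_monotone_dist _ x (fun v => Num.min v b)) => //.
by move=> s t _ _ st; rewrite le_min ge_min st ge_min lexx orbT.
Qed.

Lemma min_dist_ge0 x b s : 0 <= b -> (0 <= (Num.min (dist x s) b)%:E)%E.
Proof. by move=> b0; rewrite lee_fin le_min prob_ge0. Qed.

Lemma Kfun_split x b c : measurable_fun D x -> 0 <= b -> 0 <= c ->
  (Kfun x b = \int[mu]_(s in `[0%R, c[) (Num.min (dist x s) b)%:E +
              \int[mu]_(s in `[c, +oo[) (Num.min (dist x s) b)%:E)%E.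
Proof.
move=> mx b0 c0; rewrite /Kfun -ge0_integral_setU//.
- congr integral; apply/seteqP; split => s /=; rewrite !in_itv/= !andbT.
    by move=> ->; case: (ltP s c); [left|right].
  by case=> [/andP[]//|]; exact: le_trans.
- by apply: measurable_min_dist => //; exact: measurableU.
- by move=> s _; exact: min_dist_ge0.
- apply/disj_setPS => s /=; rewrite !in_itv/= andbT => -[/andP[_ +] /le_lt_trans h].
  by move/h; rewrite ltxx.
Qed.

Lemma integral_cst_initial b c : 0 <= c ->
  (\int[mu]_(s in `[0%R, c[) b%:E = (b * c)%:E)%E.
Proof.
move=> c0; rewrite integral_cst//= lebesgue_measure_itv/= lte_fin EFinM.
by case: ltgtP c0 => // [_|<-] _; rewrite ?sube0.
Qed.

(** The easy half of K(x, b) = min over c of (b c + excess x c): below height c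
    the integrand is at most b, above it at most m(|x| > s). *)
Lemma Kfun_le x b c : measurable_fun D x -> 0 <= b -> 0 <= c ->
  (Kfun x b <= (b * c)%:E + excess x c)%E.
Proof.
move=> mx b0 c0; rewrite (Kfun_split mx b0 c0) excessE//; apply: leeD.
  apply: (@le_trans _ _ (\int[mu]_(s in `[0%R, c[) b%:E)%E).
    apply: ge0_le_integral => //.
    - by move=> s _; exact: min_dist_ge0.
    - exact: measurable_min_dist.
    - by move=> s _; rewrite lee_fin ge_min lexx orbT.
  by rewrite integral_cst_initial.
apply: ge0_le_integral => //.
- by move=> s _; exact: min_dist_ge0.
- exact: measurable_min_dist.
- exact: measurable_dist.
- by move=> s _; rewrite lee_fin ge_min lexx.
Qed.

(** The minimum in the formula for K(x, b) is attained at c = x^*(b), because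
    m(|x| > s) exceeds b exactly below that height. *)
Lemma Kfun_attained x b : measurable_fun D x -> 0 < b ->
  exists2 c : R, 0 <= c & Kfun x b = ((b * c)%:E + excess x c)%E.
Proof.
move=> mx b0; pose S := [set s : R | 0 <= s /\ dist x s <= b].
have [s0 s00 ds0] := dist_small mx b0.
have Ss0 : S s0 by split => //; exact: ltW.
have lS : lbound S 0 by move=> s [].
have iS : has_inf S by split; [exists s0|exists 0].
pose c := inf S; have c0 : 0 <= c by apply: lb_le_inf => //; exists s0.
have ltc s : 0 <= s -> s < c -> b < dist x s.
  move=> s0' sc; rewrite ltNge; apply/negP => H.
  by move: sc; rewrite ltNge (ge_inf _ (_ : S s))//; case: iS.
have gec s : c <= s -> dist x s <= b.
  move=> cs; rewrite leNgt; apply/negP => /(dist_rcont mx)[s' ss' bs'].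
  have [r [r0 rb] rs'] := inf_lt (proj1 iS) (le_lt_trans cs ss').
  by have := lt_le_trans bs' (le_trans (le_dist mx (ltW rs')) rb); rewrite ltxx.
exists c => //; rewrite (Kfun_split mx (ltW b0) c0) excessE//; congr (_ + _)%E.
  transitivity (\int[mu]_(s in `[0%R, c[) b%:E)%E.
    apply: eq_integral => s; rewrite inE/= in_itv/= => /andP[s0' sc].
    by congr EFin; apply/min_idPr/ltW/ltc.
  by rewrite integral_cst_initial.
apply: eq_integral => s; rewrite inE/= in_itv/= andbT => cs.
by congr EFin; apply/min_idPl/gec.
Qed.

(** Take the optimal heights c and d for x and y: the height c + d is admissible
    for x + y. *)
Lemma Kfun_subadditive x y b : measurable_fun D x -> measurable_fun D y ->
  0 < b -> (Kfun (fun t => x t + y t)%R b <= Kfun x b + Kfun y b)%E.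
Proof.
move=> mx my b0.
have [c c0 ->] := Kfun_attained mx b0; have [d d0 ->] := Kfun_attained my b0.
apply: (le_trans (Kfun_le _ (ltW b0) (addr_ge0 c0 d0))).
  exact: measurable_funD.
rewrite mulrDr EFinD [leRHS]addeACA; apply: leeD => //.
exact: excess_sub.
Qed.

End KFunctional.

(** * Piecewise linear interpolation of a concave function *)

Section PiecewiseLinear.
Variables (R : realType) (psi : Psi R).
Implicit Types (n j : nat) (v : R).

(** The slopes of the piecewise linear interpolation of psi at the nodes j/n;
    the value 0 past the last node makes the Abel summation below close up. *)
Definition slope n j : R :=
  if (j < n)%N then n%:R * (psi (j.+1%:R / n%:R) - psi (j%:R / n%:R)) else 0.

(** The piecewise linear interpolation of psi, written as a combination of the
    functions min(v, b); concavity of psi is what makes the coefficients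
    nonnegative. *)
Definition interp n v : R :=
  \sum_(j < n) (slope n j - slope n j.+1) * Num.min v (j.+1%:R / n%:R).

Lemma node_01 n j : (j <= n)%N -> (0 < n)%N -> 0 <= (j%:R / n%:R : R) <= 1.
Proof.
move=> jn n0; rewrite divr_ge0//= ler_pdivrMr ?ltr0n// mul1r ler_nat//.
Qed.

Lemma slope_ge0 n j : 0 <= slope n j.
Proof.
rewrite /slope; case: ifPn => // jn; have n0 := leq_ltn_trans (leq0n j) jn.
have /andP[? _] := node_01 (ltnW jn) n0; have /andP[_ ?] := node_01 jn n0.
rewrite mulr_ge0// subr_ge0 psi_le//.
by rewrite ler_pM2r ?invr_gt0 ?ltr0n// ler_nat.
Qed.

Lemma slope_decr n j : slope n j.+1 <= slope n j.
Proof.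
rewrite {1}/slope; case: ifPn => [jn|_]; last exact: slope_ge0.
rewrite /slope (ltnW jn) ler_wpM2l//.
have n0 := leq_ltn_trans (leq0n _) jn.
have := @Psi_concave _ psi (1/2) (j%:R / n%:R) (j.+2%:R / n%:R).
rewrite !in_itv/= !node_01// 1?ltnW// 1?ltnW//.
move=> /(_ _ isT isT) H.
have -> : psi (j.+1%:R / n%:R) = psi (1 / 2 * (j%:R / n%:R) + (1 - 1 / 2) * (j.+2%:R / n%:R)).
  congr (psi _); rewrite -addn2 -(addn1 j) !natrD; field.
  by rewrite pnatr_eq0 -lt0n.
have h : 0 <= 1 / 2 :> R by lra.
have h' : 1 / 2 <= 1 :> R by lra.
by move: (H (introT andP (conj h h'))); lra.
Qed.

Lemma abel_sum (s m : nat -> R) k : m 0%N = 0 ->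
  \sum_(j < k) (s j - s j.+1) * m j.+1 =
  \sum_(j < k) s j * (m j.+1 - m j) - s k * m k.
Proof.
move=> m0; elim: k => [|k IH]; first by rewrite !big_ord0 m0 mulr0 subr0.
rewrite !big_ord_recr/= IH; ring.
Qed.

Lemma interpE n v : 0 <= v -> interp n v =
  \sum_(j < n) slope n j * (Num.min v (j.+1%:R / n%:R) - Num.min v (j%:R / n%:R)).
Proof.
move=> v0; rewrite /interp (abel_sum _ (m := fun j => Num.min v (j%:R / n%:R))).
  by rewrite {2}/slope ltnn mul0r subr0.
by rewrite mul0r; apply/min_idPr.
Qed.

Lemma interp_term_le n j v : (j < n)%N -> 0 <= v <= 1 ->
  slope n j * (Num.min v (j.+1%:R / n%:R) - Num.min v (j%:R / n%:R)) <=
  psi (Num.min v (j.+1%:R / n%:R)) - psi (Num.min v (j%:R / n%:R)).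
Proof.
move=> jn /andP[v0 v1]; have n0 := leq_ltn_trans (leq0n _) jn.
have n0' : 0 < n%:R :> R by rewrite ltr0n.
have le12 : j%:R / n%:R <= j.+1%:R / n%:R :> R.
  by rewrite ler_pM2r ?invr_gt0// ler_nat.
have [vj|jv] := leP v (j%:R / n%:R).
  by rewrite !(min_idPl _) ?subrr ?mulr0// (le_trans vj).
have [jv'|vj'] := leP (j.+1%:R / n%:R) v.
  rewrite /slope jn -natr1.
  set p1 := psi _; set p0 := psi _.
  rewrite le_eqVlt; apply/orP; left; apply/eqP; field.
  by rewrite gt_eqF.
pose th := n%:R * v - j%:R.
have th01 : 0 <= th <= 1.
  move: jv vj'; rewrite ltr_pdivrMr// ltr_pdivlMr// -natr1 /th; lra.
have := @Psi_concave _ psi th (j.+1%:R / n%:R) (j%:R / n%:R).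
rewrite !in_itv/= th01 !node_01// 1?ltnW// => /(_ isT isT isT).
have -> : th * (j.+1%:R / n%:R) + (1 - th) * (j%:R / n%:R) = v.
  by rewrite /th -natr1; field; rewrite gt_eqF.
rewrite /slope jn; set p1 := psi (j.+1%:R / _); set p0 := psi (j%:R / _) => H.
have -> : n%:R * (p1 - p0) * (v - j%:R / n%:R) = th * (p1 - p0).
  by rewrite /th; field; rewrite gt_eqF.
by rewrite lerBrDr; move: H; lra.
Qed.

(** Each interval between two nodes contributes at most the increment of psi,
    since a concave function lies above its chords. *)
Lemma interp_le n v : (0 < n)%N -> 0 <= v <= 1 -> interp n v <= psi v.
Proof.
move=> n0 v01; rewrite interpE; last by case/andP: v01.
apply: (@le_trans _ _ (\sum_(j < n) (psi (Num.min v (j.+1%:R / n%:R)) - psi (Num.min v (j%:R / n%:R))))).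
  by apply: ler_sum => j _; exact: interp_term_le.
rewrite -(big_mkord xpredT (fun j => psi (Num.min v (j.+1%:R / n%:R)) - psi (Num.min v (j%:R / n%:R)))).
rewrite telescope_sumr// mul0r divff ?pnatr_eq0 -?lt0n//.
case/andP: v01 => v0 v1; rewrite (min_idPl v1) (min_idPr v0) Psi0 subr0//.
Qed.

Lemma psi_subadd (a b : R) : 0 <= a -> 0 <= b -> a + b <= 1 ->
  psi (a + b) <= psi a + psi b.
Proof.
move=> a0 b0 ab1; have [->|ab] := eqVneq (a + b) 0.
  by rewrite Psi0 addr_ge0// psi_ge0// ?a0 ?b0/= (le_trans _ ab1)// ?lerDl ?lerDr.
have {}ab : 0 < a + b by rewrite lt_neqAle eq_sym ab addr_ge0.
have H c : 0 <= c -> c <= a + b -> c / (a + b) * psi (a + b) <= psi c.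
  move=> c0 cab; have := @psi_scale _ psi (c / (a + b)) (a + b).
  rewrite divfK ?gt_eqF//; apply; last by rewrite ltW.
  by rewrite divr_ge0 ?(ltW ab)//= ler_pdivrMr// mul1r.
apply: (le_trans _ (lerD (H a a0 _) (H b b0 _))); rewrite ?lerDl ?lerDr//.
by rewrite -mulrDl -mulrDl divff ?gt_eqF// mul1r.
Qed.

(** The interpolation agrees with psi at the node below v, and psi grows by at
    most psi(1/n) from that node to v. *)
Lemma interp_ge n v : (0 < n)%N -> 0 <= v <= 1 ->
  psi v <= interp n v + psi n%:R^-1.
Proof.
move=> n0 /andP[v0 v1]; have n0' : 0 < n%:R :> R by rewrite ltr0n.
pose k := Num.truncn (n%:R * v).
have nv0 : 0 <= n%:R * v by rewrite mulr_ge0// ltW.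
have /andP[k1 k2] : k%:R <= n%:R * v < k.+1%:R by exact: truncn_itv.
have kn : (k <= n)%N by rewrite -(ler_nat R) (le_trans k1)// ler_piMr// ltW.
have kv : k%:R / n%:R <= v by rewrite ler_pdivrMr// mulrC.
have H : psi (k%:R / n%:R) <= interp n v.
  rewrite interpE//.
  have -> : psi (k%:R / n%:R) = \sum_(j < n) (if (j < k)%N then psi (j.+1%:R / n%:R) - psi (j%:R / n%:R) else 0).
    rewrite -big_mkcond/= (big_ord_narrow kn)/=.
    rewrite -(big_mkord xpredT (fun j => psi (j.+1%:R / n%:R) - psi (j%:R / n%:R))).
    by rewrite telescope_sumr// mul0r Psi0 subr0.
  apply: ler_sum => j _; case: ifPn => [jk|_].
    have jn := ltn_ord j.
    have le1 : j.+1%:R / n%:R <= v.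
      by rewrite (le_trans _ kv)// ler_pM2r ?invr_gt0// ler_nat.
    have le0 : j%:R / n%:R <= v.
      by rewrite (le_trans _ le1)// ler_pM2r ?invr_gt0// ler_nat.
    rewrite (min_idPr le1) (min_idPr le0) /slope jn -natr1.
    set p1 := psi _; set p0 := psi _.
    rewrite le_eqVlt; apply/orP; left; apply/eqP; field.
    by rewrite gt_eqF.
  rewrite mulr_ge0 ?slope_ge0// subr_ge0 le_min ge_min lexx/= ge_min.
  by rewrite [X in _ || X]ler_pM2r ?invr_gt0// ler_nat leqnSn orbT.
apply: (le_trans _ (lerD H (lexx _))).
have -> : psi v = psi (k%:R / n%:R + (v - k%:R / n%:R)) by congr (psi _); ring.
apply: (le_trans (psi_subadd _ _ _)).
- by rewrite divr_ge0// ltW.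
- by rewrite subr_ge0.
- by rewrite addrC subrK.
rewrite lerD2l psi_le// ?subr_ge0//.
  have -> : v - k%:R / n%:R = (n%:R * v - k%:R) / n%:R.
    by field; rewrite gt_eqF.
  by rewrite ler_pdivrMr// mulVf ?gt_eqF// lerBlDr addrC natr1 ltW.
by rewrite invf_le1// ler1n.
Qed.

End PiecewiseLinear.

(** * The triangle inequality *)

Section Triangle.
Variables (R : realType) (psi : Psi R).
Implicit Types (x y z : R -> R) (n : nat).

Let mu := @lebesgue_measure R.
Let D : set R := `[0, 1]%classic.
Let mD : measurable D. Proof. exact: measurable_itv. Qed.
Local Notation N := (lorentz_norm psi).

Let interp_norm n x : \bar R :=
  (\int[mu]_(s in `[0%R, +oo[) (interp psi n (dist x s))%:E)%E.

Lemma interp_homo n : {in `[0, 1] &, {homo interp psi n : s t / s <= t}}.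
Proof.
move=> s t _ _ st; apply: ler_sum => j _; rewrite ler_wpM2l ?subr_ge0 ?slope_decr//.
by rewrite le_min ge_min st/= ge_min lexx orbT.
Qed.

Lemma interp_ge0 n (v : R) : 0 <= v -> 0 <= interp psi n v.
Proof.
move=> v0; apply: sumr_ge0 => j _; rewrite mulr_ge0 ?subr_ge0 ?slope_decr//.
by rewrite le_min v0 divr_ge0.
Qed.

Lemma interp_normE n x : measurable_fun D x ->
  interp_norm n x =
  (\sum_(j < n) (slope psi n j - slope psi n j.+1)%:E * Kfun x (j.+1%:R / n%:R))%E.
Proof.
move=> mx; rewrite /interp_norm /interp.
under eq_integral do rewrite -sumEFin.
rewrite ge0_integral_sum//.
- apply: eq_bigr => j _; under eq_integral do rewrite EFinM.
  rewrite ge0_integralZl_EFin ?subr_ge0 ?slope_decr//.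
  + by move=> s _; apply: min_dist_ge0; rewrite divr_ge0.
  + exact: measurable_min_dist.
- move=> j; apply/measurable_EFinP/measurable_funM => //.
  by apply/measurable_EFinP; exact: measurable_min_dist.
- move=> j s _; rewrite lee_fin mulr_ge0 ?subr_ge0 ?slope_decr//.
  by rewrite -lee_fin; apply: min_dist_ge0; rewrite divr_ge0.
Qed.

Lemma interp_norm_sub n x y : measurable_fun D x -> measurable_fun D y ->
  (0 < n)%N ->
  (interp_norm n (fun t => x t + y t)%R <= interp_norm n x + interp_norm n y)%E.
Proof.
move=> mx my n0; rewrite !interp_normE//; last exact: measurable_funD.
rewrite -big_split/=; apply: lee_sum => j _.
have sl : (0 <= (slope psi n j - slope psi n j.+1)%:E)%E.
  by rewrite lee_fin subr_ge0 slope_decr.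
rewrite -ge0_muleDr.
- apply: lee_wpmul2l => //; apply: Kfun_subadditive => //.
  by rewrite divr_gt0 ?ltr0n.
- by apply: integral_ge0 => s _; apply: min_dist_ge0; rewrite divr_ge0.
- by apply: integral_ge0 => s _; apply: min_dist_ge0; rewrite divr_ge0.
Qed.

Lemma interp_norm_le n x : measurable_fun D x -> (0 < n)%N ->
  (interp_norm n x <= N x)%E.
Proof.
move=> mx n0; rewrite lorentzE//; apply: ge0_le_integral => //.
- by move=> s _; rewrite lee_fin interp_ge0// prob_ge0.
- by apply: measurable_monotone_dist => //; exact: interp_homo.
- exact: measurable_psi_dist.
- by move=> s _; rewrite lee_fin interp_le// dist_01.
Qed.

Lemma interp_cvg (v : R) : 0 <= v <= 1 ->
  interp psi n.+1 v @[n --> \oo] --> psi v.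
Proof.
move=> v01; apply/cvgrPdist_lt => e e0.
have [d /andP[d0 _] H] := psi_small psi e0.
exists (Num.bound d^-1) => // n /= nd.
have h1 := @interp_le _ psi n.+1 v isT v01.
have h2 := @interp_ge _ psi n.+1 v isT v01.
rewrite ger0_norm ?subr_ge0// ltrBlDl (le_lt_trans h2)// ltrD2l H//.
rewrite -[leRHS]invrK lef_pV2 ?posrE ?invr_gt0// ltW//.
rewrite (lt_le_trans (archi_boundP _)) ?invr_ge0 ?(ltW d0)// ler_nat.
by rewrite (leq_trans nd).
Qed.

(** The functionals attached to the interpolations of psi are positive
    combinations of K-functionals, hence subadditive, and bounded by the norm;
    Fatou's lemma recovers the norm of the sum from them. *)
Lemma lorentz_triangle x y : measurable_fun D x -> measurable_fun D y ->
  (N (fun t => x t + y t)%R <= N x + N y)%E.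
Proof.
move=> mx my; set z := fun t => _.
have mz : measurable_fun D z by exact: measurable_funD.
pose f n s := (interp psi n.+1 (dist z s))%:E.
apply: (@le_trans _ _ (\int[mu]_(s in `[0%R, +oo[) limn_einf (f^~ s))%E).
  rewrite lorentzE// le_eqVlt; apply/orP; left; apply/eqP.
  apply: eq_integral => s _.
  have cv : f^~ s n @[n --> \oo] --> (psi (dist z s))%:E.
    by apply: cvg_EFin; [near=> n|apply: interp_cvg; exact: dist_01].
  rewrite is_cvg_limn_einfE//; last by apply/cvg_ex; eexists; exact: cv.
  by apply/esym/cvg_lim.
apply: (le_trans (fatou _ _ _ _)) => //.
- by move=> n; apply: measurable_monotone_dist => //; exact: interp_homo.
- by move=> n s _; rewrite lee_fin interp_ge0// prob_ge0.
rewrite limn_einf_lim; apply: lime_le; first exact: is_cvg_einfs.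
apply: nearW => n; apply: (@le_trans _ _ (interp_norm n.+1 z)).
  by apply: ereal_inf_lbound; exists n => //=.
apply: (le_trans (interp_norm_sub mx my _)) => //.
by apply: leeD; exact: interp_norm_le.
Unshelve. all: by end_near. Qed.

End Triangle.

(** * Means and truncations *)

Section Mean.
Variables (R : realType).
Implicit Types (x y z : R -> R) (s t c : R).

Let mu := @lebesgue_measure R.
Let D : set R := `[0, 1]%classic.
Let mD : measurable D. Proof. exact: measurable_itv. Qed.

Definition l1 x := (@lebesgue_measure R).-integrable (`[0, 1]%classic : set R) (EFin \o x).

Definition mean x : R := \int[@lebesgue_measure R]_(t in `[0, 1]) x t.

Lemma l1_bounded x (M : R) : measurable_fun D x ->
  {in `[0, 1], forall u, `|x u| <= M} -> l1 x.
Proof.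
move=> mx xM; apply: measurable_bounded_integrable => //.
  by rewrite /= lebesgue_measure_itv/= lte_fin ltr01 ltry.
exists M; split; first exact: num_real.
by move=> M' MM' u /= Du; rewrite (le_trans _ (ltW MM'))// xM.
Qed.

Lemma meanD x y : l1 x -> l1 y -> mean (fun t => x t + y t) = mean x + mean y.
Proof. by move=> ix iy; rewrite /mean RintegralD. Qed.

Lemma l1D x y : l1 x -> l1 y -> l1 (fun t => x t + y t).
Proof.
move=> ix iy; rewrite /l1 (_ : _ \o _ = (EFin \o x) \+ (EFin \o y)) //.
exact: integrableD.
Qed.

Lemma meanZ x c : l1 x -> mean (fun t => c * x t) = c * mean x.
Proof. by move=> ix; rewrite /mean RintegralZl. Qed.

Lemma l1Z x c : l1 x -> l1 (fun t => c * x t).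
Proof.
move=> ix; rewrite /l1 (_ : _ \o _ = (fun t => c%:E * (EFin \o x) t)%E) //.
exact: integrableZl.
Qed.

Lemma l1_cst c : l1 (cst c).
Proof. by apply: (@l1_bounded _ `|c|). Qed.

Lemma mean_cst c : mean (cst c) = c.
Proof.
by rewrite /mean Rintegral_cst//= lebesgue_measure_itv/= lte_fin ltr01 sube0 mulr1.
Qed.

Lemma mean_le x y : l1 x -> l1 y -> {in `[0, 1], forall t, x t <= y t} ->
  mean x <= mean y.
Proof. by move=> ix iy xy; apply: le_Rintegral. Qed.

Lemma mean_indic (A : set R) : measurable (D `&` A) -> mean \1_A = prob A.
Proof.
move=> mA; rewrite /mean /prob m01E /Rintegral; congr fine.
rewrite (_ : D `&` A = (D `&` A) `&` D); last by rewrite setIAC setIid.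
rewrite -integral_indic//; apply: eq_integral => t; rewrite inE => Dt.
by rewrite !indicE in_setI (mem_set Dt).
Qed.

Section Psi.
Variable psi : Psi R.
Local Notation N := (lorentz_norm psi).

(** The integral of |x| is the integral of its distribution function, and
    t psi(1) <= psi(t). *)
Lemma lorentz_dom_l1 x : measurable_fun D x ->
  ((psi 1)%:E * \int[mu]_(t in D) `|x t|%:E <= N x)%E.
Proof.
move=> mx; have -> : (\int[mu]_(t in D) `|x t|%:E = excess x 0)%E.
  by apply: eq_integral => t _; rewrite subr0; congr EFin; apply/esym/max_idPl.
rewrite excessE// lorentzE// -ge0_integralZl_EFin//.
- apply: ge0_le_integral => //.
  + by move=> s _; rewrite lee_fin mulr_ge0 ?prob_ge0 ?psi_ge0// lexx ler01.
  + by apply/measurable_EFinP/measurable_funM => //; apply/measurable_EFinP; exact: measurable_dist.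
  + exact: measurable_psi_dist.
  + by move=> s _; rewrite -EFinM lee_fin mulrC psi_id_le// dist_01.
- by move=> s _; rewrite lee_fin prob_ge0.
- exact: measurable_dist.
- by rewrite psi_ge0// lexx ler01.
Qed.

Lemma psi1_gt0 : 0 < psi 1. Proof. by rewrite psi_gt0// lexx ltr01. Qed.

Lemma fspace_l1 x : fspace N x -> l1 x.
Proof.
move=> [mx Nx]; apply/integrableP; split; first exact/measurable_EFinP.
rewrite ltey; apply/eqP => Ey; have := lorentz_dom_l1 mx.
rewrite -[X in (_ * X)%E]/(\int[mu]_(t in D) `|(EFin \o x) t|)%E Ey.
by rewrite gt0_muley ?lte_fin ?psi1_gt0// leye_eq => /eqP E; move: Nx; rewrite E ltxx.
Qed.

Lemma lorentz_dom_mean x : fspace N x -> ((psi 1 * `|mean x|)%:E <= N x)%E.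
Proof.
move=> fx; have ix := fspace_l1 fx; have [mx _] := fx.
apply: le_trans (lorentz_dom_l1 mx); rewrite EFinM lee_pmul2l//; last first.
  by rewrite lte_fin psi1_gt0.
rewrite /mean EFin_normr_Rintegral//.
by apply: le_abse_integral => //; exact/measurable_EFinP.
Qed.

Lemma lorentz0 : N (fun=> 0) = 0%E.
Proof.
apply/eqP; rewrite eq_le lorentz_ge0// andbT.
by have := lorentz_cst psi 0; rewrite normr0 mul0r.
Qed.

Lemma measurable_sum01 (y : nat -> R -> R) n :
  (forall k, measurable_fun D (y k)) -> measurable_fun D (fun t => \sum_(k < n) y k t).
Proof. by move=> my; apply: measurable_sum => k. Qed.

Lemma lorentz_sum (y : nat -> R -> R) n : (forall k, measurable_fun D (y k)) ->
  (N (fun t => \sum_(k < n) y k t)%R <= \sum_(k < n) N (y k))%E.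
Proof.
move=> my; elim: n => [|n IH].
  by under eq_fun do rewrite big_ord0; rewrite big_ord0 lorentz0.
under eq_fun do rewrite big_ord_recr/=; rewrite big_ord_recr/=.
apply: (le_trans (lorentz_triangle _ _ _)) => //; first exact: measurable_sum01.
by rewrite leeD2r.
Qed.

Lemma fspace_sum (y : nat -> R -> R) n : (forall k, fspace N (y k)) ->
  fspace N (fun t => \sum_(k < n) y k t).
Proof.
move=> fy; split; first by apply: measurable_sum01 => k; case: (fy k).
apply: (le_lt_trans (lorentz_sum _ _)) => [k|]; first by case: (fy k).
by apply: lte_sum_pinfty => k _; case: (fy k).
Qed.

End Psi.

Section Truncation.

Definition clip (M v : R) : R := Num.max (- M) (Num.min M v).

Lemma clip_id M v : `|v| <= M -> clip M v = v.
Proof. by rewrite ler_norml /clip => /andP[h1 h2]; rewrite (min_idPr h2) (max_idPr h1). Qed.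

Lemma clip_gt M v : 0 <= M -> M < v -> clip M v = M.
Proof. by move=> M0 Mv; rewrite /clip (min_idPl (ltW Mv)) (max_idPr _)//; lra. Qed.

Lemma clip_lt M v : 0 <= M -> v < - M -> clip M v = - M.
Proof.
move=> M0 Mv; rewrite /clip (min_idPr _); last by lra.
by rewrite (max_idPl _)//; lra.
Qed.

Lemma clip_cases M v : 0 <= M -> [\/ `|v| <= M /\ clip M v = v,
  M < v /\ clip M v = M | v < - M /\ clip M v = - M].
Proof.
move=> M0; have [h|h] := leP `|v| M; first by constructor 1; rewrite clip_id.
have [h1|h1] := ltP M v; first by constructor 2; rewrite clip_gt.
have h2 : v < - M.
  by move: h; rewrite ltr_normr => /orP[|]; lra.
by constructor 3; rewrite clip_lt.
Qed.

Lemma clip_le M v : 0 <= M -> `|clip M v| <= M.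
Proof.
move=> M0; have [[h ->//]|[h ->]|[h ->]] := clip_cases v M0; rewrite ?normrN;
  by rewrite ger0_norm.
Qed.

Lemma clip_rem M v : 0 <= M -> `|v - clip M v| = Num.max (`|v| - M) 0.
Proof.
move=> M0; have [[h ->]|[h ->]|[h ->]] := clip_cases v M0.
- by rewrite subrr normr0 (max_idPr _)//; lra.
- have h3 : 0 <= v by lra.
  have h4 : 0 <= v - M by lra.
  by rewrite (ger0_norm h3) (ger0_norm h4) (max_idPl h4).
- have h3 : v <= 0 by lra.
  have h4 : v + M <= 0 by lra.
  by rewrite opprK (ler0_norm h3) (ler0_norm h4) (max_idPl _) ?opprD//; lra.
Qed.

Lemma measurable_clip M : measurable_fun setT (clip M).
Proof. by apply: measurable_maxr => //; exact: measurable_minr. Qed.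

Lemma measurable_clip_comp x M : measurable_fun D x -> measurable_fun D (clip M \o x).
Proof. by move=> mx; apply: measurableT_comp => //; exact: measurable_clip. Qed.

Lemma dist_clip_rem x M s : 0 <= M -> 0 <= s ->
  dist (fun t => x t - clip M (x t)) s = dist x (s + M).
Proof.
move=> M0 s0; rewrite /dist; congr prob; apply/seteqP; split => t /=;
  rewrite /above/= clip_rem// lt_max ltrBrDr; first by case/orP => //; rewrite ltNge s0.
by move=> ->.
Qed.

Variable psi : Psi R.
Local Notation N := (lorentz_norm psi).

Lemma measurable_clip_rem x M : measurable_fun D x ->
  measurable_fun D (fun t => x t - clip M (x t)).
Proof. by move=> mx; apply: measurable_funB => //; exact: measurable_clip_comp. Qed.

Lemma psi_dist_mono x s t : measurable_fun D x -> s <= t ->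
  psi (dist x t) <= psi (dist x s).
Proof.
move=> mx st; have /andP[? ?] := dist_01 s mx; have /andP[? ?] := dist_01 t mx.
by apply: psi_le => //; exact: le_dist.
Qed.

Lemma psi_dist_shift_cvg x s : measurable_fun D x ->
  (psi (dist x (s + n%:R)))%:E @[n --> \oo] --> (0 : \bar R)%E.
Proof.
move=> mx; apply: cvg_EFin; first by near=> n.
apply/cvgrPdist_lt => e e0; have [d /andP[d0 _] H] := psi_small psi e0.
have [r r0 rd] := dist_small mx d0.
exists (Num.bound `|r - s|) => // n /= nr.
rewrite sub0r normrN ger0_norm; last exact: psi_dist_ge0.
apply: H; first exact: prob_ge0.
apply: le_trans (ltW rd); apply: le_dist => //.
rewrite -lerBlDl (le_trans (ler_norm _))//.
apply: le_trans (ltW (archi_boundP (normr_ge0 _))) _.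
by rewrite ler_nat.
Unshelve. all: by end_near. Qed.

(** Truncation at height n shifts the distribution function by n; dominated
    convergence applies with the unshifted function as majorant. *)
Lemma clip_rem_cvg x : fspace N x ->
  N (fun t => x t - clip n%:R (x t)) @[n --> \oo] --> 0%E.
Proof.
move=> [mx Nx].
pose f (n : nat) s := (psi (dist x (s + n%:R)))%:E.
have mf n : measurable_fun (`[0%R, +oo[%classic : set R) (f n).
  apply/measurable_EFinP; apply: nonincreasing_measurable => //.
  by move=> s t st; apply: psi_dist_mono => //; rewrite lerD2r.
have E0 : (0%E : \bar R) = (\int[mu]_(s in `[0%R, +oo[) cst 0 s)%E by rewrite integral0.
have NE : (fun n => N (fun t => x t - clip n%:R (x t))) =
          (fun n => \int[mu]_(s in `[0%R, +oo[) f n s)%E.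
  apply/funext => n; rewrite lorentzE; last exact: measurable_clip_rem.
  apply: eq_integral => s; rewrite inE/= in_itv/= andbT => s0.
  by rewrite dist_clip_rem.
rewrite NE E0.
have mI : measurable (`[0%R, +oo[%classic : set R) by exact: measurable_itv.
have H1 : {ae mu, forall s, (`[0%R, +oo[%classic : set R) s -> f n s @[n --> \oo] --> (0 : \bar R)%E}.
  apply: aeW => s _; exact: psi_dist_shift_cvg.
have H2 : mu.-integrable (`[0%R, +oo[%classic : set R) (fun s => (psi (dist x s))%:E).
  apply/integrableP; split; first exact: measurable_psi_dist.
  under eq_integral do rewrite gee0_abs ?lee_fin ?psi_dist_ge0//.
  by rewrite -lorentzE.
have H3 : {ae mu, forall s n, (`[0%R, +oo[%classic : set R) s -> (`|f n s| <= (psi (dist x s))%:E)%E}.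
  apply: aeW => s n _; rewrite gee0_abs lee_fin; last exact: psi_dist_ge0.
  by apply: psi_dist_mono => //; rewrite lerDl.
have m0 : measurable_fun (`[0%R, +oo[%classic : set R) (cst 0%E : R -> \bar R).
  exact: measurable_cst.
by have [] := @dominated_convergence _ _ R mu _ mI f (cst 0%E) _ mf m0 H1 H2 H3.
Qed.

(** The dyadic Riemann sum of the decreasing function psi(m(|x| > s)) is at most
    twice its integral, since 2^i is twice the length of [2^(i-1), 2^i]. *)
Lemma layer_sum x I : measurable_fun D x ->
  ((\sum_(i < I) 2 ^+ i * psi (dist x (2 ^+ i)))%:E <= 2%:E * N x)%E.
Proof.
move=> mx; pose J (a : R) := (\int[mu]_(s in `[0%R, a[) (psi (dist x s))%:E)%E.
have psimon s t := @psi_dist_mono x s t mx.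
have psi0 s : (0 <= (psi (dist x s))%:E)%E by rewrite lee_fin psi_dist_ge0.
have step a b : 0 <= a -> a <= b -> (J a + ((b - a) * psi (dist x b))%:E <= J b)%E.
  move=> a0 ab; rewrite /J [leRHS](_ : _ = \int[mu]_(s in `[0%R, a[ `|` `[a, b[) (psi (dist x s))%:E)%E; last first.
    congr integral; apply/seteqP; split => s /=; rewrite !in_itv/=.
      by move=> /andP[-> sb]; case: (ltP s a) => h; [left|right].
    by case=> /andP[h1 h2]; apply/andP; split; lra.
  rewrite ge0_integral_setU//.
  - rewrite leeD2l//.
    apply: (@le_trans _ _ (\int[mu]_(s in `[a, b[) (psi (dist x b))%:E)%E).
      rewrite integral_cst//= lebesgue_measure_itv/= lte_fin.
      case: ltgtP ab => // [_|<-] _; first by rewrite -EFinD -EFinM mulrC.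
      by rewrite subrr mul0r mule0.
    apply: ge0_le_integral => //.
    + exact: measurable_psi_dist.
    + by move=> s /=; rewrite in_itv/= lee_fin => /andP[_ /ltW]; exact: psimon.
  - by apply: measurable_psi_dist => //; exact: measurableU.
  - apply/disj_setPS => s /=; rewrite !in_itv/= => -[/andP[_ h1] /andP[h2 _]].
    by move: h1; rewrite ltNge h2.
suff H : ((\sum_(i < I) 2 ^+ i * psi (dist x (2 ^+ i)))%:E <= 2%:E * J (2 ^+ I / 2)%R)%E.
  apply: (le_trans H); rewrite lee_pmul2l ?lte_fin// lorentzE//.
  apply: ge0_subset_integral => //; first exact: measurable_psi_dist.
  by move=> s /=; rewrite !in_itv/= => /andP[->].
elim: I => [|I IH].
  rewrite big_ord0 mule_ge0// ?lee_fin//.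
  by apply: integral_ge0 => s _.
rewrite big_ord_recr/= EFinD; apply: (le_trans (leeD IH (lexx _))).
have p0 : 0 < 2 ^+ I :> R by rewrite exprn_gt0.
have -> : 2 ^+ I.+1 / 2 = 2 ^+ I :> R by rewrite exprS; field.
apply: le_trans (lee_wpmul2l _ (step (2 ^+ I / 2)%R (2 ^+ I)%R _ _)); rewrite ?lee_fin//; [|lra..].
have J0 : (0 <= J (2 ^+ I / 2)%R)%E by apply: integral_ge0 => s _.
have t0 : (0 <= ((2 ^+ I - 2 ^+ I / 2) * psi (dist x (2 ^+ I)))%:E)%E.
  by rewrite lee_fin mulr_ge0 ?psi_dist_ge0//; lra.
rewrite (ge0_muleDr _ J0 t0) -EFinM; apply: leeD => //; rewrite lee_fin.
by set p := psi _; rewrite le_eqVlt; apply/orP; left; apply/eqP; field.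
Qed.

End Truncation.
End Mean.

(** * Sums of independent identically distributed functions *)

Section IID.
Variables (R : realType).
Implicit Types (x : nat -> R -> R) (s t c : R).

Let mu := @lebesgue_measure R.
Let D : set R := `[0, 1]%classic.
Let mD : measurable D. Proof. exact: measurable_itv. Qed.

Lemma mean_sum (I : Type) (r : seq I) (f : I -> R -> R) : (forall i, l1 (f i)) ->
  mean (fun t => \sum_(i <- r) f i t) = \sum_(i <- r) mean (f i).
Proof.
move=> fi; elim: r => [|i r IH].
  by under eq_fun do rewrite big_nil; rewrite big_nil (mean_cst 0).
have l1r : l1 (fun t => \sum_(i <- r) f i t).
  elim: r {IH} => [|j r IH]; first by under eq_fun do rewrite big_nil; exact: l1_cst.
  by under eq_fun do rewrite big_cons; exact: l1D.
by under eq_fun do rewrite big_cons; rewrite meanD// IH big_cons.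
Qed.

Lemma mean_ge0 (f : R -> R) : (forall t, D t -> 0 <= f t) -> 0 <= mean f.
Proof. by move=> f0; rewrite /mean; apply: Rintegral_ge0 => t; exact: f0. Qed.

Lemma l1_indic (A : set R) : measurable (D `&` A) -> l1 (\1_A : R -> R).
Proof.
move=> mA; apply: (@l1_bounded _ _ 1); last first.
  by move=> t _; rewrite indicE; case: (_ \in _); rewrite ?normr1 ?normr0.
have h : measurable_fun D (\1_(D `&` A) : R -> R) by exact: measurable_indic.
by apply: eq_measurable_fun h => t Dt; rewrite !indicE in_setI Dt.
Qed.

Lemma markov_mean (f : R -> R) (A : set R) (c : R) : l1 f ->
  measurable (D `&` A) -> (forall t, D t -> 0 <= f t) ->
  (forall t, D t -> A t -> c <= f t) -> c * prob A <= mean f.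
Proof.
move=> fi mA f0 fc; have iA := l1_indic mA.
rewrite -mean_indic// -meanZ//; apply: mean_le => //; first exact: l1Z.
move=> t Dt; rewrite indicE; case: (boolP (t \in A)) => [/set_mem At|_].
  by rewrite mulr1 fc.
by rewrite mulr0 f0.
Qed.

Variable x : nat -> R -> R.
Hypothesis mx : forall k, measurable_fun D (x k).
Hypothesis ix : independent x.
Hypothesis idx : identically_distributed x.

Lemma measurable_preimage k (B : set R) : measurable B -> measurable (D `&` x k @^-1` B).
Proof. by move=> mB; exact: (mx k). Qed.

Lemma measurable_cap n (B : nat -> set R) : (forall k, measurable (B k)) ->
  measurable (D `&` [set t | forall k, (k < n)%N -> B k (x k t)]).
Proof.
move=> mB; elim: n => [|n IH].
  by rewrite (_ : [set _ | _] = setT) ?setIT//; apply/seteqP; split.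
rewrite (_ : _ `&` _ = (D `&` [set t | forall k, (k < n)%N -> B k (x k t)])
   `&` (D `&` x n @^-1` B n)).
  by apply: measurableI => //; exact: measurable_preimage.
apply/seteqP; split => t /=.
  by move=> [Dt H]; split; split => //; [move=> k kn; apply: H; exact: leqW|exact: H].
move=> [[Dt H] [_ H']]; split => // k; rewrite ltnS leq_eqVlt => /orP[/eqP->//|].
exact: H.
Qed.

Lemma prob_cap n (B : nat -> set R) : (forall k, measurable (B k)) ->
  prob [set t | forall k, (k < n)%N -> B k (x k t)] =
  \prod_(k < n) prob (x k @^-1` B k).
Proof.
move=> mB; have := ix [fset k in iota 0 n]%fset mB.
rewrite (_ : \bigcap_(i in _) _ = [set t | forall k, (k < n)%N -> B k (x k t)]); last first.
  apply/seteqP; split => t /= H k.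
    by move=> kn; apply: H; rewrite /= !inE mem_iota add0n.
  by rewrite /= !inE mem_iota add0n => kn; exact: H.
rewrite (perm_big (iota 0 n)); last first.
  by apply: uniq_perm; rewrite ?fset_uniq ?iota_uniq// => k; rewrite !inE.
rewrite probE; last exact: measurable_cap.
rewrite (eq_bigr (fun i => (prob (x i @^-1` B i))%:E)); last first.
  by move=> k _; rewrite probE//; exact: measurable_preimage.
rewrite prodEFin => -[->].
by rewrite -[in LHS](subn0 n) -/(index_iota 0 n) big_mkord.
Qed.

Lemma prob_id k (B : set R) : measurable B -> prob (x k @^-1` B) = prob (x 0%N @^-1` B).
Proof. by move=> mB; rewrite /prob (idx k 0%N). Qed.

(** Expanding the product over the index functions f turns independence of events
    into the product formula for means. *)
Lemma mean_prod_simple n M (a : 'I_M -> R) (B : 'I_M -> set R) :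
  (forall j, measurable (B j)) ->
  mean (fun t => \prod_(k < n) \sum_(j < M) a j * \1_(B j) (x k t)) =
  (\sum_(j < M) a j * prob (x 0%N @^-1` B j)) ^+ n.
Proof.
move=> mB.
have -> : (\sum_(j < M) a j * prob (x 0%N @^-1` B j)) ^+ n =
   \prod_(k < n) \sum_(j < M) a j * prob (x k @^-1` B j).
  rewrite -[in LHS](card_ord n) -prodr_const; apply: eq_bigr => k _.
  by apply: eq_bigr => j _; rewrite (prob_id k).
rewrite bigA_distr_bigA/=.
under eq_fun do rewrite bigA_distr_bigA/=.
pose BB (f : {ffun 'I_n -> 'I_M}) (k : nat) : set R :=
  if insub k is Some i then B (f i) else setT.
have mBB f k : measurable (BB f k) by rewrite /BB; case: insub.
have BBE f (i : 'I_n) : BB f i = B (f i) by rewrite /BB valK.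
pose E f := [set t | forall k : nat, (k < n)%N -> BB f k (x k t)].
have mE f : measurable (D `&` E f) by exact: measurable_cap.
have EE (f : {ffun 'I_n -> 'I_M}) t : \prod_(i < n) (a (f i) * \1_(B (f i)) (x i t)) =
    (\prod_(i < n) a (f i)) * \1_(E f) t.
  rewrite big_split/=; congr (_ * _); rewrite indicE.
  have [|] := boolP (t \in E f).
    move=> /set_mem H; rewrite big1// => i _; rewrite indicE mem_set//.
    by have := H i (ltn_ord i); rewrite BBE.
  rewrite notin_setE => H.
  have [i Hi] : exists i : 'I_n, ~ B (f i) (x i t).
    apply: contrapT => /forallNP H'; apply: H => k kn.
    by apply: contrapT => H2; apply: (H' (Ordinal kn)); rewrite -BBE.
  by rewrite (bigD1 i)//= indicE memNset// mul0r.
have l1E (f : {ffun 'I_n -> 'I_M}) : l1 (fun t => \prod_(i < n) (a (f i) * \1_(B (f i)) (x i t))).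
  by under eq_fun do rewrite EE; apply/l1Z/l1_indic.
rewrite mean_sum//; apply: eq_bigr => f _.
under eq_fun do rewrite EE.
rewrite meanZ; last exact: l1_indic.
rewrite mean_indic// big_split/=; congr (_ * _).
by rewrite prob_cap//; apply: eq_bigr => i _; rewrite BBE.
Qed.

Lemma mean_prod_le_approx n (h : R -> R) (H : R) N : measurable_fun setT h ->
  (forall v, 0 <= h v <= H) -> (0 < N)%N ->
  mean (fun t => \prod_(k < n) h (x k t)) <= (mean (h \o x 0%N) + N%:R^-1) ^+ n.
Proof.
move=> mh hH N0; have N0' : 0 < N%:R :> R by rewrite ltr0n.
pose M := (Num.truncn (H * N%:R)).+1.
pose idx_ v := Num.truncn (h v * N%:R).
have hN v : (idx_ v)%:R <= h v * N%:R < (idx_ v).+1%:R.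
  by apply: truncn_itv; rewrite mulr_ge0 ?(ltW N0')//; case/andP: (hH v).
have idxM v : (idx_ v < M)%N.
  rewrite ltnS; apply: le_truncn; rewrite ler_wpM2r ?(ltW N0')//.
  by case/andP: (hH v).
pose a (j : 'I_M) : R := j.+1%:R / N%:R.
pose B (j : 'I_M) := [set v | idx_ v = j].
have mB j : measurable (B j).
  rewrite (_ : B j = setT `&` h @^-1` `[j%:R / N%:R, j.+1%:R / N%:R[).
    by apply: mh => //; exact: measurable_itv.
  rewrite setTI; apply/seteqP; split => v /=;
    rewrite /B/= in_itv/= ler_pdivrMr// ltr_pdivlMr//.
    by move=> <-.
  by move=> hj; apply/esym; apply/eqP; rewrite eq_sym truncn_eq// (le_trans _ (proj1 (andP hj))).
pose hs v := \sum_(j < M) a j * \1_(B j) v.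
have hsE v : hs v = (idx_ v).+1%:R / N%:R.
  rewrite /hs (bigD1 (Ordinal (idxM v)))//= indicE mem_set// mulr1 big1 ?addr0//.
  move=> j jv; rewrite indicE memNset ?mulr0// /B/= => E.
  by move/eqP: jv; apply; apply/val_inj.
have h_hs v : h v <= hs v.
  by rewrite hsE ler_pdivlMr//; case/andP: (hN v) => _ /ltW.
have hs_h v : hs v <= h v + N%:R^-1.
  rewrite hsE -natr1 mulrDl mul1r lerD2r ler_pdivrMr//.
  by case/andP: (hN v).
have mhs : measurable_fun setT hs.
  by apply: measurable_sum => j; apply: measurable_funM => //; exact: measurable_indic.
have hs0 v : 0 <= hs v by rewrite hsE divr_ge0.
have hsH v : hs v <= H + 1.
  rewrite (le_trans (hs_h v))// lerD//; first by case/andP: (hH v).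
  by rewrite invf_le1// ler1n.
have prodl1 (g : R -> R) : measurable_fun setT g -> (forall v, 0 <= g v <= H + 1) ->
    l1 (fun t => \prod_(k < n) g (x k t)).
  move=> mg g01; apply: (@l1_bounded _ _ ((H + 1) ^+ n)).
    by apply: measurable_prod => k _; exact: measurableT_comp.
  move=> t _; rewrite normr_prod -[in leRHS](card_ord n) -prodr_const.
  by apply: ler_prod => k _; have /andP[? ?] := g01 (x k t); rewrite ger0_norm.
have compl1 (g : R -> R) : measurable_fun setT g -> (forall v, 0 <= g v <= H + 1) ->
    l1 (g \o x 0%N).
  move=> mg g01; apply: (@l1_bounded _ _ (H + 1)); first exact: measurableT_comp.
  by move=> t _; have /andP[? ?] := g01 (x 0%N t); rewrite /= ger0_norm.
have h01 v : 0 <= h v <= H + 1.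
  by have /andP[-> hh] := hH v; rewrite (le_trans hh)// lerDl.
have hs01 v : 0 <= hs v <= H + 1 by rewrite hs0 hsH.
apply: (@le_trans _ _ (mean (fun t => \prod_(k < n) hs (x k t)))).
  apply: mean_le; [exact: prodl1..|].
  by move=> t _; apply: ler_prod => k _; rewrite h_hs andbT; case/andP: (hH (x k t)).
rewrite mean_prod_simple//.
have E1 : mean (hs \o x 0%N) = \sum_(j < M) a j * prob (x 0%N @^-1` B j).
  have := @mean_prod_simple 1 M a B mB; rewrite expr1 => <-.
  by congr mean; apply/funext => t; rewrite big_ord1.
rewrite -E1; have m0 : 0 <= mean (hs \o x 0%N).
  by apply: mean_ge0 => t _; exact: hs0.
suff m1 : mean (hs \o x 0%N) <= mean (h \o x 0%N) + N%:R^-1.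
  by apply: lerXn2r; rewrite ?nnegrE//; exact: le_trans m0 m1.
rewrite -[X in _ <= _ + X](mean_cst N%:R^-1) -meanD; last 2 first.
- exact: compl1.
- exact: l1_cst.
apply: mean_le; first exact: compl1.
  by apply: l1D; [exact: compl1|exact: l1_cst].
by move=> t _; exact: hs_h.
Qed.

(** An upper bound is all that the exponential and the counting inequalities
    take from independence. It follows from the case of simple functions by
    rounding h up to multiples of 1/N. *)
Lemma mean_prod_le n (h : R -> R) (H : R) : measurable_fun setT h ->
  (forall v, 0 <= h v <= H) ->
  mean (fun t => \prod_(k < n) h (x k t)) <= mean (h \o x 0%N) ^+ n.
Proof.
move=> mh hH.
have cv : (mean (h \o x 0%N) + N.+1%:R^-1) ^+ n @[N --> \oo] --> mean (h \o x 0%N) ^+ n.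
  apply: (@continuous_cvg _ _ _ _ _ _ (fun v : R => v ^+ n)); first exact: exprn_continuous.
  rewrite -[X in _ --> X]addr0; apply: cvgD; first exact: cvg_cst.
  exact: cvg_harmonic.
apply: (cvgr_to_ge cv); apply: nearW => N.
exact: mean_prod_le_approx hH _.
Qed.

(** From exp(w/2) <= 1/(1 - w/2), squared; the bound 1/3 on |w| makes the cubic
    error term harmless. *)
Lemma expR_le_quadratic (w : R) : `|w| <= 1 / 3 -> expR w <= 1 + w + w ^+ 2.
Proof.
rewrite ler_norml => /andP[w1 w2].
have h : 0 < 1 - w / 2 by lra.
have e1 : expR (w / 2) <= (1 - w / 2)^-1.
  rewrite -[leLHS]invrK lef_pV2 ?posrE ?invr_gt0 ?expR_gt0// -expRN.
  by have := expR_ge1Dx (- (w / 2)); lra.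
have -> : expR w = expR (w / 2) ^+ 2.
  by rewrite expr2 -expRD; congr expR; field.
apply: (@le_trans _ _ ((1 - w / 2)^-1 ^+ 2)).
  by apply: lerXn2r; rewrite ?nnegrE ?expR_ge0 ?invr_ge0 ?(ltW h).
rewrite exprVn -[leLHS]mul1r ler_pdivrMr ?exprn_gt0//.
have : 0 <= w ^+ 2 * (1 - 3 * w + w ^+ 2).
  rewrite mulr_ge0 ?sqr_ge0//; have := sqr_ge0 w; lra.
by rewrite !expr2; lra.
Qed.

Section Deviation.
Variable y : R -> R.
Hypothesis my : measurable_fun setT y.
Hypothesis y1 : forall v, `|y v| <= 1.

Let Y k t := y (x k t).
Let m := mean (Y 0%N).

Lemma measurable_Y k : measurable_fun D (Y k).
Proof. exact: measurableT_comp. Qed.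

Let Y_l1 : l1 (Y 0%N).
Proof. by apply: (@l1_bounded _ _ 1) => [|t _]; [exact: measurable_Y|exact: y1]. Qed.

Lemma mean_abs_le1 : `|m| <= 1.
Proof.
rewrite ler_norml -{1}(mean_cst (-1)) -{2}(mean_cst 1); apply/andP; split;
  apply: mean_le => //; rewrite ?l1_cst//; try exact: l1_cst;
  by move=> t _; have := y1 (x 0%N t); rewrite ler_norml => /andP[].
Qed.

Lemma mean_sqr_le (u : R) : dist (Y 0%N) 0 <= u -> mean (fun t => (Y 0%N t - m) ^+ 2) <= u.
Proof.
move=> du; have l1Y2 : l1 (fun t => Y 0%N t ^+ 2).
  apply: (@l1_bounded _ _ 1) => [|t _].
    by apply: measurable_funX; exact: measurable_Y.
  by rewrite normrX exprn_ile1// y1.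
have -> : (fun t => (Y 0%N t - m) ^+ 2) =
          (fun t => Y 0%N t ^+ 2 + ((- (2 * m)) * Y 0%N t + cst (m ^+ 2) t)).
  by apply/funext => t /=; ring.
rewrite meanD//; last by apply: l1D; [exact: l1Z|exact: l1_cst].
rewrite meanD ?meanZ ?mean_cst//; try exact: l1Z; try exact: l1_cst.
rewrite -/m; apply: (@le_trans _ _ (mean (fun t => Y 0%N t ^+ 2))).
  by have := sqr_ge0 m; rewrite !expr2; lra.
have mab : measurable (D `&` above (Y 0%N) 0) by apply: measurable_above; exact: measurable_Y.
apply: le_trans du; rewrite /dist -mean_indic//.
apply: mean_le => //; first exact: l1_indic.
move=> t _; rewrite indicE; case: (boolP (t \in _)) => [_|].
  by rewrite -[leLHS]ger0_norm ?sqr_ge0// normrX exprn_ile1// y1.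
rewrite notin_setE /above/= => /negP; rewrite -leNgt normr_le0 => /eqP->.
by rewrite expr0n.
Qed.

(** The exponential Markov inequality: by the quadratic bound on the exponential,
    the mean of exp(lam (Y - m)) is at most 1 + lam^2 u, the variance of Y being
    at most the probability u of Y <> 0. The condition lam <= 1/6 keeps
    lam (Y - m) below 1/3. *)
Lemma upper_deviation n (u lam T : R) : dist (Y 0%N) 0 <= u ->
  0 <= lam <= 1 / 6 ->
  prob [set t | T < \sum_(k < n) Y k t - n%:R * m] <=
  expR (- (lam * T) + lam ^+ 2 * n%:R * u).
Proof.
move=> du /andP[lam0 lam1].
pose h v := expR (lam * (y v - m)).
have ym v : `|lam * (y v - m)| <= 1 / 3.
  have h2 : `|y v - m| <= 2.
    by rewrite (le_trans (ler_normB _ _))//; have := y1 v; have := mean_abs_le1; lra.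
  by rewrite normrM ger0_norm//; nra.
have mh : measurable_fun setT h.
  apply: measurableT_comp; first exact: measurable_expR.
  by apply: measurable_funM => //; exact: measurable_funB.
have hH v : 0 <= h v <= expR (1/3).
  by rewrite expR_ge0 ler_expR (le_trans (ler_norm _)).
have mZ : measurable_fun D (fun t => \sum_(k < n) Y k t - n%:R * m).
  apply: measurable_funB => //; apply: measurable_sum => k; exact: measurable_Y.
have mA : measurable (D `&` [set t | T < \sum_(k < n) Y k t - n%:R * m]).
  rewrite (_ : [set t | _] = (fun t => \sum_(k < n) Y k t - n%:R * m) @^-1` `]T, +oo[).
    by apply: mZ => //; exact: measurable_itv.
  by apply/seteqP; split => t /=; rewrite in_itv/= andbT.
have hx_l1 : l1 (h \o x 0%N).
  apply: (@l1_bounded _ _ (expR (1/3))); first exact: measurableT_comp.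
  by move=> t _; have /andP[? ?] := hH (x 0%N t); rewrite /= ger0_norm.
have P_l1 : l1 (fun t => \prod_(k < n) h (x k t)).
  apply: (@l1_bounded _ _ (expR (1/3) ^+ n)).
    by apply: measurable_prod => k _; exact: measurableT_comp.
  move=> t _; rewrite normr_prod -[in leRHS](card_ord n) -prodr_const.
  by apply: ler_prod => k _; have /andP[? ?] := hH (x k t); rewrite ger0_norm ?lexx ?andbT.
have PE t : \prod_(k < n) h (x k t) = expR (lam * (\sum_(k < n) Y k t - n%:R * m)).
  rewrite -expR_sum -mulr_sumr sumrB sumr_const card_ord.
  by rewrite -[m *+ n]mulr_natl.
have mh1 : mean (h \o x 0%N) <= 1 + lam ^+ 2 * u.
  have l1q : l1 (fun t => (Y 0%N t - m) ^+ 2).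
    apply: (@l1_bounded _ _ 4) => [|t _].
      by apply: measurable_funX; apply: measurable_funB => //; exact: measurable_Y.
    rewrite normrX (_ : 4 = 2 ^+ 2); last by rewrite -natrX.
    apply: lerXn2r; rewrite ?nnegrE//.
    by rewrite (le_trans (ler_normB _ _))//; have := y1 (x 0%N t);
       have := mean_abs_le1; rewrite /Y; lra.
  apply: (@le_trans _ _ (mean (fun t => cst (1 - lam * m) t + (lam * Y 0%N t +
       lam ^+ 2 * (Y 0%N t - m) ^+ 2)))).
    apply: mean_le => //.
      apply: l1D; first exact: l1_cst.
      by apply: l1D; exact: l1Z.
    move=> t _; rewrite /= /h; apply: (le_trans (expR_le_quadratic (ym _))).
    by rewrite exprMn /Y; lra.
  rewrite meanD; last 2 first.
    exact: l1_cst.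
    by apply: l1D; exact: l1Z.
  rewrite (meanD (l1Z lam Y_l1) (l1Z (lam ^+ 2) l1q)).
  rewrite mean_cst meanZ// meanZ// -/m.
  have h1 : lam ^+ 2 * mean (fun t => (Y 0%N t - m) ^+ 2) <= lam ^+ 2 * u.
    by rewrite ler_wpM2l ?sqr_ge0// mean_sqr_le.
  by move: h1; lra.
have step := @mean_prod_le n h _ mh hH.
rewrite expRD expRN [leRHS]mulrC ler_pdivlMr ?expR_gt0// [leLHS]mulrC.
apply: (le_trans (markov_mean P_l1 mA _ _)).
- by move=> t _; rewrite PE expR_ge0.
- by move=> t _ /= Tt; rewrite PE ler_expR ler_wpM2l// ltW.
apply: (le_trans step); rewrite (_ : lam ^+ 2 * n%:R * u = n%:R * (lam ^+ 2 * u)); last by ring.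
rewrite expRM_natl; have mh0 : 0 <= mean (h \o x 0%N).
  by apply: mean_ge0 => t _; rewrite /= /h expR_ge0.
have h2 := le_trans mh1 (expR_ge1Dx (lam ^+ 2 * u)).
by apply: lerXn2r => //; rewrite nnegrE ?expR_ge0.
Qed.

(** Large values of a sum force many nonzero terms: each of them contributes a
    factor 1/(n u) to a product of mean at most (1 + 1/n)^n. *)
Lemma few_nonzero n (K : nat) (u : R) : dist (Y 0%N) 0 <= u -> 0 < u ->
  (0 < n)%N -> n%:R * u <= 1 ->
  dist (fun t => \sum_(k < n) Y k t) K%:R <= expR 1 * (n%:R * u) ^+ K.+1.
Proof.
move=> du u0 n0 nu1; have n0' : 0 < n%:R :> R by rewrite ltr0n.
pose v := n%:R * u; have v0 : 0 < v by rewrite mulr_gt0.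
have v1 : 1 <= v^-1 by rewrite invf_ge1.
pose h w := if y w == 0 then 1 else v^-1.
have hE w : h w = 1 + (v^-1 - 1) * \1_(y @^-1` ~` [set 0]) w.
  rewrite /h indicE; case: eqP => yw.
    by rewrite memNset ?mulr0 ?addr0//= => /(_ yw).
  by rewrite mem_set// mulr1 addrCA subrr addr0.
have mB : measurable (y @^-1` ~` [set 0]).
  rewrite -[X in measurable X]setTI; apply: my => //.
  by apply: measurableC; exact: measurable_set1.
have mh : measurable_fun setT h.
  rewrite (_ : h = fun w => 1 + (v^-1 - 1) * \1_(y @^-1` ~` [set 0]) w).
    by apply: measurable_funD => //; apply: measurable_funM => //; exact: measurable_indic.
  by apply/funext.
have hH w : 0 <= h w <= v^-1.
  by rewrite /h; case: eqP; rewrite ?lexx ?ler01 ?v1// invr_ge0 (ltW v0).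
have mS : measurable_fun D (fun t => \sum_(k < n) Y k t).
  by apply: measurable_sum => k; exact: measurable_Y.
have mA : measurable (D `&` above (fun t => \sum_(k < n) Y k t) K%:R).
  exact: measurable_above.
have P_l1 : l1 (fun t => \prod_(k < n) h (x k t)).
  apply: (@l1_bounded _ _ (v^-1 ^+ n)).
    by apply: measurable_prod => k _; exact: measurableT_comp.
  move=> t _; rewrite normr_prod -[in leRHS](card_ord n) -prodr_const.
  by apply: ler_prod => k _; have /andP[? ?] := hH (x k t); rewrite ger0_norm ?lexx ?andbT.
have mh1 : mean (h \o x 0%N) <= 1 + n%:R^-1.
  have mP : measurable (D `&` (x 0%N @^-1` (y @^-1` ~` [set 0]))).
    exact: measurable_preimage.
  rewrite (_ : h \o x 0%N = fun t => cst 1 t + (v^-1 - 1) * \1_(x 0%N @^-1` (y @^-1` ~` [set 0])) t); last first.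
    by apply/funext => t; rewrite /= hE !indicE.
  rewrite meanD; [|exact: l1_cst|apply: l1Z; exact: l1_indic].
  rewrite mean_cst meanZ; last exact: l1_indic.
  rewrite mean_indic// lerD2l.
  have pu : prob (x 0%N @^-1` (y @^-1` ~` [set 0])) <= u.
    apply: le_trans du; apply: le_prob => //; first by apply: measurable_above; exact: measurable_Y.
    by move=> t [/= /eqP yt _]; rewrite /above/= normr_gt0.
  have -> : n%:R^-1 = v^-1 * u by rewrite /v; field; rewrite !gt_eqF.
  apply: ler_pM => //; first by rewrite subr_ge0.
    exact: prob_ge0.
  by rewrite gerBl.
have step := @mean_prod_le n h _ mh hH.
rewrite -ler_pdivrMr ?exprn_gt0// mulrC -exprVn.
apply: (le_trans (markov_mean P_l1 mA _ _)).
- by move=> t _; apply: prodr_ge0 => k _; case/andP: (hH (x k t)).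
- move=> t _; rewrite /above/= => Kt.
  rewrite (bigID (fun k : 'I_n => y (x k t) == 0))/= big1 ?mul1r; last first.
    by move=> k /eqP yk; rewrite /h yk eqxx.
  rewrite (eq_bigr (fun=> v^-1)); last by move=> k /negbTE yk; rewrite /h yk.
  rewrite prodr_const; apply: ler_weXn2l => //.
  rewrite -(ltr_nat R); apply: (lt_le_trans Kt).
  rewrite (bigID (fun k : 'I_n => y (x k t) == 0))/= big1 ?add0r; last by move=> k /eqP.
  apply: (le_trans (ler_norm_sum _ _ _)).
  apply: (@le_trans _ _ (\sum_(k < n | y (x k t) != 0) 1)).
    by apply: ler_sum => k _; exact: y1.
  by rewrite sumr_const.
apply: (le_trans step).
have mh0 : 0 <= mean (h \o x 0%N).
  by apply: mean_ge0 => t _; case/andP: (hH (x 0%N t)).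
have -> : expR 1 = expR n%:R^-1 ^+ n :> R.
  by rewrite -expRM_natl mulfV// gt_eqF.
have h2 := le_trans mh1 (expR_ge1Dx (n%:R^-1)).
by apply: lerXn2r => //; rewrite nnegrE ?expR_ge0.
Qed.

End Deviation.

Lemma prob_setU (A B : set R) : measurable (D `&` A) -> measurable (D `&` B) ->
  prob (A `|` B) <= prob A + prob B.
Proof.
move=> mA mB; rewrite -lee_fin EFinD -!probE//; last first.
  by rewrite setIUr; exact: measurableU.
by rewrite !m01E setIUr; apply: measureU2.
Qed.

Lemma deviation (y : R -> R) n (u lam T : R) : measurable_fun setT y ->
  (forall v, `|y v| <= 1) -> dist (y \o x 0%N) 0 <= u -> 0 <= lam <= 1 / 6 ->
  dist (fun t => \sum_(k < n) y (x k t) - n%:R * mean (y \o x 0%N)) T <=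
  2 * expR (- (lam * T) + lam ^+ 2 * n%:R * u).
Proof.
move=> my y1 du lam01.
have H1 := upper_deviation my y1 n T du lam01.
have myN : measurable_fun setT (fun v => - y v) by exact: measurable_funN.
have y1N v : `|- y v| <= 1 by rewrite normrN.
have duN : dist (fun t => - y (x 0%N t)) 0 <= u.
  apply: le_trans du; rewrite le_eqVlt; apply/orP; left; apply/eqP; congr prob.
  by apply/seteqP; split => t; rewrite /above/= normrN.
have H2 := upper_deviation myN y1N n T duN lam01.
have yl1 : l1 (y \o x 0%N).
  by apply: (@l1_bounded _ _ 1) => [|t _]; [exact: measurableT_comp|exact: y1].
have mN : mean (fun t => - y (x 0%N t)) = - mean (y \o x 0%N).
  rewrite -mulN1r -meanZ//; congr mean; apply/funext => t.
  by rewrite mulN1r.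
have mZ (g : R -> R) c : measurable_fun setT g ->
    measurable (D `&` [set t | T < \sum_(k < n) g (x k t) - c]).
  move=> mg.
  have mZ : measurable_fun D (fun t => \sum_(k < n) g (x k t) - c).
    by apply: measurable_funB => //; apply: measurable_sum => k; exact: measurableT_comp.
  rewrite (_ : [set t | _] = (fun t => \sum_(k < n) g (x k t) - c) @^-1` `]T, +oo[).
    by apply: mZ => //; exact: measurable_itv.
  by apply/seteqP; split => t /=; rewrite in_itv/= andbT.
have A1 := mZ y (n%:R * mean (y \o x 0%N)) my.
have A2 := mZ _ (n%:R * mean (fun t => - y (x 0%N t))) myN.
rewrite [leRHS](_ : _ = expR (- (lam * T) + lam ^+ 2 * n%:R * u) + expR (- (lam * T) + lam ^+ 2 * n%:R * u)); last by ring.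
apply: le_trans (lerD H1 H2).
apply: le_trans (prob_setU A1 A2).
rewrite /dist (_ : above _ T = [set t | T < \sum_(k < n) y (x k t) - n%:R * mean (y \o x 0%N)] `|`
  [set t | T < \sum_(k < n) - y (x k t) - n%:R * mean (fun t => - y (x 0%N t))])//.
have E t : \sum_(k < n) - y (x k t) - n%:R * mean (fun t => - y (x 0%N t)) =
    - (\sum_(k < n) y (x k t) - n%:R * mean (y \o x 0%N)).
  by rewrite mN sumrN; ring.
by apply/seteqP; split => t; rewrite /above/= E ltr_normr => /orP.
Qed.

End IID.

(** * Iterating the two conditions on psi *)

Section Growth.
Variables (R : realType) (psi : Psi R).
Implicit Types (n : nat) (u v : R).

Lemma psi_le_dilate (a v w : R) : 0 <= w <= 1 -> 0 < v <= 1 -> 1 <= a ->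
  w <= a * v -> psi w <= a * psi v.
Proof.
move=> /andP[w0 w1] /andP[v0 v1] a1 wav.
have pv : 0 <= psi v by rewrite psi_ge0// (ltW v0).
have [wv|vw] := leP w v.
  by apply: (le_trans (psi_le psi w0 wv v1)); rewrite ler_peMl.
have -> : w = (w / v) * v by rewrite divfK// gt_eqF.
apply: (@le_trans _ _ (w / v * psi v)).
  apply: psi_dilate => //; first by rewrite ler_pdivlMr// mul1r ltW.
    exact: ltW.
  by rewrite divfK// gt_eqF.
by rewrite ler_wpM2r// ler_pdivrMr.
Qed.

(** Iterating psi(k u) <= c psi(u) gives psi(k^m u) <= D0 c^m psi(u), that is,
    growth of order n^th with th = log_k c < 1 along the powers n = k^m; the
    intermediate n cost a factor k. The constant D0 takes care of the arguments
    beyond the range where the hypothesis holds. *)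
Lemma psi_growth (k : nat) (c d : R) : (2 <= k)%N -> c < k%:R -> 0 < d ->
  (forall u, 0 < u < d -> psi (k%:R * u) <= c * psi u) ->
  exists th, exists2 C, 0 <= th < 1 /\ 1 <= C & forall n u, (0 < n)%N -> 0 < u ->
    n%:R * u <= 1 -> psi (n%:R * u) <= C * expR (th * ln n%:R) * psi u.
Proof.
move=> k2 ck d0 Hk.
have k1' : 1 < k%:R :> R by rewrite ltr1n.
have k0' : 0 < k%:R :> R by lra.
pose d' := Num.min d k%:R^-1; pose c' := Num.max c 1.
have d'0 : 0 < d' by rewrite lt_min d0 invr_gt0.
have d'1 : d' <= 1 by rewrite ge_min invf_le1// (ltW k1') orbT.
have c'1 : 1 <= c' by rewrite le_max lexx orbT.
have c'0 : 0 < c' by lra.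
have c'k : c' < k%:R by rewrite gt_max ck.
have {}Hk u : 0 < u < d' -> psi (k%:R * u) <= c' * psi u.
  move=> /andP[u0]; rewrite lt_min => /andP[ud uk].
  apply: (le_trans (Hk u _)); first by rewrite u0.
  rewrite ler_wpM2r ?le_max ?lexx// psi_ge0// (ltW u0)/=.
  by rewrite (le_trans (ltW uk))// invf_le1// ltW.
pose D0 := psi 1 / psi d'.
have pd : 0 < psi d' by rewrite psi_gt0// d'0.
have D1 : 1 <= D0 by rewrite ler_pdivlMr// mul1r psi_le// ltW.
have iter m : forall u, 0 < u -> k%:R ^+ m * u <= 1 ->
    psi (k%:R ^+ m * u) <= D0 * c' ^+ m * psi u.
  elim: m => [|m IH] u u0 kmu.
    rewrite expr0 !mul1r mulr1 ler_peMl// psi_ge0// (ltW u0)/=.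
    by move: kmu; rewrite expr0 mul1r.
  have km1 : 1 <= k%:R ^+ m :> R by rewrite exprn_ege1// ltW.
  have ku1 : k%:R * u <= 1.
    apply: le_trans kmu; rewrite exprSr -mulrA ler_peMl// mulr_ge0// ltW//.
  have u1 : u <= 1 by apply: le_trans ku1; rewrite ler_peMl// ltW.
  have [ud|du] := ltP u d'.
    rewrite exprSr -mulrA (le_trans (IH _ _ _))//.
    - by rewrite mulr_gt0.
    - by rewrite mulrA -exprSr.
    have Dc : 0 <= D0 * c' ^+ m by rewrite mulr_ge0 ?exprn_ge0//; lra.
    rewrite exprSr !mulrA -[leRHS]mulrA ler_wpM2l//.
    by rewrite Hk// u0.
  apply: (@le_trans _ _ (psi 1)).
    by rewrite psi_le// mulr_ge0 ?exprn_ge0 ?(ltW u0)// ltW.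
  apply: (@le_trans _ _ (D0 * psi u)).
    rewrite /D0 mulrAC ler_pdivlMr// ler_wpM2l ?psi_ge0 ?lexx ?ler01//.
    by rewrite psi_le// ltW.
  rewrite ler_wpM2r ?psi_ge0 ?(ltW u0)// ler_peMr//; first by lra.
  by rewrite exprn_ege1.
have lnk : 0 < ln k%:R :> R by rewrite ln_gt0.
pose th := ln c' / ln k%:R.
exists th; exists (k%:R * D0).
  split; last by nra.
  apply/andP; split; first by apply: divr_ge0; [exact: ln_ge0|exact: ltW].
  by rewrite /th ltr_pdivrMr// mul1r ltr_ln ?posrE.
move=> n u n0 u0 nu1.
have /andP[m1 m2] := trunc_log_bounds k2 n0; set m := trunc_log k n in m1 m2.
have n0' : 0 < n%:R :> R by rewrite ltr0n.
have m1' : k%:R ^+ m <= n%:R :> R by rewrite -natrX ler_nat.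
have m2' : n%:R <= k%:R * k%:R ^+ m :> R by rewrite -exprS -natrX ler_nat ltnW.
have km0 : 0 < k%:R ^+ m :> R by rewrite exprn_gt0.
have kmu : k%:R ^+ m * u <= 1.
  by apply: le_trans nu1; rewrite ler_wpM2r// ltW.
have u01 : u <= 1.
  by apply: le_trans nu1; rewrite ler_peMl// ?ler1n// ltW.
apply: (@le_trans _ _ (k%:R * psi (k%:R ^+ m * u))).
  apply: psi_le_dilate; [|by rewrite mulr_gt0|exact: ltW|].
    by rewrite nu1 mulr_ge0// ltW.
  by rewrite mulrA ler_wpM2r// ltW.
have pu : 0 <= psi u by rewrite psi_ge0// (ltW u0).
have e1 : c' ^+ m <= expR (th * ln n%:R).
  have -> : c' ^+ m = expR (th * ln (k%:R ^+ m)).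
    rewrite lnXn// -[ln _ *+ m]mulr_natl /th mulrCA divfK ?gt_eqF//.
    by rewrite expRM_natl lnK ?posrE.
  rewrite ler_expR ler_wpM2l//.
    by apply: divr_ge0; [exact: ln_ge0|exact: ltW].
  by rewrite ler_ln ?posrE.
have D00 : 0 <= D0 by lra.
move: (expR _) e1 => e e1; move: (iter m u u0 kmu) => it.
apply: (@le_trans _ _ (k%:R * (D0 * c' ^+ m * psi u))).
  by rewrite ler_wpM2l// ltW.
rewrite [leRHS](_ : _ = k%:R * (D0 * e * psi u)); last by ring.
by rewrite ler_wpM2l ?(ltW k0')// ler_wpM2r// ler_wpM2l.
Qed.

(** Take n close to 1/u in the growth estimate: psi(1/2) <= psi(n u). *)
Lemma psi_lower (th C : R) : 0 <= th -> 1 <= C ->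
  (forall n u, (0 < n)%N -> 0 < u ->
    n%:R * u <= 1 -> psi (n%:R * u) <= C * expR (th * ln n%:R) * psi u) ->
  exists2 c0, 0 < c0 & forall u, 0 < u <= 1 -> c0 * expR (th * ln u) <= psi u.
Proof.
move=> th0 C1 H; have C0 : 0 < C by lra.
have ph : 0 < psi (1 / 2) by apply: psi_gt0; apply/andP; split; lra.
exists (psi (1 / 2) / C); first by rewrite divr_gt0.
move=> u /andP[u0 u1]; pose n := Num.truncn u^-1.
have ui : 1 <= u^-1 by rewrite invf_ge1.
have /andP[n1 n2] : n%:R <= u^-1 < n.+1%:R by apply: truncn_itv; lra.
have n0 : (0 < n)%N by rewrite truncn_gt0.
have n0' : 1 <= n%:R :> R by rewrite ler1n.
have nu1 : n%:R * u <= 1 by rewrite -ler_pdivlMr// mul1r.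
have nu2 : 1 / 2 <= n%:R * u.
  move: n2; rewrite -natr1 -[u^-1]mul1r ltr_pdivrMr//; nra.
have := H n u n0 u0 nu1; set e := expR _ => He.
have pu : 0 <= psi u by rewrite psi_ge0// (ltW u0).
have ee : e * expR (th * ln u) <= 1.
  rewrite /e -expRD -mulrDr -lnM ?posrE//; last by lra.
  rewrite expR_le1 mulr_ge0_le0// ln_le0//.
rewrite mulrAC ler_pdivrMr//.
have p1 : psi (1 / 2) <= C * e * psi u.
  by apply: le_trans He; apply: psi_le => //; lra.
apply: (@le_trans _ _ (C * e * psi u * expR (th * ln u))).
  by rewrite ler_wpM2r ?expR_ge0.
rewrite (_ : _ * _ = (e * expR (th * ln u)) * (psi u * C)); last by ring.
by rewrite ler_piMl// mulr_ge0// ltW.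
Qed.

(** Iterating psi(u^l) <= c psi(u) gives psi(u^L) <= c^m psi(u) with L = l^m.
    The largest m with l^m <= n^a makes c^m a negative power of n. Thus
    raising u to the power n^a, with a as small as desired, already gains a
    power of n. *)
Lemma psi_decay (l : nat) (c d a : R) : (2 <= l)%N -> c < 1 -> 0 < d -> 0 < a ->
  (forall u, 0 < u < d -> psi (u ^+ l) <= c * psi u) ->
  exists eps, exists2 C, 0 < eps /\ 1 <= C & forall n, (0 < n)%N ->
    exists L : nat, [/\ (0 < L)%N, L%:R <= expR (a * ln n%:R) &
      forall u, 0 < u < Num.min d 1 -> psi (u ^+ L) <= C * expR (- (eps * ln n%:R)) * psi u].
Proof.
move=> l2 c1 d0 a0 Hl; pose c' := Num.max c (1 / 2).
have c'0 : 0 < c' by rewrite lt_max; apply/orP; right; lra.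
have c'1 : c' < 1 by rewrite gt_max c1/=; lra.
have l1' : 1 < l%:R :> R by rewrite ltr1n.
have lnl : 0 < ln l%:R :> R by rewrite ln_gt0.
have lnc : ln c' < 0 by rewrite ln_lt0// c'0.
have iter m : forall u, 0 < u < Num.min d 1 -> psi (u ^+ (l ^ m)) <= c' ^+ m * psi u.
  elim: m => [|m IH] u; first by rewrite expn0 expr1 expr0 mul1r.
  rewrite lt_min => /and3P[u0 ud u1].
  rewrite expnS exprM (le_trans (IH _ _))//.
    rewrite exprn_gt0//= lt_min; apply/andP; split.
      apply: le_lt_trans ud; rewrite -[leRHS]expr1; apply: ler_wiXn2l; try lra.
      exact: leq_trans l2.
    by rewrite exprn_ilt1 ?(ltW u0)// -lt0n; exact: leq_trans l2.
  rewrite exprSr -mulrA ler_wpM2l ?exprn_ge0 ?(ltW c'0)//.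
  apply: (le_trans (Hl u _)); first by rewrite u0.
  by rewrite ler_wpM2r ?psi_ge0 ?(ltW u0) ?(ltW u1)// le_max lexx.
exists (a * - ln c' / ln l%:R); exists c'^-1.
  split; last by rewrite invf_ge1// ltW.
  by rewrite divr_gt0// mulr_gt0// oppr_gt0.
move=> n n0; have n1 : 1 <= n%:R :> R by rewrite ler1n.
have lnn : 0 <= ln n%:R :> R by rewrite ln_ge0.
pose m := Num.truncn (a * ln n%:R / ln l%:R).
have /andP[m1 m2] : m%:R <= a * ln n%:R / ln l%:R < m.+1%:R.
  by apply: truncn_itv; rewrite divr_ge0 ?mulr_ge0 ?(ltW lnl)// ltW.
exists (l ^ m)%N; split.
- by rewrite expn_gt0 (leq_trans _ l2).
- rewrite natrX -[leLHS]lnK ?posrE ?exprn_gt0//; last by lra.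
  rewrite ler_expR lnXn; last by lra.
  by rewrite -[_ *+ m]mulr_natl -ler_pdivlMr.
move=> u uu; apply: (le_trans (iter m u uu)).
have u01 : 0 <= u <= 1.
  by move: uu; rewrite lt_min => /and3P[u0 _ u1]; rewrite !ltW.
rewrite ler_wpM2r ?psi_ge0//.
have -> : c' ^+ m = expR (m%:R * ln c') by rewrite expRM_natl lnK ?posrE.
have -> : c'^-1 = expR (- ln c') by rewrite expRN lnK ?posrE.
rewrite -expRD ler_expR.
have -> : - (a * - ln c' / ln l%:R * ln n%:R) = (a * ln n%:R / ln l%:R) * ln c' by ring.
have : (m.+1%:R - a * ln n%:R / ln l%:R) * ln c' <= 0.
  by rewrite nmulr_lle0// subr_ge0 ltW.
by rewrite -natr1; lra.
Qed.

End Growth.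

(** * The norm of a centered sum of bounded independent functions *)

Section Estimate.
Variables (R : realType) (psi : Psi R).
Local Notation N := (lorentz_norm psi).

Let mu := @lebesgue_measure R.
Let D : set R := `[0, 1]%classic.
Let mD : measurable D. Proof. exact: measurable_itv. Qed.

(** A function bounded by 1 has a mean at most the measure of its support. *)
Lemma mean_abs_le_dist (Y : R -> R) : measurable_fun D Y ->
  (forall t, `|Y t| <= 1) -> `|mean Y| <= dist Y 0.
Proof.
move=> mY Y1; have l1Y : l1 Y by apply: (@l1_bounded _ _ 1).
have mA : measurable (D `&` above Y 0) by exact: measurable_above.
have l1A := l1_indic mA.
rewrite /dist -mean_indic// ler_norml; apply/andP; split; last first.
  apply: mean_le => // t _; rewrite indicE; case: (boolP (t \in _)) => [_|].
    by rewrite (le_trans (ler_norm _)).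
  by rewrite notin_setE /above/= => /negP; rewrite -leNgt normr_le0 => /eqP->.
rewrite -mulN1r -meanZ//; apply: mean_le => //; first exact: l1Z.
move=> t _; rewrite indicE; case: (boolP (t \in _)) => [_|].
  by rewrite mulr1; have := Y1 t; rewrite ler_norml => /andP[].
rewrite notin_setE /above/= => /negP; rewrite -leNgt normr_le0 => /eqP->.
by rewrite mulr0.
Qed.

Lemma lorentz_scale_le (x : R -> R) (b : R) : measurable_fun D x -> 0 < b ->
  (N (fun t => b * x t)%R <= b%:E * N x)%E.
Proof.
move=> mx b0; rewrite /lorentz_norm -ge0_integralZl_EFin ?(ltW b0)//.
- apply: ge0_le_integral => //.
  + by move=> t _; exact: rearrangement_ge0.
  + by apply: measurable_rearrangement; exact: measurable_funM.
  + apply: measurable_funeM; exact: measurable_rearrangement.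
  move=> t _; rewrite -lee_pdivrMl//.
  apply: le_ereal_inf_tmp => _ [s [s0 H] <-].
  rewrite lee_pdivrMl// -EFinM; apply: ereal_inf_lbound.
  exists (b * s) => //; split; first by rewrite mulr_ge0// ltW.
  apply: le_trans H; rewrite (_ : [set u | b * s < `|b * x u|] = [set u | s < `|x u|])//.
  by apply/seteqP; split => u /=; rewrite normrM (gtr0_norm b0) ltr_pM2l.
- by move=> t _; exact: rearrangement_ge0.
- exact: measurable_rearrangement.
Qed.

Section Fixed.
Variables (x : nat -> R -> R).
Hypothesis mx : forall k, measurable_fun D (x k).
Hypothesis ix : independent x.
Hypothesis idx : identically_distributed x.
Variable y : R -> R.
Hypothesis my : measurable_fun setT y.
Hypothesis y1 : forall v, `|y v| <= 1.
Variables (n : nat) (u : R).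
Hypothesis n0 : (0 < n)%N.
Hypothesis u01 : 0 < u <= 1.
Hypothesis du : dist (y \o x 0%N) 0 <= u.

Let m := mean (y \o x 0%N).
Let S t := \sum_(k < n) y (x k t).
Let Z t := S t - n%:R * m.

Let mY k : measurable_fun D (y \o x k). Proof. exact: measurableT_comp. Qed.
Let mS : measurable_fun D S.
Proof. by apply: measurable_sum => k; exact: mY. Qed.
Let mZ : measurable_fun D Z. Proof. exact: measurable_funB. Qed.
Let m_u : `|m| <= u. Proof. by apply: le_trans du; apply: mean_abs_le_dist => // t; exact: y1. Qed.
Let S_n t : `|S t| <= n%:R.
Proof.
rewrite (le_trans (ler_norm_sum _ _ _))//.
apply: (@le_trans _ _ (\sum_(k < n) 1)); first by apply: ler_sum => k _; exact: y1.
by rewrite sumr_const card_ord.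
Qed.

(** The mean of y(x_k) is at most u in modulus, so the centering term costs at
    most n u psi(1). *)
Lemma centering_le : (N Z <= N S + (n%:R * u * psi 1)%:E)%E.
Proof.
apply: (le_trans (lorentz_triangle psi mS (_ : measurable_fun D (cst (- (n%:R * m)))))) => //.
apply: leeD => //; apply: (le_trans (lorentz_cst _ _)); rewrite lee_fin.
have p1 := psi1_gt0 psi.
by rewrite ler_wpM2r ?(ltW p1)// normrN normrM normr_nat ler_wpM2l.
Qed.

(** The triangle inequality, each term being bounded by 1 and supported on a set
    of measure at most u. *)
Lemma crude_bound : (N Z <= (2 * n%:R * psi u)%:E)%E.
Proof.
have /andP[u0 u1] := u01.
apply: (le_trans centering_le); apply: (@le_trans _ _ ((n%:R * psi u)%:E + (n%:R * psi u)%:E)%E).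
  apply: leeD; last first.
    by rewrite lee_fin -mulrA ler_wpM2l// psi_id_le// (ltW u0).
  apply: (le_trans (lorentz_sum psi n mY)).
  apply: (@le_trans _ _ (\sum_(k < n) (psi u)%:E)%E).
    apply: lee_sum => k _.
    have y1' : {in `[0, 1], forall t, `|(y \o x k) t| <= 1} by move=> t _; exact: y1.
    apply: (le_trans (lorentz_bounded psi (mY k) ler01 ler01 y1')).
    rewrite (dist_eq0 (mY k) y1') Psi0 mulr0 addr0 mul1r lee_fin psi_le ?prob_ge0//.
    apply: le_trans du; rewrite le_eqVlt; apply/orP; left; apply/eqP.
    have mB : measurable (y @^-1` [set v | 0 < `|v|]).
      rewrite -[X in measurable X]setTI; apply: my => //.
      rewrite (_ : [set v | _] = ~` [set 0]).
        by apply: measurableC; exact: measurable_set1.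
      apply/seteqP; split => v /=; rewrite normr_gt0; first by move/eqP.
      by move=> v0; apply/eqP.
    exact: (prob_id idx k mB).
  by rewrite sumEFin sumr_const card_ord mulr_natl.
by rewrite -EFinD lee_fin; lra.
Qed.

(** The sum is nonzero on a set of measure at most about n u, and it exceeds K
    only on a much smaller set. *)
Lemma sparse_bound K : n%:R * u <= 1 ->
  (N Z <= (K%:R * (expR 1 * psi (n%:R * u)) + n%:R * psi (dist S K%:R)
           + psi (n%:R * u))%:E)%E.
Proof.
move=> nu1; have /andP[u0 u1] := u01.
have n0' : 0 < n%:R :> R by rewrite ltr0n.
have nu0 : 0 < n%:R * u by rewrite mulr_gt0.
apply: (le_trans centering_le); rewrite EFinD; apply: leeD; last first.
  by rewrite lee_fin psi_id_le// nu1 ltW.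
apply: (le_trans (lorentz_bounded psi mS (ler0n _ K) (ler0n _ n) (fun t _ => S_n t))).
rewrite lee_fin lerD2r ler_wpM2l//.
apply: psi_le_dilate; first exact: dist_01.
- by rewrite nu0.
- by have := expR_ge1Dx (1 : R); lra.
- by have := few_nonzero mx ix idx my y1 0 du u0 n0 nu1; rewrite expr1.
Qed.

Lemma dense_bound T : 0 <= T ->
  (N Z <= (T * psi 1 + 2 * n%:R * psi (dist Z T))%:E)%E.
Proof.
move=> T0; have Z2 : {in `[0, 1], forall t, `|Z t| <= 2 * n%:R}.
  move=> t _; rewrite /Z (le_trans (ler_normB _ _))//.
  rewrite [leRHS](_ : _ = n%:R + n%:R * 1); last by ring.
  rewrite lerD// normrM normr_nat ler_wpM2l//.
  by apply: (le_trans m_u); case/andP: u01.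
have n2 : 0 <= 2 * n%:R :> R by rewrite mulr_ge0.
apply: (le_trans (lorentz_bounded psi mZ T0 n2 Z2)).
rewrite lee_fin lerD2r ler_wpM2l//.
by have /andP[? ?] := dist_01 0 mZ; rewrite psi_le.
Qed.

End Fixed.

Lemma expR_ln_unbounded (a B : R) : 0 < a ->
  exists n0 : nat, forall n : nat, (n0 <= n)%N -> (0 < n)%N -> B <= expR (a * ln n%:R).
Proof.
move=> a0; exists (Num.bound (expR (B / a))) => n n0n n0.
have n0' : 0 < n%:R :> R by rewrite ltr0n.
have h : B / a <= ln n%:R.
  rewrite -[leLHS]expRK ler_ln ?posrE ?expR_gt0//.
  by rewrite (le_trans (ltW (archi_boundP (expR_ge0 _))))// ler_nat.
apply: (le_trans _ (expR_ge1Dx _)).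
by move: h; rewrite ler_pdivrMr// mulrC; lra.
Qed.

End Estimate.

(** The case n^q u^(q-1) <= 1, that is, (n u)^q <= u. More than q L of the terms
    are nonzero with probability at most about (n u)^(q L) <= u^L, and psi(u^L)
    absorbs the factor n. Below height q L, which is at most a small power of n,
    the norm costs about L psi(n u), and psi(n u) grows like n^th with th < 1. *)
Lemma sparse_estimate (R : realType) (psi : Psi R) (x : nat -> R -> R)
    (y : R -> R) (n : nat) (u d a eps C2 : R) (L : nat) (th C1 e : R) (q : nat) :
  (forall j, measurable_fun `[0 : R, 1] (x j)) -> independent x ->
  identically_distributed x ->
  measurable_fun setT y -> (forall v, `|y v| <= 1) ->
  (0 < n)%N -> 0 < u <= 1 -> dist (y \o x 0%N) 0 <= u ->
  0 < a -> 1 <= C2 -> (0 < L)%N -> L%:R <= expR (a * ln n%:R) ->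
  (forall v, 0 < v < d -> psi (v ^+ L) <= C2 * expR (- (eps * ln n%:R)) * psi v) ->
  n%:R^-1 < d ->
  1 <= C1 -> psi (n%:R * u) <= C1 * expR (th * ln n%:R) * psi u ->
  th + a <= 1 - e -> e <= eps ->
  (0 < q)%N -> n%:R ^+ q * u ^+ q.-1 <= 1 ->
  (lorentz_norm psi (fun s => \sum_(j < n) y (x j s) - n%:R * mean (y \o x 0%N))%R <=
   ((q%:R * (expR 1 * C1) + expR 1 * C2 + C1) *
    expR ((1 - e) * ln n%:R) * psi u)%:E)%E.
Proof.
move=> mx ix idx my y1 n_gt0 u01 du a0 C21 L0 Lt DL nd.
set t := ln n%:R in Lt DL *; set Z := fun s => _.
have n0' : 0 < n%:R :> R by rewrite ltr0n.
have t0 : 0 <= t by rewrite ln_ge0// ler1n.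
have nE : n%:R = expR t by rewrite lnK ?posrE.
move=> C11 g1 tha ee q0 sparse; have /andP[u0 u1] := u01.
have nuq : (n%:R * u) ^+ q <= u.
  rewrite exprMn -[X in u ^+ X](prednK q0)// exprSr mulrA.
  by rewrite ler_piMl// ltW.
have nu0 : 0 < n%:R * u by rewrite mulr_gt0.
have nu1 : n%:R * u <= 1.
  rewrite leNgt; apply/negP => nu1.
  have := le_trans nuq u1; rewrite leNgt => /negP; apply.
  by rewrite exprn_egt1// -lt0n.
have ud : u < d.
  by apply: le_lt_trans nd; rewrite -[leRHS]mul1r ler_pdivlMr// mulrC.
have E10 : 0 <= expR 1 :> R by exact: expR_ge0.
have E11 : 1 <= expR 1 :> R by rewrite -[leLHS]expR0 ler_expR.
have uL0 : 0 < u ^+ L by rewrite exprn_gt0.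
have uL1 : u ^+ L <= 1 by rewrite exprn_ile1// ltW.
have mS : measurable_fun `[0 : R, 1] (fun s => \sum_(j < n) y (x j s)).
  by apply: measurable_sum => j; exact: measurableT_comp.
have tail : psi (dist (fun s => \sum_(j < n) y (x j s)) (q * L)%:R) <=
    expR 1 * (C2 * expR (- (eps * t)) * psi u).
  apply: (@le_trans _ _ (expR 1 * psi (u ^+ L))).
    apply: psi_le_dilate (dist_01 _ mS) _ E11 _; first by rewrite uL0.
    apply: (le_trans (few_nonzero mx ix idx my y1 (q * L) du u0 n_gt0 nu1)).
    rewrite ler_wpM2l// exprS exprM.
    have p0 : 0 <= (n%:R * u) ^+ q by rewrite exprn_ge0// ltW.
    apply: (@le_trans _ _ (((n%:R * u) ^+ q) ^+ L)).
      by rewrite ler_piMl// exprn_ge0.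
    by apply: lerXn2r; rewrite ?nnegrE// ltW.
  by rewrite ler_wpM2l// DL// u0.
apply: (le_trans (sparse_bound psi mx ix idx my y1 n_gt0 u01 du (q * L) nu1)).
set w := expR ((1 - e) * t).
have Lw : L%:R * expR (th * t) <= w.
  apply: (@le_trans _ _ (expR ((th + a) * t))).
    by rewrite mulrDl addrC expRD ler_wpM2r ?expR_ge0.
  by rewrite ler_expR ler_wpM2r.
have tw : expR (th * t) <= w.
  by rewrite ler_expR ler_wpM2r// (le_trans _ tha)// lerDl ltW.
have nw : n%:R * expR (- (eps * t)) <= w.
  rewrite nE -expRD ler_expR -[X in X + _]mul1r -mulNr -mulrDl ler_wpM2r//.
  by rewrite lerD2l lerN2.
have pu : 0 <= psi u by rewrite psi_ge0// (ltW u0).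
have C10 : 0 <= C1 := le_trans ler01 C11.
have C20 : 0 <= C2 := le_trans ler01 C21.
rewrite lee_fin !mulrDl; apply: lerD; [apply: lerD|].
- rewrite natrM; apply: (@le_trans _ _ (q%:R * L%:R * (expR 1 * (C1 * expR (th * t) * psi u)))).
    by rewrite ler_wpM2l// ler_wpM2l.
  rewrite [leLHS](_ : _ = q%:R * (expR 1 * C1) * (L%:R * expR (th * t)) * psi u); last by ring.
  by rewrite ler_wpM2r// ler_wpM2l// mulr_ge0// mulr_ge0.
- apply: (@le_trans _ _ (n%:R * (expR 1 * (C2 * expR (- (eps * t)) * psi u)))).
    by rewrite ler_wpM2l.
  rewrite [leLHS](_ : _ = expR 1 * C2 * (n%:R * expR (- (eps * t))) * psi u); last by ring.
  by rewrite ler_wpM2r// ler_wpM2l// mulr_ge0.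
- apply: (le_trans g1); rewrite ler_wpM2r// ler_wpM2l//.
Qed.

(** The case n^q u^(q-1) > 1, where u is not much smaller than 1/n. Then
    T = n^(1-a) psi(u) is at least a positive power of n, and the deviation
    inequality with lam of order n^-a bounds the probability of a deviation
    larger than T by (n^-2)^L. Below height T the norm costs T psi(1); above it,
    psi of that probability absorbs the factor n. *)
Lemma dense_estimate (R : realType) (psi : Psi R) (x : nat -> R -> R)
    (y : R -> R) (n : nat) (u d a eps C2 : R) (L : nat) (th c0 lam0 e : R) (q : nat) :
  (forall j, measurable_fun `[0 : R, 1] (x j)) -> independent x ->
  identically_distributed x ->
  measurable_fun setT y -> (forall v, `|y v| <= 1) ->
  (0 < n)%N -> 0 < u <= 1 -> dist (y \o x 0%N) 0 <= u ->
  0 < a -> 1 <= C2 -> (0 < L)%N -> L%:R <= expR (a * ln n%:R) ->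
  (forall v, 0 < v < d -> psi (v ^+ L) <= C2 * expR (- (eps * ln n%:R)) * psi v) ->
  n%:R^-1 < d ->
  0 <= th -> th = 1 - 8 * a ->
  0 < c0 -> c0 * expR (th * ln u) <= psi u ->
  0 < lam0 -> lam0 <= 1 / 6 -> lam0 <= psi 1 / 2 ->
  e <= a -> e <= eps ->
  (2 < q)%N -> a^-1 <= q.-1%:R ->
  (2 / a + 1) * 2 / (lam0 * c0) <= expR (a * ln n%:R) ->
  1 < n%:R ^+ q * u ^+ q.-1 ->
  (lorentz_norm psi (fun s => \sum_(j < n) y (x j s) - n%:R * mean (y \o x 0%N))%R <=
   ((psi 1 + 2 * C2) *
    expR ((1 - e) * ln n%:R) * psi u)%:E)%E.
Proof.
move=> mx ix idx my y1 n_gt0 u01 du a0 C21 L0 Lt DL nd.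
set t := ln n%:R in Lt DL *; set Z := fun s => _.
have n0' : 0 < n%:R :> R by rewrite ltr0n.
have t0 : 0 <= t by rewrite ln_ge0// ler1n.
have nE : n%:R = expR t by rewrite lnK ?posrE.
move=> th0 thE c00 low lam00 lam06 lamp ea ee q2 qa big dense.
have /andP[u0 u1] := u01.
have q10 : 0 < q.-1%:R :> R by rewrite ltr0n -ltnS (ltn_predK q2) ltnW.
have qi : q.-1%:R^-1 <= a.
  by rewrite -[leRHS]invrK lef_pV2 ?posrE ?invr_gt0.
have qi1 : q.-1%:R^-1 <= 1 :> R.
  by rewrite invf_le1// ler1n -ltnS (ltn_predK q2) ltnW.
(* The lower bound on u, in logarithmic form: u > n^(-1-1/(q-1)). *)
have lnu : - ((1 + q.-1%:R^-1) * t) < ln u.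
  have : 0 < ln (n%:R ^+ q * u ^+ q.-1) by rewrite ln_gt0.
  rewrite lnM ?posrE ?exprn_gt0// lnXn// lnXn//.
  rewrite -[ln n%:R *+ q]mulr_natl -[ln u *+ _]mulr_natl -/t.
  rewrite -[in q%:R * t](ltn_predK q2) -natr1 => H.
  rewrite -(ltr_pM2l q10) mulrN mulrA mulrDr mulr1 mulfV ?gt_eqF//.
  by rewrite -subr_gt0 opprK addrC.
have lnu1 : ln u <= 0 by rewrite ln_le0.
have thlnu : - ((th + a) * t) <= th * ln u.
  have h1 : th * (- ((1 + q.-1%:R^-1) * t)) <= th * ln u.
    by rewrite ler_wpM2l// ltW.
  apply: le_trans h1; rewrite mulrN lerN2 mulrA ler_wpM2r//.
  rewrite mulrDr mulr1 lerD2l; apply: le_trans qi.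
  have th1 : th <= 1 by rewrite thE gerBl mulr_ge0// ltW.
  by apply: ler_piMl => //; rewrite invr_ge0 ltW.
(* The probability bound below is (n^-2)^L: here n^-2 is at most u, and within
   the range of DL. *)
have u2 : expR (- 2 * t) <= u.
  rewrite -[leRHS]lnK ?posrE// ler_expR; apply: le_trans (ltW lnu).
  rewrite mulNr lerN2 ler_wpM2r//; clear - qi1; lra.
have nE1 : expR (- t) = n%:R^-1 by rewrite expRN -nE.
have v_d : 0 < expR (- 2 * t) < d.
  rewrite expR_gt0/=; apply: le_lt_trans nd; rewrite -nE1 ler_expR.
  by clear - t0; lra.
have pu : 0 < psi u by exact: psi_gt0.
pose T := expR ((1 - a) * t) * psi u.
have T0 : 0 <= T by rewrite mulr_ge0 ?expR_ge0// ltW.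
have Tlow : c0 * expR (6 * a * t) <= T.
  apply: (@le_trans _ _ (expR ((1 - a) * t) * (c0 * expR (th * ln u)))); last first.
    by rewrite ler_wpM2l ?expR_ge0.
  rewrite mulrCA ler_wpM2l ?(ltW c00)// -expRD ler_expR.
  apply: (@le_trans _ _ ((1 - a) * t + - ((th + a) * t))); last by rewrite lerD2l.
  by rewrite -mulNr -mulrDl ler_wpM2r// thE; clear; lra.
pose lam := lam0 * expR (- (a * t)).
have lam_ge0 : 0 <= lam by rewrite mulr_ge0 ?expR_ge0// ltW.
have lam6 : 0 <= lam <= 1 / 6.
  rewrite lam_ge0/=; apply: le_trans lam06; rewrite ler_piMr ?(ltW lam00)//.
  by rewrite expR_le1 oppr_le0 mulr_ge0// ltW.
have lamT : lam0 * c0 * expR (5 * a * t) <= lam * T.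
  rewrite /lam [leRHS](_ : _ = lam0 * (expR (- (a * t)) * T)); last by ring.
  rewrite -mulrA ler_wpM2l ?(ltW lam00)//.
  apply: (@le_trans _ _ (expR (- (a * t)) * (c0 * expR (6 * a * t)))); last first.
    by rewrite ler_wpM2l ?expR_ge0.
  rewrite mulrCA ler_wpM2l ?(ltW c00)// -expRD ler_expR; clear; lra.
have lamnu : lam * n%:R * u <= T / 2.
  rewrite /T /lam nE (_ : _ * u = (expR (- (a * t)) * expR t) * (lam0 * u)); last by ring.
  rewrite -expRD (_ : - (a * t) + t = (1 - a) * t); last by ring.
  rewrite -mulrA ler_wpM2l ?expR_ge0//.
  apply: (@le_trans _ _ (psi 1 / 2 * u)); first by rewrite ler_wpM2r// ltW.
  have := @psi_id_le _ psi u; rewrite (ltW u0) u1 => /(_ isT); clear; lra.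
have expo : - (lam * T) + lam ^+ 2 * n%:R * u <= - (lam * T) / 2.
  rewrite expr2 -mulrA -mulrA (mulrA lam n%:R).
  have := ler_wpM2l lam_ge0 lamnu; clear; lra.
have tat : t <= expR (a * t) / a.
  rewrite ler_pdivlMr// mulrC; apply: le_trans (expR_ge1Dx _); clear; lra.
(* lam T is at least of order n^(5a), while L ln n is at most of order n^(2a). *)
have main : 2 * L%:R * t + ln 2 <= lam * T / 2.
  have w1 : 1 <= expR (a * t) by rewrite -[leLHS]expR0 ler_expR mulr_ge0// ltW.
  move: big Lt tat w1 lamT; have -> : 5 * a * t = 5%:R * (a * t) by ring.
  rewrite expRM_natl; set w := expR (a * t) => big Lt' tat w1 lamT.
  have ln2 : ln 2 <= 1 :> R.
    have := @expR_ge1Dx R 1 => h.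
    by rewrite -[leRHS]expRK ler_ln ?posrE ?expR_gt0//; clear - h; lra.
  have ww : 1 <= w ^+ 2 by rewrite exprn_ege1.
  have Lt2 : L%:R * t <= w ^+ 2 / a.
    rewrite expr2 -mulrA; apply: ler_pM => //.
  have cc : 0 < lam0 * c0 by rewrite mulr_gt0.
  have big' : 2 / a + 1 <= lam0 * c0 * w / 2.
    move: big; rewrite ler_pdivrMr//; clear; lra.
  have w25 : w * w ^+ 2 <= w ^+ 5 by rewrite -exprS ler_weXn2l.
  have cw : lam0 * c0 * (w * w ^+ 2) <= lam * T.
    by apply: le_trans lamT; rewrite ler_wpM2l// ltW.
  have h := ler_wpM2r (le_trans ler01 ww) big'.
  apply: (@le_trans _ _ ((2 / a + 1) * w ^+ 2)).
    rewrite [leLHS](_ : _ = 2 * (L%:R * t) + ln 2); last by ring.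
    rewrite [leRHS](_ : _ = 2 * (w ^+ 2 / a) + w ^+ 2); last by ring.
    by apply: lerD; [rewrite ler_wpM2l|exact: le_trans ln2 ww].
  by apply: (le_trans h); clear - cw; lra.
have distT : dist Z T <= expR (- 2 * t) ^+ L.
  apply: (le_trans (deviation mx ix idx n T my y1 du lam6)).
  apply: (@le_trans _ _ (2 * expR (- (lam * T) / 2))).
    by rewrite ler_wpM2l// ler_expR.
  rewrite -expRM_natl -[X in X * _]lnK ?posrE// -expRD ler_expR.
  by clear - main; lra.
have mZ : measurable_fun `[0 : R, 1] Z.
  by apply: measurable_funB => //; apply: measurable_sum => j; exact: measurableT_comp.
have v1 : expR (- 2 * t) <= 1 by rewrite expR_le1 nmulr_rle0//; clear; lra.
have tail : psi (dist Z T) <= C2 * expR (- (eps * t)) * psi u.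
  apply: (@le_trans _ _ (psi (expR (- 2 * t) ^+ L))).
    apply: psi_le => //; first exact: prob_ge0.
    by rewrite exprn_ile1// expR_ge0.
  apply: (le_trans (DL _ v_d)); rewrite ler_wpM2l ?mulr_ge0 ?expR_ge0//.
    exact: le_trans ler01 C21.
  by rewrite psi_le// expR_ge0.
apply: (le_trans (dense_bound psi mx my y1 n u01 du T0)); rewrite lee_fin.
have C20 : 0 <= C2 := le_trans ler01 C21.
rewrite [leRHS](_ : _ = psi 1 * expR ((1 - e) * t) * psi u +
  2 * C2 * expR ((1 - e) * t) * psi u); last by ring.
apply: lerD.
  rewrite /T [leLHS](_ : _ = psi 1 * expR ((1 - a) * t) * psi u); last by ring.
  rewrite ler_wpM2r ?(ltW pu)// ler_wpM2l ?(ltW (psi1_gt0 psi))//.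
  by rewrite ler_expR ler_wpM2r// lerD2l lerN2.
apply: (@le_trans _ _ (2 * n%:R * (C2 * expR (- (eps * t)) * psi u))).
  by rewrite ler_wpM2l// mulr_ge0.
rewrite nE [leLHS](_ : _ = 2 * C2 * (expR t * expR (- (eps * t))) * psi u); last by ring.
rewrite ler_wpM2r ?(ltW pu)// ler_wpM2l ?mulr_ge0// -expRD ler_expR.
by rewrite -[X in X + _]mul1r -mulNr -mulrDl ler_wpM2r// lerD2l lerN2.
Qed.

(** The triangle inequality gives n psi(u); the improvement to n^(1-e) psi(u) is
    uniform in the measure u of the support. The uniformity is what allows summation over
    the dyadic layers of an unbounded function. Small n are covered by the
    triangle inequality, large n by the sparse or the dense estimate. *)
Lemma iid_estimate (R : realType) (psi : Psi R) (k l : nat) (c1 d1 c2 d2 : R) :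
  (2 <= k)%N -> c1 < k%:R -> 0 < d1 ->
  (forall u, 0 < u < d1 -> psi (k%:R * u) <= c1 * psi u) ->
  (2 <= l)%N -> c2 < 1 -> 0 < d2 ->
  (forall u, 0 < u < d2 -> psi (u ^+ l) <= c2 * psi u) ->
  exists e, exists2 C, 0 < e < 1 /\ 0 <= C &
  forall x : nat -> R -> R, (forall j, measurable_fun `[0 : R, 1] (x j)) ->
  independent x -> identically_distributed x ->
  forall y : R -> R, measurable_fun setT y -> (forall v, `|y v| <= 1) ->
  forall (n : nat) (u : R), (0 < n)%N -> 0 < u <= 1 ->
  dist (y \o x 0%N) 0 <= u ->
  (lorentz_norm psi (fun t => \sum_(j < n) y (x j t) - n%:R * mean (y \o x 0%N))%R <=
   (C * expR ((1 - e) * ln n%:R) * psi u)%:E)%E.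
Proof.
move=> k2 c1k d10 Hk l2 c21 d20 Hl.
have [th [C1 [/andP[th0 th1] C11] G]] := psi_growth k2 c1k d10 Hk.
have [c0 c00 Low] := psi_lower th0 C11 G.
(* Eight parts a of the gap between th and 1 are spent on the length L <= n^a,
   on the lower bound for u and on the deviation parameter lam. *)
pose a := (1 - th) / 8; have a0 : 0 < a by rewrite /a; clear - th1; lra.
have thE : th = 1 - 8 * a by rewrite /a; clear; lra.
have [eps [C2 [eps0 C21] Dec]] := psi_decay l2 c21 d20 a0 Hl.
have C10 := le_trans ler01 C11; have C20 := le_trans ler01 C21.
pose d := Num.min d2 1; have dd0 : 0 < d by rewrite lt_min d20 ltr01.
have p1 := psi1_gt0 psi.
pose lam0 := Num.min (1 / 6) (psi 1 / 2).
have lam00 : 0 < lam0 by rewrite lt_min !divr_gt0.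
(* Large enough for 1/(q-1) <= a, so that u > n^(-1-a) in the dense case. *)
pose q := (Num.bound a^-1).+3.
have qa : a^-1 <= q.-1%:R.
  rewrite /q/= (le_trans (ltW (archi_boundP _))) ?invr_ge0 ?(ltW a0)//.
  by rewrite ler_nat -addn2 leq_addr.
have [n1 Hn1] := expR_ln_unbounded (2 / d) (ltr01 (R := R)).
have [n2 Hn2] := expR_ln_unbounded ((2 / a + 1) * 2 / (lam0 * c0)) a0.
pose n0 := maxn n1 n2.
pose e := Num.min (Num.min a eps) (1 / 2).
have e0 : 0 < e by rewrite !lt_min a0 eps0 divr_gt0.
have ea : e <= a by rewrite !ge_min lexx.
have ee : e <= eps by rewrite !ge_min lexx orbT.
have e1 : e < 1.
  by rewrite gt_min; apply/orP; right; clear; lra.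
pose A := q%:R * (expR 1 * C1) + expR 1 * C2 + C1; pose B := psi 1 + 2 * C2.
have A0 : 0 <= A by rewrite !addr_ge0 ?mulr_ge0 ?expR_ge0.
have B0 : 0 <= B by rewrite addr_ge0 ?mulr_ge0// ltW.
have N0 : 0 <= 2 * n0%:R :> R by rewrite mulr_ge0.
(* A serves the sparse case, B the dense case, 2 n0 the small values of n. *)
exists e; exists (A + B + 2 * n0%:R); first by split; [rewrite e0 e1|exact: addr_ge0 (addr_ge0 A0 B0) N0].
move=> x mx ix idx y my y1 n u n_gt0 u01 du.
have /andP[u0 u1] := u01.
have t0 : 0 <= ln n%:R :> R by rewrite ln_ge0// ler1n.
have w1 : 1 <= expR ((1 - e) * ln n%:R) :> R.
  by rewrite -[leLHS]expR0 ler_expR mulr_ge0// subr_ge0 ltW.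
have w0 := le_trans ler01 w1.
have pu : 0 < psi u by exact: psi_gt0.
have [nn0|n0n] := ltnP n n0.
  apply: (le_trans (crude_bound psi mx idx my y1 n u01 du)).
  rewrite lee_fin ler_wpM2r ?(ltW pu)//.
  apply: (@le_trans _ _ (2 * n0%:R * 1)).
    by rewrite mulr1 ler_wpM2l// ler_nat ltnW.
  by apply: ler_pM => //; rewrite lerDr; exact: addr_ge0 A0 B0.
have {}Hn1 := Hn1 n (leq_trans (leq_maxl _ _) n0n) n_gt0.
have {}Hn2 := Hn2 n (leq_trans (leq_maxr _ _) n0n) n_gt0.
have n0' : 0 < n%:R :> R by rewrite ltr0n.
rewrite mul1r lnK ?posrE// in Hn1.
have nd : n%:R^-1 < d.
  rewrite -[ltRHS]invrK ltf_pV2 ?posrE ?invr_gt0//.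
  by apply: lt_le_trans Hn1; rewrite mulr_natl mulr2n ltrDl invr_gt0.
have [L [L0 Lt DL]] := Dec n n_gt0.
have [sparse|dense] := leP (n%:R ^+ q * u ^+ q.-1) 1.
  have nu1 : n%:R * u <= 1.
    rewrite leNgt; apply/negP => nu1; move: sparse; rewrite leNgt => /negP; apply.
    rewrite -[X in n%:R ^+ X]prednK// exprSr mulrAC -exprMn.
    have nu2 : 1 < (n%:R * u) ^+ q.-1 by rewrite exprn_egt1.
    apply: (lt_le_trans nu2); rewrite ler_peMr ?ler1n//.
    by rewrite (le_trans ler01)// ltW.
  have g1 := G n u n_gt0 u0 nu1.
  have the : th + a <= 1 - e by rewrite thE; clear - ea a0; lra.
  have := @sparse_estimate _ psi x y n u d a eps C2 L th C1 e q mx ix idx my y1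
     n_gt0 u01 du a0 C21 L0 Lt DL nd C11 g1 the ee isT sparse.
  move=> /le_trans; apply; rewrite lee_fin ler_wpM2r ?(ltW pu)// ler_wpM2r//.
  by rewrite -/A -addrA lerDl; exact: addr_ge0 B0 N0.
have lam06 : lam0 <= 1 / 6 by rewrite ge_min lexx.
have lamp : lam0 <= psi 1 / 2 by rewrite ge_min lexx orbT.
have := @dense_estimate _ psi x y n u d a eps C2 L th c0 lam0 e q mx ix idx my y1
   n_gt0 u01 du a0 C21 L0 Lt DL nd th0 thE c00 (Low u u01) lam00 lam06 lamp ea ee
   isT qa Hn2 dense.
move=> /le_trans; apply; rewrite lee_fin ler_wpM2r ?(ltW pu)// ler_wpM2r//.
by rewrite -/B addrAC lerDr; exact: addr_ge0 A0 N0.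
Qed.

(** * The law of large numbers in the Lorentz space *)

Section Truncated.
Variables (R : realType) (psi : Psi R).
Local Notation N := (lorentz_norm psi).

Let D : set R := `[0, 1]%classic.
Let mD : measurable D. Proof. exact: measurable_itv. Qed.

Section Identical.
Variable x : nat -> R -> R.
Hypothesis mx : forall k, measurable_fun D (x k).
Hypothesis idx : identically_distributed x.

Lemma dist_identical (g : R -> R) k s : measurable_fun setT g ->
  dist (g \o x k) s = dist (g \o x 0%N) s.
Proof.
move=> mg; have mB : measurable (g @^-1` [set v | s < `|v|]).
  rewrite -[X in measurable X]setTI; apply: mg => //.
  have : measurable_fun setT (@Num.norm R R) by exact: normr_measurable.
  move=> /(_ measurableT `]s, +oo[%classic); rewrite setTI.
  rewrite (_ : _ @^-1` _ = [set v | s < `|v|]); first by apply; exact: measurable_itv.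
  by apply/seteqP; split => v /=; rewrite in_itv/= andbT.
exact: (prob_id idx k mB).
Qed.

Lemma lorentz_identical (g : R -> R) k : measurable_fun setT g ->
  N (g \o x k) = N (g \o x 0%N).
Proof.
move=> mg; rewrite !lorentzE; [|exact: measurableT_comp..].
by apply: eq_integral => s _; rewrite dist_identical.
Qed.

End Identical.

Section Fixed.
Variable x : nat -> R -> R.
Hypothesis fx : forall k, fspace N (x k).
Hypothesis idx : identically_distributed x.
Hypothesis x0 : mean (x 0%N) = 0.

Let mx k : measurable_fun D (x k). Proof. by case: (fx k). Qed.

Let rem M v : R := v - clip M v.

Let mrem M : measurable_fun setT (rem M).
Proof. by apply: measurable_funB => //; exact: measurable_clip. Qed.

Lemma fspace_clip_rem M : 0 <= M -> fspace N (rem M \o x 0%N).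
Proof.
move=> M0; split; first exact: measurableT_comp.
apply: le_lt_trans (proj2 (fx 0%N)); apply: lorentz_le_abs => //.
  exact: measurableT_comp.
by move=> t _; rewrite /rem/= clip_rem// ge_max normr_ge0 gerBl M0.
Qed.

(** The mean of the sum of the remainders is recentered at the expense of one more
    copy of their norms, whence the factor 2. *)
Lemma truncation_bound M n : 0 <= M ->
  (N (fun t => \sum_(k < n) x k t)%R <=
   N (fun t => \sum_(k < n) clip M (x k t) - n%:R * mean (clip M \o x 0%N))%R +
   (2 * n%:R)%:E * N (rem M \o x 0%N))%E.
Proof.
move=> M0; set m := mean (clip M \o x 0%N).
have mclip k : measurable_fun D (clip M \o x k) by exact: measurable_clip_comp.
have clipl1 : l1 (clip M \o x 0%N).
  by apply: (@l1_bounded _ _ M) => // t _; exact: clip_le.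
have reml1 : l1 (rem M \o x 0%N) := fspace_l1 (fspace_clip_rem M0).
have mE : m = - mean (rem M \o x 0%N).
  apply/eqP; rewrite -addr_eq0 -meanD//; apply/eqP; rewrite -[RHS]x0.
  by congr mean; apply/funext => t /=; rewrite /rem addrC subrK.
have mr k : measurable_fun D (rem M \o x k) by exact: measurableT_comp.
have mA : measurable_fun D (fun t => \sum_(k < n) clip M (x k t) - n%:R * m).
  by apply: measurable_funB => //; apply: measurable_sum => k; exact: mclip.
have mB : measurable_fun D (fun t => \sum_(k < n) rem M (x k t)).
  by apply: measurable_sum => k; exact: mr.
rewrite (_ : (fun t => \sum_(k < n) x k t) = (fun t =>
   (\sum_(k < n) clip M (x k t) - n%:R * m) +
   (\sum_(k < n) rem M (x k t) + cst (n%:R * m) t))); last first.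
  apply/funext => t /=; rewrite addrACA addNr addr0 -big_split/=.
  by apply: eq_bigr => k _; rewrite /rem addrC subrK.
apply: (le_trans (lorentz_triangle psi mA (measurable_funD mB (measurable_cst _)))).
apply: leeD => //.
apply: (le_trans (lorentz_triangle psi mB (measurable_cst _))).
have N0 : (0 <= N (rem M \o x 0%N))%E by exact: lorentz_ge0.
have -> : ((2 * n%:R)%:E * N (rem M \o x 0%N) =
    n%:R%:E * N (rem M \o x 0%N) + n%:R%:E * N (rem M \o x 0%N))%E.
  by rewrite -ge0_muleDl ?lee_fin// -EFinD; congr (_%:E * _)%E; ring.
apply: leeD.
  apply: (le_trans (lorentz_sum psi n mr)).
  rewrite (eq_bigr (fun=> N (rem M \o x 0%N))); last first.
    by move=> k _; exact: lorentz_identical.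
  have /fineK <- : N (rem M \o x 0%N) \is a fin_num.
    by rewrite ge0_fin_numE//; case: (fspace_clip_rem M0).
  by rewrite sumEFin sumr_const card_ord -EFinM mulr_natl.
apply: (le_trans (lorentz_cst _ _)).
rewrite normrM normr_nat mE normrN -mulrA EFinM lee_wpmul2l ?lee_fin//.
rewrite mulrC; apply: lorentz_dom_mean; exact: fspace_clip_rem.
Qed.

End Fixed.

(** The finite set of indices is transported along f; B is extended to all
    indices by choosing a preimage. *)
Lemma independent_sub (x : nat -> R -> R) (f : nat -> nat) : injective f ->
  independent x -> independent (x \o f).
Proof.
move=> injf ix J B mB.
pose B' i := B (xget 0%N [set j | f j = i]).
have B'E j : B' (f j) = B j.
  rewrite /B'; congr B; case: xgetP => [i -> /= /injf//|/(_ j)].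
  by case.
have := ix [fset f j | j in J]%fset B' (fun i => mB _).
rewrite big_imfset/=; last by move=> ? ? _ _; exact: injf.
rewrite (_ : \bigcap_(i in _) _ = \bigcap_(i in [set` J]) ((x \o f) i @^-1` B i)).
  by move=> ->; apply: eq_bigr => j _; rewrite B'E.
apply/seteqP; split => t /= H j.
  move=> jJ; have := H (f j); rewrite /= B'E; apply.
  by apply/imfsetP; exists j.
by move=> /imfsetP[i iJ ->]; rewrite B'E; exact: H.
Qed.

Lemma identically_distributed_sub (x : nat -> R -> R) (f : nat -> nat) :
  identically_distributed x -> identically_distributed (x \o f).
Proof. by move=> idx i j B mB; exact: idx. Qed.

Lemma mean_ge0E (f : R -> R) : measurable_fun D f -> (forall t, 0 <= f t) ->
  mean f = fine (\int[@lebesgue_measure R]_(s in `[0%R, +oo[) (dist f s)%:E)%E.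
Proof.
move=> mf f0; rewrite -excessE// /mean /Rintegral /excess; congr fine.
apply: eq_integral => t _; congr EFin.
by rewrite subr0 ger0_norm// (max_idPl _).
Qed.

(** Equal laws give equal distribution functions of the positive and of the
    negative parts, and the mean is the difference of the integrals of these. *)
Lemma mean_identical (x : nat -> R -> R) k : (forall k, fspace N (x k)) ->
  identically_distributed x -> mean (x k) = mean (x 0%N).
Proof.
move=> fx idx; have mx j : measurable_fun D (x j) by case: (fx j).
pose pos v : R := Num.max v 0; pose neg v : R := Num.max (- v) 0.
have mpos : measurable_fun setT pos by apply: measurable_maxr.
have mneg : measurable_fun setT neg by apply: measurable_maxr => //; exact: measurable_funN.
have fpos j : l1 (pos \o x j).
  apply: (@fspace_l1 _ psi); split; first exact: measurableT_comp.
  apply: le_lt_trans (proj2 (fx j)); apply: lorentz_le_abs => //.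
    exact: measurableT_comp.
  move=> t _; rewrite /pos/= ger0_norm ?le_max ?lexx ?orbT//.
  by rewrite ge_max ler_norm normr_ge0.
have fneg j : l1 (neg \o x j).
  apply: (@fspace_l1 _ psi); split; first exact: measurableT_comp.
  apply: le_lt_trans (proj2 (fx j)); apply: lorentz_le_abs => //.
    exact: measurableT_comp.
  move=> t _; rewrite /neg/= ger0_norm ?le_max ?lexx ?orbT//.
  by rewrite ge_max -normrN ler_norm normr_ge0.
have E j : mean (x j) = mean (pos \o x j) - mean (neg \o x j).
  rewrite -mulN1r -meanZ// -meanD//; last exact: l1Z.
  congr mean; apply/funext => t; rewrite /pos /neg/=.
  have [h|] := boolP (0 <= x j t).
    by rewrite (max_idPl h) (max_idPr _); lra.
  rewrite -ltNge => h; rewrite (max_idPr (ltW h)) (max_idPl _); lra.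
rewrite !E; congr (_ - _).
  have p0 j t : 0 <= (pos \o x j) t by rewrite /pos/= le_max lexx orbT.
  rewrite !mean_ge0E//; [|exact: measurableT_comp..]; congr fine.
  by apply: eq_integral => s _; rewrite (dist_identical idx).
have p0 j t : 0 <= (neg \o x j) t by rewrite /neg/= le_max lexx orbT.
rewrite !mean_ge0E//; [|exact: measurableT_comp..]; congr fine.
by apply: eq_integral => s _; rewrite (dist_identical idx).
Qed.

(** A law of large numbers in norm. Truncation at a height M leaves a remainder
    of small norm; the truncated sum deviates from its mean by more than a small
    multiple of n only with exponentially small probability, which psi maps to
    a small number. *)
Lemma lorentz_lln (x : nat -> R -> R) (e : R) : (forall k, fspace N (x k)) ->
  independent x -> identically_distributed x -> mean (x 0%N) = 0 -> 0 < e ->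
  exists n0 : nat, forall n, (n0 <= n)%N -> (0 < n)%N ->
    (N (fun t => \sum_(k < n) x k t)%R <= (e * n%:R)%:E)%E.
Proof.
move=> fx ix idx x0 e0; have mx j : measurable_fun D (x j) by case: (fx j).
have p1 := psi1_gt0 psi.
have cv := clip_rem_cvg (fx 0%N).
have [M M0 NM] : exists2 M : R, 0 < M & (N (fun t => x 0%N t - clip M (x 0%N t))%R <= (e / 4)%:E)%E.
  have /fine_cvgP[Hfin /cvgr_lt Hlt] := cv.
  have e4' : 0 < e / 4 by rewrite divr_gt0.
  have [n1 _ H1] := Hfin; have [n2 _ H2] := Hlt _ e4'.
  pose n := (maxn n1 n2).+1.
  have h1 := H1 n (leq_trans (leq_maxl _ _) (leqnSn _)).
  have h2 := H2 n (leq_trans (leq_maxr _ _) (leqnSn _)).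
  exists n%:R; first by rewrite ltr0n.
  by rewrite -(fineK h1) lee_fin ltW.
(* Deviations up to th n cost at most a quarter of e n; the bound 1/3 makes
   th/2 an admissible parameter of the deviation inequality. *)
pose th := Num.min (1 / 3) (e / 4 / (M * psi 1)).
have th0 : 0 < th by rewrite lt_min !divr_gt0// mulr_gt0.
have th3 : th <= 1 / 3 by rewrite ge_min lexx.
have thM : M * (th * psi 1) <= e / 4.
  have : th <= e / 4 / (M * psi 1) by rewrite ge_min lexx orbT.
  rewrite ler_pdivlMr ?mulr_gt0// => h; apply: le_trans h.
  by rewrite mulrCA.
have e16 : 0 < e / (8 * M) by rewrite divr_gt0// mulr_gt0.
have [d /andP[d0 d1] Hd] := psi_small psi e16.
have th4 : 0 < th ^+ 2 / 4 by rewrite divr_gt0// exprn_gt0.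
pose n0 := Num.bound (`|ln 2 - ln d| / (th ^+ 2 / 4)).
exists n0 => n n0n n_gt0; have n0' : 0 < n%:R :> R by rewrite ltr0n.
pose y v := M^-1 * clip M v.
have my : measurable_fun setT y by apply: measurable_funM => //; exact: measurable_clip.
have y1 v : `|y v| <= 1.
  rewrite normrM gtr0_norm ?invr_gt0// ler_pdivrMl// mulr1.
  by apply: clip_le; exact: ltW.
have du : dist (y \o x 0%N) 0 <= 1.
  by have /andP[] := dist_01 0 (measurableT_comp my (mx 0%N)).
pose Z t := \sum_(k < n) y (x k t) - n%:R * mean (y \o x 0%N).
have mZ : measurable_fun D Z.
  by apply: measurable_funB => //; apply: measurable_sum => k; exact: measurableT_comp.
have T0 : 0 <= th * n%:R by rewrite mulr_ge0// ltW.
have u01 : 0 < (1 : R) <= 1 by rewrite ltr01 lexx.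
have lam6 : 0 <= th / 2 <= 1 / 6 by apply/andP; split; lra.
have NZ := dense_bound psi mx my y1 n u01 du T0.
have dev := deviation mx ix idx n (th * n%:R) my y1 du lam6.
have small : dist Z (th * n%:R) <= d.
  apply: (le_trans dev).
  rewrite (_ : - (th / 2 * (th * n%:R)) + (th / 2) ^+ 2 * n%:R * 1 = - (th ^+ 2 / 4 * n%:R)); last by field.
  rewrite -[X in X * _]lnK ?posrE// -expRD -[leRHS]lnK ?posrE// ler_expR.
  rewrite lerBlDr -lerBlDl.
  have : `|ln 2 - ln d| <= th ^+ 2 / 4 * n%:R.
    rewrite mulrC -ler_pdivrMr// (le_trans (ltW (archi_boundP _)))//.
      by rewrite divr_ge0// ltW.
    by rewrite ler_nat.
  by apply: le_trans; rewrite ler_norm.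
have psmall : psi (dist Z (th * n%:R)) <= e / (8 * M).
  by apply/ltW/Hd => //; exact: prob_ge0.
have NZ' : (N Z <= (th * n%:R * psi 1 + 2 * n%:R * (e / (8 * M)))%:E)%E.
  apply: (le_trans NZ); rewrite lee_fin lerD2l ler_wpM2l//.
apply: (le_trans (truncation_bound fx idx x0 n (ltW M0))).
rewrite (_ : (fun t => \sum_(k < n) clip M (x k t) - _) = (fun t => M * Z t)); last first.
  have mE : mean (clip M \o x 0%N) = M * mean (y \o x 0%N).
    rewrite -meanZ; last first.
      by apply: (@l1_bounded _ _ 1) => [|t _]; [exact: measurableT_comp|exact: y1].
    by congr mean; apply/funext => t /=; rewrite /y mulVKf// gt_eqF.
  apply/funext => t; rewrite /Z mulrBr mulr_sumr mulrCA -mE; congr (_ - _).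
  by apply: eq_bigr => k _; rewrite /y mulVKf// gt_eqF.
apply: (@le_trans _ _ (M%:E * (th * n%:R * psi 1 + 2 * n%:R * (e / (8 * M)))%:E
     + (2 * n%:R)%:E * (e / 4)%:E)%E).
  apply: leeD.
    apply: (le_trans (lorentz_scale_le psi mZ M0)).
    by rewrite lee_wpmul2l// lee_fin ltW.
  by rewrite lee_wpmul2l// lee_fin mulr_ge0.
rewrite -!EFinM -EFinD lee_fin.
rewrite (_ : _ + _ = n%:R * (M * (th * psi 1)) + n%:R * (3 / 4 * e)); last first.
  by field; rewrite gt_eqF.
have := ler_wpM2l (ltW n0') thM.
by rewrite mulrC; lra.
Qed.

End Truncated.

(** * Weakly null sequences and the sufficiency of the conditions *)

(** This functional forces a weakly null identically distributed sequence to have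
    mean zero. *)
Lemma mean_dual_space (R : realType) (psi : Psi R) :
  dual_space (lorentz_norm psi) (@mean R).
Proof.
split.
  move=> a x y fx fy; rewrite meanD; [|exact/l1Z/(fspace_l1 fx)|exact: fspace_l1 fy].
  by rewrite meanZ//; exact: fspace_l1 fx.
have p1 := psi1_gt0 psi.
exists (psi 1)^-1 => x fx; rewrite lee_pdivlMl// -EFinM.
exact: lorentz_dom_mean.
Qed.

Lemma extract_subsequence (P : nat -> Prop) :
  (forall n0, exists2 n, (n0 <= n)%N & P n) ->
  exists2 f : nat -> nat, {homo f : i j / (i < j)%N} & forall i, P (f i).
Proof.
move=> H; have /choice[g Hg] : forall n0, exists n, (n0 <= n)%N /\ P n.
  by move=> n0; have [n ? ?] := H n0; exists n.
pose f := fix f i := if i is j.+1 then g (f j).+1 else g 0%N.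
exists f; last by case=> [|i] /=; [case: (Hg 0%N)|case: (Hg (f i).+1)].
apply: homo_ltn => [i j k|i]; first exact: ltn_trans.
by have [] := Hg (f i).+1.
Qed.

Lemma homo_ltn_inj (f : nat -> nat) : {homo f : i j / (i < j)%N} -> injective f.
Proof.
by move=> hf i j fij; case: (ltngtP i j) => // /hf; rewrite fij ltnn.
Qed.

Section WeaklyNull.
Variables (R : realType) (psi : Psi R).
Local Notation N := (lorentz_norm psi).

(** Functionals are linear only through the combination a x + y; the zero function
    arises as -y + y. *)
Lemma dual_sum phi (y : nat -> R -> R) n : dual_space N phi ->
  (forall k, fspace N (y k)) ->
  phi (fun t => \sum_(k < n) y k t) = \sum_(k < n) phi (y k).
Proof.
move=> [lin _] fy; elim: n => [|n IH].
  have E : phi (fun t => -1 * y 0%N t + y 0%N t) = 0 by rewrite lin// mulN1r addNr.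
  rewrite [RHS]big_ord0 -[RHS]E; congr phi; apply/funext => t.
  by rewrite big_ord0 mulN1r addNr.
rewrite big_ord_recr/= -IH addrC -[X in X + _]mul1r -lin//.
  by congr phi; apply/funext => t; rewrite big_ord_recr/= mul1r addrC.
exact: fspace_sum.
Qed.

(** A functional bounded away from 0 along a subsequence, with constant sign,
    would grow linearly on its sums, against the law of large numbers. *)
Lemma iid_weakly_null (x : nat -> R -> R) : (forall k, fspace N (x k)) ->
  independent x -> identically_distributed x -> mean (x 0%N) = 0 ->
  weakly_null N x.
Proof.
move=> fx ix idx x0; split=> // phi dphi.
have [_ [C HC]] := dphi.
have no_sub (s e : R) : `|s| = 1 -> 0 < e ->
    exists n0, forall n, (n0 <= n)%N -> s * phi (x n) < e.
  move=> s1 e0; apply: contrapT => /forallNP H.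
  have [|f hf Pf] := @extract_subsequence (fun n => e <= s * phi (x n)).
    move=> n0; have /existsNP[n /not_implyP[n0n /negP]] := H n0.
    by rewrite -leNgt => h; exists n.
  have fxf k : fspace N ((x \o f) k) by exact: fx.
  pose e' := e / (2 * (`|C| + 1)).
  have C1 : 0 < `|C| + 1 by rewrite ltr_wpDl.
  have e'0 : 0 < e' by rewrite divr_gt0// mulr_gt0.
  have xf0 : mean ((x \o f) 0%N) = 0 by rewrite /= (mean_identical (psi := psi)).
  have [n0 Hn0] := lorentz_lln fxf (independent_sub (homo_ltn_inj hf) ix)
    (identically_distributed_sub f idx) xf0 e'0.
  have [n [n0n n_gt0]] : exists n, (n0 <= n)%N /\ (0 < n)%N by exists n0.+1.
  have Nn := Hn0 n n0n n_gt0; have n0' : 0 < n%:R :> R by rewrite ltr0n.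
  have lb : e * n%:R <= `|phi (fun t => \sum_(k < n) (x \o f) k t)|.
    rewrite [leRHS](_ : _ = `|s * phi (fun t => \sum_(k < n) (x \o f) k t)|); last first.
      by rewrite normrM s1 mul1r.
    apply: le_trans (ler_norm _).
    rewrite dual_sum// mulr_sumr.
    apply: (@le_trans _ _ (\sum_(k < n) e)); last by apply: ler_sum => k _; exact: Pf.
    by rewrite sumr_const card_ord mulr_natr.
  have ub := HC _ (fspace_sum n fxf).
  have : ((e * n%:R)%:E <= (`|C| * (e' * n%:R))%:E)%E.
    apply: (@le_trans _ _ (`|C|%:E * N (fun t => \sum_(k < n) (x \o f) k t)%R)%E).
      apply: (@le_trans _ _ (C%:E * N (fun t => \sum_(k < n) (x \o f) k t)%R)%E).
        by apply: le_trans ub; rewrite lee_fin.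
      apply: lee_wpmul2r; last by rewrite lee_fin ler_norm.
      by apply: lorentz_ge0; case: (fspace_sum n fxf).
    by rewrite EFinM; apply: lee_wpmul2l => //; rewrite lee_fin.
  rewrite lee_fin mulrA ler_pM2r// leNgt => /negP; apply.
  rewrite /e' mulrA ltr_pdivrMr ?mulr_gt0//.
  rewrite mulrC ltr_pM2l//; have := normr_ge0 C; lra.
apply/cvgrPdist_lt => e e0.
have [n1 H1] := no_sub 1 e (normr1 _) e0.
have [n2 H2] := no_sub (-1) e (normrN1 _) e0.
exists (maxn n1 n2) => // n /= nn.
have h1 := H1 n (leq_trans (leq_maxl _ _) nn).
have h2 := H2 n (leq_trans (leq_maxr _ _) nn).
by rewrite sub0r normrN ltr_norml; move: h1 h2; rewrite mul1r mulN1r; lra.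
Qed.

Lemma weakly_null_mean (x : nat -> R -> R) : weakly_null N x ->
  identically_distributed x -> mean (x 0%N) = 0.
Proof.
move=> [fx wx] idx; have := wx _ (mean_dual_space psi).
rewrite (_ : (fun n => mean (x n)) = cst (mean (x 0%N))).
  by move=> /(cvg_lim (@Rhausdorff R)) <-; rewrite lim_cst//.
by apply/funext => n; exact: (mean_identical (psi := psi)).
Qed.

Lemma subsequence_refl (x : nat -> R -> R) : subsequence x x.
Proof. by exists id. Qed.

Lemma powR_natE (j : nat) (a : R) : (0 < j)%N -> j%:R `^ a = expR (a * ln j%:R).
Proof. by move=> j0; rewrite /powR pnatr_eq0 -[j == 0%N]negbK -lt0n j0. Qed.

(** Identically distributed terms have equal norms, so the triangle inequality
    bounds the sum of j of them by j times that norm. *)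
Lemma Gamma_iid_1 : Gamma_iid N 1.
Proof.
split => // x [fx wx] ix idx; exists x; first exact: subsequence_refl.
have mx k : measurable_fun `[0 : R, 1] (x k) by case: (fx k).
have mi : measurable_fun setT (id : R -> R) by exact: measurable_id.
have Nx k : N (x k) = N (x 0%N) := lorentz_identical psi mx idx k mi.
have Nfin : N (x 0%N) \is a fin_num by rewrite ge0_fin_numE ?lorentz_ge0//; case: (fx 0%N).
split => //.
  by exists (fine (N (x 0%N))) => n; rewrite fineK// Nx.
move=> y [f hf ->]; apply: (@le_lt_trans _ _ (N (x 0%N))); last by case: (fx 0%N).
apply: ge_ereal_sup => _ [j j1 <-].
have j0 : 0 < j%:R :> R by rewrite ltr0n.
rewrite invr1 powRN powRr1 ?ler0n// lee_pdivrMl//.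
apply: (le_trans (lorentz_sum psi j (fun k => mx (f k)))).
rewrite (eq_bigr (fun=> (fine (N (x 0%N)))%:E)); last by move=> k _; rewrite fineK// Nx.
by rewrite sumEFin sumr_const card_ord -[X in (_ <= _ * X)%E](fineK Nfin) -EFinM mulr_natl.
Qed.

Lemma clip_increment (p v : R) : 0 <= p -> `|clip (2 * p) v - clip p v| <= p.
Proof.
move=> p0; have p20 : 0 <= 2 * p by rewrite mulr_ge0.
rewrite ler_norml.
have [[+ ->]|[h ->]|[h ->]] := clip_cases v p0; rewrite ?ler_norml;
  have [[+ ->]|[h' ->]|[h' ->]] := clip_cases v p20; rewrite ?ler_norml;
  by move=> *; repeat match goal with H : is_true (_ && _) |- _ => move/andP: H => [? ?] end;
     apply/andP; split; lra.
Qed.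

Section Sufficiency.
Variables (e C : R).
Hypothesis e01 : 0 < e < 1.
Hypothesis C0 : 0 <= C.
Hypothesis est : forall x : nat -> R -> R,
  (forall j, measurable_fun `[0 : R, 1] (x j)) ->
  independent x -> identically_distributed x ->
  forall y : R -> R, measurable_fun setT y -> (forall v, `|y v| <= 1) ->
  forall (n : nat) (u : R), (0 < n)%N -> 0 < u <= 1 ->
  dist (y \o x 0%N) 0 <= u ->
  (N (fun t => \sum_(j < n) y (x j t) - n%:R * mean (y \o x 0%N))%R <=
   (C * expR ((1 - e) * ln n%:R) * psi u)%:E)%E.

(** For u = 0 the estimate is the limit of the estimates for small positive u, by
    continuity of psi at 0. *)
Lemma estimate_u0 (x : nat -> R -> R) (y : R -> R) (n : nat) (u : R) :
  (forall j, measurable_fun `[0 : R, 1] (x j)) ->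
  independent x -> identically_distributed x ->
  measurable_fun setT y -> (forall v, `|y v| <= 1) ->
  (0 < n)%N -> 0 <= u <= 1 ->
  dist (y \o x 0%N) 0 <= u ->
  (N (fun t => \sum_(j < n) y (x j t) - n%:R * mean (y \o x 0%N))%R <=
   (C * expR ((1 - e) * ln n%:R) * psi u)%:E)%E.
Proof.
move=> mx ix idx my y1 n0 /andP[u0 u1] du.
have [ue0|un0] := eqVneq u 0; last first.
  by apply: est => //; rewrite lt_neqAle eq_sym un0 u0.
rewrite ue0 Psi0 mulr0; apply/lee_addgt0Pr => r r0; rewrite add0e.
pose w := C * expR ((1 - e) * ln n%:R).
have w0 : 0 <= w by rewrite mulr_ge0 ?expR_ge0.
have w1 : 0 < w + 1 by rewrite ltr_wpDl.
have rw : 0 < r / (w + 1) by rewrite divr_gt0.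
have [d d01 Hd] := psi_small psi rw; have /andP[d0 d1] := d01.
have dd : dist (y \o x 0%N) 0 <= d by apply: (le_trans du); rewrite ue0 ltW.
have := est mx ix idx my y1 n0 d01 dd; rewrite -/w => /le_trans; apply.
rewrite lee_fin; have pd := Hd d (ltW d0) (lexx _).
apply: (@le_trans _ _ (w * (r / (w + 1)))); first by rewrite ler_wpM2l// ltW.
by rewrite mulrA ler_pdivrMr// mulrC ler_wpM2l ?(ltW r0)// lerDl.
Qed.

Variable x : nat -> R -> R.
Hypothesis fx : forall k, fspace N (x k).
Hypothesis ix : independent x.
Hypothesis idx : identically_distributed x.
Hypothesis x0 : mean (x 0%N) = 0.

Let mx k : measurable_fun `[0 : R, 1] (x k). Proof. by case: (fx k). Qed.

(** Dyadic layers: each increment of the truncation between the heights 2^i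
    and 2^(i+1) is 2^i times a function with values in [-1, 1] vanishing unless
    |x| > 2^i. *)
Lemma clip_layers n I : (0 < n)%N ->
  (N (fun t => \sum_(k < n) clip (2 ^+ I) (x k t) - n%:R * mean (clip (2 ^+ I) \o x 0%N))%R <=
   (C * expR ((1 - e) * ln n%:R) *
    (psi 1 + \sum_(i < I) 2 ^+ i * psi (dist (x 0%N) (2 ^+ i))))%:E)%E.
Proof.
move=> n0; elim: I => [|I IH].
  rewrite expr0 big_ord0 addr0; apply: est => //.
  - exact: measurable_clip.
  - by move=> v; exact: clip_le.
  - by rewrite ltr01 lexx.
  - by have /andP[] := dist_01 0 (measurableT_comp (@measurable_clip R 1) (mx 0%N)).
have p0 : 0 < 2 ^+ I :> R by rewrite exprn_gt0.
pose y v : R := (clip (2 ^+ I.+1) v - clip (2 ^+ I) v) / 2 ^+ I.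
have my : measurable_fun setT y.
  by apply: measurable_funM => //; apply: measurable_funB; exact: measurable_clip.
have y_small v : `|v| <= 2 ^+ I -> y v = 0.
  move=> v1; rewrite /y !clip_id ?subrr ?mul0r//.
  by apply: (le_trans v1); rewrite exprS ler_peMl ?ler1n ?(ltW p0).
have y1 v : `|y v| <= 1.
  rewrite normrM [X in _ * X]gtr0_norm ?invr_gt0// ler_pdivrMr// mul1r.
  by rewrite exprS clip_increment// ltW.
have du : dist (y \o x 0%N) 0 <= dist (x 0%N) (2 ^+ I).
  apply: le_prob; [by apply: measurable_above; exact: measurableT_comp|exact: measurable_above|].
  move=> t [+ _]; rewrite /above/= normr_gt0 ltNge; apply: contra_neqN.
  exact: y_small.
have du01 := dist_01 (2 ^+ I) (mx 0%N).
have E := estimate_u0 mx ix idx my y1 n0 du01 du.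
have clipl1 M : 0 <= M -> l1 (clip M \o x 0%N).
  move=> M0; apply: (@l1_bounded _ _ M); first exact: measurable_clip_comp.
  by move=> t _; exact: clip_le.
have yl1 : l1 (y \o x 0%N).
  by apply: (@l1_bounded _ _ 1) => [|t _]; [exact: measurableT_comp|exact: y1].
have clipE v : clip (2 ^+ I.+1) v = clip (2 ^+ I) v + 2 ^+ I * y v.
  by rewrite /y mulrC divfK ?gt_eqF// addrC subrK.
have mE : mean (clip (2 ^+ I.+1) \o x 0%N) =
    mean (clip (2 ^+ I) \o x 0%N) + 2 ^+ I * mean (y \o x 0%N).
  rewrite -meanZ// -meanD//; last exact: l1Z.
    by congr mean; apply/funext => t /=; rewrite clipE.
  exact/clipl1/ltW.
have mA : measurable_fun `[0 : R, 1] (fun t => \sum_(k < n) clip (2 ^+ I) (x k t) -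
    n%:R * mean (clip (2 ^+ I) \o x 0%N)).
  by apply: measurable_funB => //; apply: measurable_sum => k; exact: measurable_clip_comp.
have mB : measurable_fun `[0 : R, 1] (fun t => \sum_(k < n) y (x k t) - n%:R * mean (y \o x 0%N)).
  by apply: measurable_funB => //; apply: measurable_sum => k; exact: measurableT_comp.
rewrite (_ : (fun t => _) = (fun t => (\sum_(k < n) clip (2 ^+ I) (x k t) -
    n%:R * mean (clip (2 ^+ I) \o x 0%N)) +
    2 ^+ I * (\sum_(k < n) y (x k t) - n%:R * mean (y \o x 0%N)))); last first.
  apply/funext => t; rewrite mE mulrBr mulr_sumr.
  under eq_bigr do rewrite clipE.
  by rewrite big_split/=; ring.
have F2 := le_trans (lorentz_scale_le psi mB p0)
  (lee_wpmul2l (ltW p0 : (0 <= (2 ^+ I)%:E)%E) E).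
have mB' : measurable_fun `[0 : R, 1] (fun t => 2 ^+ I *
    (\sum_(k < n) y (x k t) - n%:R * mean (y \o x 0%N))) by exact: measurable_funM.
apply: (le_trans (lorentz_triangle psi mA mB')).
apply: (le_trans (leeD IH F2)).
rewrite big_ord_recr/= -EFinM -EFinD lee_fin.
by rewrite le_eqVlt; apply/orP; left; apply/eqP; ring.
Qed.

(** The truncation height 2^I is chosen large enough for the remainders of the n
    terms to have total norm at most 1; the layers below it sum up to a multiple
    of n^(1-e) times the norm of a single term. *)
Lemma iid_sum_bound n : (0 < n)%N ->
  (N (fun t => \sum_(k < n) x k t)%R <=
   ((C * (psi 1 + 2 * fine (N (x 0%N))) + 1) * expR ((1 - e) * ln n%:R))%:E)%E.
Proof.
move=> n0; have n0' : 0 < n%:R :> R by rewrite ltr0n.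
have Nfin : N (x 0%N) \is a fin_num by rewrite ge0_fin_numE ?lorentz_ge0//; case: (fx 0%N).
have r0 : 0 < (2 * n%:R)^-1 :> R by rewrite invr_gt0 mulr_gt0.
have [I HI] : exists I : nat,
    (N (fun t => x 0%N t - clip (2 ^+ I) (x 0%N t))%R <= ((2 * n%:R)^-1)%:E)%E.
  have /fine_cvgP[[n1 _ H1] /cvgr_lt/(_ _ r0)[n2 _ H2]] := clip_rem_cvg (fx 0%N).
  exists (maxn n1 n2).
  have le2 m : (m <= maxn n1 n2)%N -> (m <= 2 ^ maxn n1 n2)%N.
    by move=> h; apply: (leq_trans h); exact/ltnW/ltn_expl.
  have h1 := H1 _ (le2 _ (leq_maxl _ _)); have h2 := H2 _ (le2 _ (leq_maxr _ _)).
  by rewrite /= natrX in h1 h2; rewrite -(fineK h1) lee_fin ltW.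
have p0 : 0 <= 2 ^+ I :> R by rewrite exprn_ge0.
apply: (le_trans (truncation_bound fx idx x0 n p0)).
set w := expR _; have w1 : 1 <= w.
  rewrite -[leLHS]expR0 ler_expR mulr_ge0//; last by rewrite ln_ge0// ler1n.
  by rewrite subr_ge0 ltW//; case/andP: e01.
have w0 := le_trans ler01 w1.
have -> : (C * (psi 1 + 2 * fine (N (x 0%N))) + 1) * w =
    C * (psi 1 + 2 * fine (N (x 0%N))) * w + w by ring.
rewrite EFinD; apply: leeD.
  apply: (le_trans (clip_layers I n0)); rewrite lee_fin -/w mulrAC ler_wpM2r//.
  rewrite ler_wpM2l// lerD2l -lee_fin EFinM fineK//.
  exact: layer_sum.
apply: (@le_trans _ _ ((2 * n%:R)%:E * ((2 * n%:R)^-1)%:E)%E).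
  by apply: lee_wpmul2l => //; rewrite lee_fin mulr_ge0.
by rewrite -EFinM lee_fin mulfV// gt_eqF// mulr_gt0.
Qed.

End Sufficiency.

(** With p = 1/(1 - e) the bound n^(1-e) is exactly n^(1/p). Every subsequence of an
    independent identically distributed sequence is again one with the same law,
    so the sequence itself has the required property. *)
Lemma Gamma_iid_of_estimate (e C : R) : 0 < e < 1 -> 0 <= C ->
  (forall x : nat -> R -> R, (forall j, measurable_fun `[0 : R, 1] (x j)) ->
    independent x -> identically_distributed x ->
    forall y : R -> R, measurable_fun setT y -> (forall v, `|y v| <= 1) ->
    forall (n : nat) (u : R), (0 < n)%N -> 0 < u <= 1 ->
    dist (y \o x 0%N) 0 <= u ->
    (N (fun t => \sum_(j < n) y (x j t) - n%:R * mean (y \o x 0%N))%R <=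
     (C * expR ((1 - e) * ln n%:R) * psi u)%:E)%E) ->
  Gamma_iid N (1 - e)^-1.
Proof.
move=> e01 C0 est; have /andP[e0 e1] := e01.
split; first by rewrite invf_ge1 ?subr_gt0// gerBl ltW.
move=> x wx ix idx; have [fx _] := wx.
have x0 := weakly_null_mean wx idx.
have mx k : measurable_fun `[0 : R, 1] (x k) by case: (fx k).
have mi : measurable_fun setT (id : R -> R) by exact: measurable_id.
have Nx k : N (x k) = N (x 0%N) := lorentz_identical psi mx idx k mi.
have Nfin : N (x 0%N) \is a fin_num by rewrite ge0_fin_numE ?lorentz_ge0//; case: (fx 0%N).
exists x; first exact: subsequence_refl.
split => //.
  by exists (fine (N (x 0%N))) => n; rewrite fineK// Nx.
move=> y [f hf ->].
have fxf k : fspace N ((x \o f) k) by exact: fx.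
have xf0 : mean ((x \o f) 0%N) = 0 by rewrite /= (mean_identical (psi := psi)).
have ixf := independent_sub (homo_ltn_inj hf) ix.
have idxf := identically_distributed_sub f idx.
pose B := C * (psi 1 + 2 * fine (N ((x \o f) 0%N))) + 1.
apply: (@le_lt_trans _ _ B%:E); last exact: ltry.
apply: ge_ereal_sup => _ [j j1 <-].
have := iid_sum_bound e01 C0 est fxf ixf idxf xf0 j1; rewrite -/B => H.
rewrite invrK powR_natE// mulNr expRN lee_pdivrMl ?expR_gt0//.
by rewrite -EFinM mulrC.
Qed.

End WeaklyNull.

(** * The Lueroth expansion of a number in ]0, 1] *)

Section Luroth.
Variable R : realType.
Implicit Types (t : R) (A B E : set R).

Let mu := @lebesgue_measure R.
Let D0 : set R := `]0, 1]%classic.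
Let mD0 : measurable D0. Proof. exact: measurable_itv. Qed.

Lemma m01_oc A : measurable (D0 `&` A) -> m01 A = mu (D0 `&` A).
Proof.
move=> mA; rewrite m01E.
have m0A : measurable ([set 0] `&` A : set R).
  have [A0|A0] := pselect (A 0).
    rewrite (_ : _ `&` _ = [set 0]); first exact: measurable_set1.
    by apply/seteqP; split => t /=; [case|move=> ->].
  rewrite (_ : _ `&` _ = set0)//; apply/seteqP; split => t //= [-> ].
  exact: A0.
have z0A : mu ([set 0] `&` A) = 0%E.
  apply/eqP; rewrite eq_le measure_ge0 andbT.
  have <- : mu [set 0] = 0%E by exact: lebesgue_measure_set1.
  by apply: le_measure; rewrite ?inE//; exact: subIsetl.
have E : `[0, 1]%classic `&` A = ([set 0] `&` A) `|` (D0 `&` A).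
  apply/seteqP; split => t; rewrite /D0/= !in_itv/=.
    move=> [/andP[t0 t1] At]; have [te|tn] := eqVneq t 0; first by left.
    by right; split => //; rewrite lt_neqAle eq_sym tn t0.
  by case=> [[-> ?]|[/andP[/ltW -> ->] ?]]; rewrite ?lexx ?ler01.
rewrite E -[RHS]add0e -z0A.
apply: (@measureU _ _ _ mu) => //; apply/seteqP; split => t //= [[-> _] []].
by rewrite /D0/= in_itv/= ltxx.
Qed.

(** Uniqueness of Lebesgue measure, applied to the rescaled image measure. *)
Lemma lebesgue_affine (a b : R) (E : set R) : 0 < a -> measurable E ->
  mu E = (a%:E * mu ((fun t => a * t + b)%R @^-1` E))%E.
Proof.
move=> a0 mE.
pose f : R -> measurableTypeR R := fun t => a * t + b.
have mf : measurable_fun setT f.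
  by apply: measurable_funD => //; exact: measurable_funM.
pose an := NngNum (ltW a0).
have H : forall A : set (measurableTypeR R), measurable A ->
    mu A = mscale an (pushforward mu f) A.
  move=> mf'; apply: lebesgue_measure_unique => //= _ [[p q]] _ <-.
  pose J : set R := `](p - b) / a, (q - b) / a]%classic.
  transitivity (a%:E * mu J)%E.
    rewrite /mu /J !lebesgue_measure_itv/= !lte_fin ltr_pM2r ?invr_gt0// ltrD2r.
    case: ifPn => _; last by rewrite mule0.
    by rewrite -!EFinD -EFinM; congr EFin; field; rewrite gt_eqF.
  rewrite /mscale/= /pushforward; congr (_ * mu _)%E.
  apply/seteqP; split => t; rewrite /J /f/= !in_itv/= ltr_pdivrMr// ler_pdivlMr//;
    by rewrite ltrBlDr lerBrDr mulrC.
by rewrite (H mf).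
Qed.

(** The number m of the Lueroth interval ]1/(m+1), 1/m] that contains t. *)
Definition luroth_index t : nat := Num.truncn t^-1.

(** The Lueroth map: affine from each ]1/(m+1), 1/m] onto ]0, 1]. Its digits
    are independent, and each is at least m with probability 1/m: they carry the
    sets of measure 1/m needed below. *)
Definition luroth_map t : R :=
  (luroth_index t)%:R * (luroth_index t).+1%:R * t - (luroth_index t)%:R.

Lemma luroth_index_ge m t : 0 < t -> (m <= luroth_index t)%N = (m%:R * t <= 1).
Proof.
move=> t0; rewrite /luroth_index truncn_ge_nat ?invr_ge0 ?(ltW t0)//.
by rewrite -[t^-1]mul1r ler_pdivlMr.
Qed.

Lemma luroth_index_gt0 t : D0 t -> (0 < luroth_index t)%N.
Proof. by rewrite /D0/= in_itv/= => /andP[t0 t1]; rewrite luroth_index_ge// mul1r. Qed.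

(** The branch with index m maps ]1/(m+1), 1/m] affinely onto ]0, 1]. *)
Definition branch m t : R := m%:R * m.+1%:R * t + - m%:R.

Lemma luroth_branch m t : (0 < m)%N ->
  (D0 t /\ luroth_index t = m) <-> D0 (branch m t).
Proof.
move=> m0; have m0' : 0 < m%:R :> R by rewrite ltr0n.
have m1' : 0 < m.+1%:R :> R by rewrite ltr0n.
rewrite /D0 /branch/= !in_itv/=; split.
  move=> [/andP[t0 t1] im].
  have h1 : m%:R * t <= 1 by rewrite -luroth_index_ge// im.
  have h2 : 1 < m.+1%:R * t by rewrite ltNge -luroth_index_ge// im ltnn.
  apply/andP; split.
    by rewrite -mulrA subr_gt0 ltr_pMr.
  by rewrite lerBlDr -natr1 mulrAC; rewrite -natr1 in h2 *; nra.
move=> /andP[h1 h2].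
have t1 : 1 < m.+1%:R * t by move: h1; rewrite -mulrA subr_gt0 ltr_pMr.
have t0 : 0 < t by rewrite -(pmulr_rgt0 _ m1') (lt_trans ltr01).
have t2 : m%:R * t <= 1.
  move: h2; rewrite lerBlDr -[1 + m%:R]addrC natr1 mulrAC -[leRHS]mul1r ler_pM2r//.
split.
  rewrite t0/= (le_trans _ t2)// ler_peMl ?ler1n// ltW//.
apply/eqP; rewrite eqn_leq luroth_index_ge// t2 andbT.
by rewrite leqNgt luroth_index_ge// -ltNge.
Qed.

Lemma luroth_map_branch t : luroth_map t = branch (luroth_index t) t.
Proof. by []. Qed.

Let piece m E := branch m @^-1` (D0 `&` E).

Let pieceE m E t : (0 < m)%N ->
  piece m E t <-> [/\ D0 t, luroth_index t = m & E (luroth_map t)].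
Proof.
move=> m0; rewrite /piece/=; split.
  by move=> [/(luroth_branch _ m0)[Dt im] Et]; split => //; rewrite luroth_map_branch im.
move=> [Dt im Et]; split; first by apply/luroth_branch.
by rewrite -im.
Qed.

Let measurable_branch m : measurable_fun setT (branch m).
Proof. by apply: measurable_funD => //; exact: measurable_funM. Qed.

Let measurable_piece m E : measurable (D0 `&` E) -> measurable (piece m E).
Proof.
by move=> mE; rewrite -[X in measurable X]setTI; exact: measurable_branch.
Qed.

Let event (K : set nat) E : set R :=
  [set t | K (luroth_index t) /\ E (luroth_map t)].

Let eventE K E : D0 `&` event K E = \bigcup_(m in [set m | (0 < m)%N /\ K m]) piece m E.
Proof.
apply/seteqP; split => t /=.
  move=> [Dt [Kt Et]]; have i0 := luroth_index_gt0 Dt.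
  by exists (luroth_index t); [split|apply/pieceE].
by move=> [m [m0 Km]] /(pieceE _ _ m0)[Dt im Et]; split => //; split => //; rewrite im.
Qed.

Lemma measurable_event K E : measurable (D0 `&` E) -> measurable (D0 `&` event K E).
Proof. by move=> mE; rewrite eventE; apply: bigcup_measurable => m _; exact: measurable_piece. Qed.

Let w (m : nat) : R := (m%:R * m.+1%:R)^-1.

Let measure_piece m E : (0 < m)%N -> measurable (D0 `&` E) ->
  mu (piece m E) = ((w m)%:E * mu (D0 `&` E))%E.
Proof.
move=> m0 mE; have a0 : 0 < m%:R * m.+1%:R :> R by rewrite mulr_gt0 ?ltr0n.
rewrite [in RHS](lebesgue_affine (- m%:R) a0 mE) muleA -EFinM mulVf ?gt_eqF//.
by rewrite mul1e.
Qed.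

Let measure_event_series K E : measurable (D0 `&` E) ->
  mu (D0 `&` event K E) =
  (\sum_(m <oo | m \in [set m | (0 < m)%N /\ K m]) ((w m)%:E * mu (D0 `&` E)))%E.
Proof.
move=> mE; rewrite eventE /mu measure_bigcup.
- apply: eq_eseriesr => m; rewrite inE => -[m0 _]; exact: measure_piece.
- by move=> m _; exact: measurable_piece.
- move=> i j [i0 _] [j0 _] [t [/(pieceE _ _ i0)[_ <- _] /(pieceE _ _ j0)[_ <- _]]].
  by [].
Qed.

(** Given that the index lies in K, the image under the map is still uniformly
    distributed: the law of one branch does not depend on its index. *)
Lemma measure_event K E : measurable (D0 `&` E) ->
  mu (D0 `&` event K E) = (mu (D0 `&` event K setT) * mu (D0 `&` E))%E.
Proof.
move=> mE.
have D01 : mu D0 = 1%E by rewrite /mu lebesgue_measure_itv/= lte_fin ltr01 sube0.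
have Efin : mu (D0 `&` E) \is a fin_num.
  rewrite ge0_fin_numE//; apply: (@le_lt_trans _ _ (mu D0)); last by rewrite D01 ltry.
  by apply: le_measure; rewrite ?inE//; exact: subIsetl.
rewrite (measure_event_series _ mE) (@measure_event_series K setT) ?setIT// D01.
rewrite -(fineK Efin); set r := fine _.
transitivity (\sum_(m <oo | m \in [set m | (0 < m)%N /\ K m]) (r%:E * (w m)%:E))%E.
  by apply: eq_eseriesr => m _; rewrite muleC.
rewrite nneseriesZl; last by move=> m _; rewrite lee_fin invr_ge0 mulr_ge0.
rewrite muleC; congr (_ * _)%E.
by apply: eq_eseriesr => m _; rewrite mule1.
Qed.

Definition index_event n (K : nat -> set nat) : set R :=
  [set t | forall i, (i < n)%N -> K i (luroth_index (iter i luroth_map t))].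

Lemma index_eventS n K :
  index_event n.+1 K = event (K 0%N) (index_event n (fun i => K i.+1)).
Proof.
apply/seteqP; split => t /=.
  by move=> H; split; [exact: (H 0%N)|move=> i i_n; have := H i.+1 i_n; rewrite iterSr].
move=> [H0 H] [|i] i_n; first exact: H0.
by rewrite iterSr; exact: H.
Qed.

Lemma measurable_index_event n K : measurable (D0 `&` index_event n K).
Proof.
elim: n K => [|n IH] K; last by rewrite index_eventS; exact: measurable_event.
by rewrite (_ : index_event 0 K = setT) ?setIT//; apply/seteqP; split.
Qed.

(** Applying the map forgets the first index, so the indices are independent by
    induction on their number. *)
Lemma measure_index_event n K : mu (D0 `&` index_event n K) =
  (\prod_(i < n) mu (D0 `&` [set t | K i (luroth_index t)]))%E.
Proof.
elim: n K => [|n IH] K.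
  rewrite big_ord0 (_ : index_event 0 K = setT); last by apply/seteqP; split.
  by rewrite setIT /mu lebesgue_measure_itv/= lte_fin ltr01 sube0.
rewrite index_eventS measure_event; last exact: measurable_index_event.
rewrite IH big_ord_recl/=; congr (mu _ * _)%E; congr (_ `&` _).
by apply/seteqP; split => t /=; [case|].
Qed.

End Luroth.

(** * Independent sequences with a prescribed discrete law *)

Section LurothSequence.
Variable R : realType.
Implicit Types (t : R) (K : set nat) (v : nat -> R).

Let mu := @lebesgue_measure R.
Let D0 : set R := `]0, 1]%classic.

Definition luroth_seq v i t : R := v (luroth_index (iter i (@luroth_map R) t)).

Let one i K : nat -> set nat := fun j => if j == i then K else setT.

Let oneE i K : [set t | K (luroth_index (iter i (@luroth_map R) t))] =
  index_event i.+1 (one i K).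
Proof.
apply/seteqP; split => t /= H.
  by move=> j _; rewrite /one; case: eqP => // ->.
by have := H i (leqnn _); rewrite /one eqxx.
Qed.

Let full_event : mu (D0 `&` [set t | (setT : set nat) (luroth_index t)]) = 1%E.
Proof.
rewrite (_ : D0 `&` _ = D0); last by apply/seteqP; split => t //= [].
by rewrite /mu lebesgue_measure_itv/= lte_fin ltr01 sube0.
Qed.

Lemma measurable_luroth_at i K :
  measurable (D0 `&` [set t | K (luroth_index (iter i (@luroth_map R) t))]).
Proof. by rewrite oneE; exact: measurable_index_event. Qed.

Lemma measure_luroth_at i K :
  m01 [set t | K (luroth_index (iter i (@luroth_map R) t))] =
  m01 [set t : R | K (luroth_index t)].
Proof.
rewrite m01_oc; last exact: measurable_luroth_at.
rewrite m01_oc; last exact: (measurable_luroth_at 0 K).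
rewrite oneE measure_index_event big_ord_recr/= big1 ?mul1e; last first.
  by move=> j _; rewrite /one ltn_eqF//; exact: full_event.
by rewrite /one eqxx.
Qed.

Lemma measurable_01 (A : set R) : measurable (D0 `&` A) -> measurable (`[0, 1]%classic `&` A).
Proof.
move=> mA; rewrite (_ : `[0, 1]%classic `&` A = ([set 0] `&` A) `|` (D0 `&` A)).
  apply: measurableU => //; have [A0|A0] := pselect (A 0).
    rewrite (_ : _ `&` _ = [set 0]); first exact: measurable_set1.
    by apply/seteqP; split => t /=; [case|move=> ->].
  rewrite (_ : _ `&` _ = set0)//; apply/seteqP; split => t //= [-> ].
  exact: A0.
apply/seteqP; split => t; rewrite /D0/= !in_itv/=.
  move=> [/andP[t0 t1] At]; have [te|tn] := eqVneq t 0; first by left.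
  by right; split => //; rewrite lt_neqAle eq_sym tn t0.
by case=> [[-> ?]|[/andP[/ltW -> ->] ?]]; rewrite ?lexx ?ler01.
Qed.

Lemma measurable_luroth_seq v i : measurable_fun `[0 : R, 1] (luroth_seq v i).
Proof.
move=> _ B mB; apply: measurable_01.
exact: (measurable_luroth_at i (v @^-1` B)).
Qed.

Lemma luroth_seq_identical v : identically_distributed (luroth_seq v).
Proof.
move=> i j B mB; rewrite [LHS](measure_luroth_at i (v @^-1` B)).
by rewrite [RHS](measure_luroth_at j (v @^-1` B)).
Qed.

Lemma luroth_seq_independent v : independent (luroth_seq v).
Proof.
move=> J B mB; pose n := (\max_(j <- J) j).+1.
pose K i : set nat := if i \in J then v @^-1` B i else setT.
have Jn i : i \in J -> (i < n)%N by move=> iJ; rewrite ltnS; exact: leq_bigmax_seq.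
have -> : \bigcap_(i in [set` J]) luroth_seq v i @^-1` B i = index_event n K.
  apply/seteqP; split => t /= H i.
    move=> i_n; rewrite /K; case: ifPn => // iJ; exact: H.
  by move=> iJ; have := H i (Jn _ iJ); rewrite /K iJ.
rewrite m01_oc; last exact: measurable_index_event.
rewrite measure_index_event.
rewrite -(big_mkord xpredT (fun i => mu (D0 `&` [set t | K i (luroth_index t)]))).
rewrite (bigID (fun i => i \in J))/= [X in (_ * X)%E]big1 ?mule1; last first.
  by move=> i /negbTE iJ; rewrite /K iJ; exact: full_event.
rewrite -big_filter (perm_big (enum_fset J)).
  rewrite big_seq [RHS]big_seq; apply: eq_bigr => i iJ; rewrite /K iJ.
  rewrite [RHS](measure_luroth_at i (v @^-1` B i)) m01_oc//.
  exact: (measurable_luroth_at 0 (v @^-1` B i)).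
apply: uniq_perm; rewrite ?filter_uniq ?iota_uniq ?fset_uniq// => i.
rewrite mem_filter mem_iota/= subn0 add0n; apply/andP/idP => [[]//|iJ].
by split => //; exact: Jn.
Qed.

Lemma prob_luroth_index_ge m : (0 < m)%N ->
  prob [set t : R | (m <= luroth_index t)%N] = m%:R^-1.
Proof.
move=> m0; have m0' : 0 < m%:R :> R by rewrite ltr0n.
rewrite /prob m01_oc; last exact: (measurable_luroth_at 0 [set k | (m <= k)%N]).
rewrite (_ : _ `&` _ = `]0, m%:R^-1]%classic).
  by rewrite /mu lebesgue_measure_itv/= lte_fin invr_gt0 m0' sube0.
apply/seteqP; split => t /=; rewrite !in_itv/=.
  by move=> [/andP[t0 _]]; rewrite luroth_index_ge// t0/= mulrC -ler_pdivlMr// mul1r.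
move=> /andP[t0 tm]; rewrite luroth_index_ge// t0/=; split.
  by rewrite (le_trans tm)// invf_le1// ler1n.
by rewrite mulrC -ler_pdivlMr// mul1r.
Qed.

End LurothSequence.

(** * Lower bounds for sums of independent functions *)

Section LowerBounds.
Variables (R : realType) (psi : Psi R).
Local Notation N := (lorentz_norm psi).

Lemma one_sub_pow_le (v : R) (k : nat) : 0 <= v <= 1 -> k%:R * v <= 1 ->
  (1 - v) ^+ k <= 1 - k%:R * v / 2.
Proof.
move=> /andP[v0 v1] kv1.
have h1 : 1 - v <= expR (- v) := expR_ge1Dx (- v).
apply: (@le_trans _ _ (expR (- v) ^+ k)).
  by apply: lerXn2r; rewrite ?nnegrE ?expR_ge0 ?subr_ge0.
rewrite -expRM_natl mulrN expRN; set w := k%:R * v.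
have w0 : 0 <= w by rewrite mulr_ge0.
apply: (@le_trans _ _ (1 + w)^-1).
  rewrite lef_pV2 ?posrE ?expR_gt0 ?expR_ge1Dx//; lra.
have w1 : 0 < 1 + w by lra.
rewrite -[leLHS]mul1r ler_pdivrMr//.
have : 0 <= w * (1 - w) by rewrite mulr_ge0// subr_ge0.
by lra.
Qed.

Variable x : nat -> R -> R.
Hypothesis mx : forall k, measurable_fun `[0 : R, 1] (x k).
Hypothesis ix : independent x.
Hypothesis idx : identically_distributed x.

Let mS n : measurable_fun `[0 : R, 1] (fun t => \sum_(k < n) x k t).
Proof. exact: measurable_sum01. Qed.

(** By independence all n terms exceed b together with probability at least
    v^n, and then the sum exceeds n b. *)
Lemma lorentz_sum_ge_all n (b v : R) : 0 <= b -> 0 <= v <= 1 ->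
  v <= prob (x 0%N @^-1` `[b, +oo[) ->
  ((n%:R * b * psi (v ^+ n))%:E <= N (fun t => \sum_(k < n) x k t)%R)%E.
Proof.
move=> b0 /andP[v0 v1] vp.
have mB : measurable (`[b, +oo[%classic : set R) by exact: measurable_itv.
apply: lorentz_ge_level => //; rewrite ?mulr_ge0 ?exprn_ge0 ?exprn_ile1//.
move=> s s0 sb.
apply: (@le_trans _ _ (\prod_(k < n) prob (x k @^-1` `[b, +oo[))).
  rewrite -[in leLHS](card_ord n) -prodr_const; apply: ler_prod => k _.
  by rewrite v0 (prob_id idx k mB).
rewrite -(prob_cap mx ix n (fun=> mB)); apply: le_prob.
- exact: (measurable_cap mx n (fun=> mB)).
- exact: measurable_above.
move=> t [/= H Dt]; rewrite /above/=; apply: (lt_le_trans sb).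
apply: le_trans (ler_norm _).
rewrite mulr_natl -[in leLHS](card_ord n) -sumr_const; apply: ler_sum => k _.
by have := H k (ltn_ord k); rewrite /= in_itv/= andbT.
Qed.

(** One of the terms exceeds b + n c with probability at least
    1 - (1 - v)^n >= n v / 2, and the other terms cannot take away more than
    n c from it. *)
Lemma lorentz_sum_ge_one n (b c v : R) : 0 <= b -> 0 <= v <= 1 ->
  n%:R * v <= 1 -> v <= prob (x 0%N @^-1` `[b + n%:R * c, +oo[) ->
  0 <= c -> (forall k t, - c <= x k t) ->
  ((b * psi (n%:R * v / 2))%:E <= N (fun t => \sum_(k < n) x k t)%R)%E.
Proof.
move=> b0 /andP[v0 v1] nv1 vp c0 xc.
pose C := ~` (`[b + n%:R * c, +oo[%classic : set R).
have mB : measurable (`[b + n%:R * c, +oo[%classic : set R) by exact: measurable_itv.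
have mC : measurable C by exact: measurableC.
have D01 : measurable (`[0, 1]%classic : set R) by exact: measurable_itv.
have pC k : prob (x k @^-1` C) <= 1 - v.
  rewrite (prob_id idx k mC) lerBrDr.
  have p1 : prob (x 0%N @^-1` `[b + n%:R * c, +oo[) + prob (x 0%N @^-1` C) = 1.
    have m1 := measurable_preimage mx 0 mB; have m2 := measurable_preimage mx 0 mC.
    apply: EFin_inj; rewrite EFinD -!probE// !m01E.
    rewrite -(@measureU _ _ _ (@lebesgue_measure R))//.
      rewrite -setIUr (_ : _ `|` _ = setT); last first.
        by rewrite /C preimage_setC setUv.
      by have := m01T R; rewrite m01E.
    by rewrite setIACA /C preimage_setC setICr setI0.
  by rewrite -p1 addrC lerD2r.
have nv0 : 0 <= n%:R * v / 2 by rewrite divr_ge0 ?mulr_ge0.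
apply: lorentz_ge_level => //; last by lra.
move=> s s0 sb.
pose F := [set t | forall k, (k < n)%N -> C (x k t)].
have mF := measurable_cap mx n (fun=> mC).
have pF : prob F <= 1 - n%:R * v / 2.
  rewrite (prob_cap mx ix n (fun=> mC)).
  apply: (le_trans _ (one_sub_pow_le (_ : 0 <= v <= 1) nv1)); last by rewrite v0.
  rewrite -[in leRHS](card_ord n) -prodr_const; apply: ler_prod => k _.
  by rewrite prob_ge0 pC.
have cover : 1 <= prob F + dist (fun t => \sum_(k < n) x k t) s.
  have mA : measurable (`[0, 1]%classic `&` above (fun t => \sum_(k < n) x k t) s).
    exact: measurable_above.
  apply: le_trans (prob_setU mF mA).
  rewrite [leLHS](_ : 1 = prob setT); last by rewrite /prob m01T.
  apply: le_prob; [by rewrite setIT|by rewrite setIUr; exact: measurableU|].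
  move=> t [_ Dt]; have [Ft|] := pselect (F t); first by left.
  move=> /existsNP[k /not_implyP[kn /contrapT]]; rewrite /= in_itv/= andbT => big.
  right; rewrite /above/=; apply: (lt_le_trans sb); apply: le_trans (ler_norm _).
  rewrite (bigD1 (Ordinal kn))//=.
  have : \sum_(i < n | i != Ordinal kn) (- c) <= \sum_(i < n | i != Ordinal kn) x i t.
    by apply: ler_sum => i _.
  rewrite sumr_const => h.
  have h2 : - (n%:R * c) <= - c *+ #|[pred i | i != Ordinal kn]|.
    rewrite mulNrn lerN2 -[leLHS]mulr_natl ler_wpM2r// ler_nat.
    by rewrite -[leqRHS](card_ord n) max_card.
  by lra.
by lra.
Qed.

End LowerBounds.

(** * One-sided upper limits *)

Section LimitSuperior.
Variable R : realType.
Implicit Types (f : R -> R) (c d : R).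

Lemma limf_esup_right_lt f c :
  (limf_esup (fun u => (f u)%:E) (0 : R)^'+ < c%:E)%E ->
  exists2 d, 0 < d & exists2 c', c' < c & forall u, 0 < u < d -> f u <= c'.
Proof.
move=> /ereal_inf_lt[y [V V0 <-]] lt_c.
have [d /= d0 dV] := V0.
have le_sup u : 0 < u < d -> ((f u)%:E <= ereal_sup [set (f v)%:E | v in V])%E.
  move=> /andP[u0 ud]; apply: ereal_sup_ubound; exists u => //; apply: dV => //.
  by rewrite /ball/= sub0r normrN gtr0_norm.
exists d => //; case E : (ereal_sup _) lt_c => [r| |]// lt_c.
  exists r; first by rewrite -lte_fin.
  by move=> u ud; have := le_sup _ ud; rewrite E lee_fin.
have /le_sup : 0 < d / 2 < d by lra.
by rewrite E leeNy_eq.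
Qed.

Lemma limf_esup_right_ge f c c' d :
  ~ (limf_esup (fun u => (f u)%:E) (0 : R)^'+ < c%:E)%E -> c' < c -> 0 < d ->
  exists2 u, 0 < u < d & c' < f u.
Proof.
move=> nlt c'c d0; apply: contrapT => noex; apply: nlt.
apply: (@le_lt_trans _ _ c'%:E); last by rewrite lte_fin.
pose V : set R := [set u | 0 < u < d].
apply: (@le_trans _ _ (ereal_sup [set (f v)%:E | v in V])).
  apply: ereal_inf_lbound; exists V => //.
  exists d => //= u; rewrite /ball_/= sub0r normrN => ud u0; rewrite /V/= u0/=.
  by rewrite gtr0_norm in ud.
apply: ge_ereal_sup => _ [u uV <-]; rewrite lee_fin leNgt; apply/negP => lt.
by apply: noex; exists u.
Qed.

End LimitSuperior.

(** * Failure of the conditions *)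

Section NoGain.
Variables (R : realType) (psi : Psi R).
Local Notation N := (lorentz_norm psi).

(** At u = 1/m one of the two mechanisms behind the sufficiency gains nothing, up
    to the constant 8: psi(u^K) is comparable to psi(u), or psi(K u / 2) to
    K psi(u). The division by 2 comes from 1 - (1 - u)^K >= K u / 2. *)
Definition no_gain (K m : nat) :=
  psi m%:R^-1 / 8 <= psi (m%:R^-1 ^+ K) \/
  K%:R / 8 * psi m%:R^-1 <= psi (K%:R * m%:R^-1 / 2).

(** A failing upper limit yields arbitrarily small u with psi(K u) > K/2 psi(u) or
    psi(u^K) > 1/2 psi(u). For 1/m in [u, 2u] all the values of psi change by at
    most a factor 2. *)
Lemma no_gain_near K (d : R) : (2 <= K)%N -> 0 < d ->
  ~ (limf_esup (fun u : R => (psi (K%:R * u) / psi u)%:E) (0 : R)^'+ < K%:R%:E)%E \/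
  ~ (limf_esup (fun u : R => (psi (u ^+ K) / psi u)%:E) (0 : R)^'+ < 1%:E)%E ->
  exists m, [/\ (0 < m)%N, m%:R^-1 < d & no_gain K m].
Proof.
move=> K2 d0 fail.
have K0 : 0 < K%:R :> R by rewrite ltr0n (leq_trans _ K2).
have K2' : 2 <= K%:R :> R by rewrite ler_nat.
pose d' := Num.min (d / 2) (2 * K%:R)^-1.
have d'0 : 0 < d' by rewrite lt_min divr_gt0//= invr_gt0 mulr_gt0.
have [u /andP[u0 ud] fu] : exists2 u, 0 < u < d' &
    K%:R / 2 * psi u < psi (K%:R * u) \/ psi u / 2 < psi (u ^+ K).
  have ps u : 0 < u < d' -> 0 < psi u.
    move=> /andP[u0 ud]; apply: psi_gt0; rewrite u0/=.
    move: ud; rewrite lt_min => /andP[_ /ltW/le_trans]; apply.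
    by rewrite invf_le1 ?mulr_gt0//; lra.
  case: fail => nlt.
    have [|u ud uP] := limf_esup_right_ge nlt (_ : K%:R / 2 < K%:R) d'0; first by lra.
    by exists u => //; left; rewrite -ltr_pdivlMr// ps.
  have [|u ud uP] := limf_esup_right_ge nlt (_ : 1 / 2 < 1) d'0; first by lra.
  by exists u => //; right; rewrite mulrC -[2^-1]mul1r -ltr_pdivlMr// ps.
move: ud; rewrite lt_min => /andP[ud uK].
have Ku : K%:R * u <= 1 / 2.
  by rewrite mulrC -ler_pdivlMr// (le_trans (ltW uK))// invfM mul1r.
have u2 : 2 * u <= K%:R * u by rewrite ler_pM2r.
(* The largest m with u <= 1/m; then 1/m <= 2 u. *)
pose m := Num.truncn u^-1.
have iu0 : 0 < u^-1 by rewrite invr_gt0.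
have /andP[mle mgt] := truncn_itv (ltW iu0); rewrite -/m in mle mgt.
have m0 : (0 < m)%N by rewrite truncn_gt0 invf_ge1//; lra.
have m0' : 1 <= m%:R :> R by rewrite ler1n.
have mp : 0 < m%:R :> R by lra.
pose v : R := m%:R^-1.
have uv : u <= v by rewrite -[u]invrK lef_pV2 ?posrE.
have vu : v <= 2 * u.
  have h : u^-1 <= 2 * m%:R by move: mgt; rewrite -natr1 => h; lra.
  have -> : 2 * u = (u^-1 / 2)^-1 by rewrite invfM !invrK mulrC.
  by rewrite lef_pV2 ?posrE ?divr_gt0//; lra.
have half w : 0 <= w <= 1 -> psi w / 2 <= psi (w / 2).
  by move=> w01; rewrite mulrC [w / 2]mulrC psi_scale//; lra.
have psi_v : psi v / 2 <= psi u.
  apply: (@le_trans _ _ (psi (2 * u) / 2)).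
    by rewrite ler_pM2r//; apply: psi_le => //; lra.
  have e : 2 * u / 2 = u by lra.
  by have := half (2 * u); rewrite e; apply; lra.
have psi_v0 : 0 <= psi v by apply: psi_ge0; lra.
have vd : v < d by lra.
exists m; split => //.
rewrite /no_gain -/v; case: fu => fu; last first.
  left; apply: (@le_trans _ _ (psi (u ^+ K))); first by lra.
  apply: psi_le; rewrite ?exprn_ge0 ?exprn_ile1//; try lra.
  by apply: lerXn2r; rewrite ?nnegrE//; lra.
right; apply: (@le_trans _ _ (psi (K%:R * u / 2))); last first.
  apply: psi_le.
  - by rewrite divr_ge0// mulr_ge0//; lra.
  - by rewrite ler_pM2r// ler_pM2l.
  have : K%:R * v <= K%:R * (2 * u) by rewrite ler_pM2l.
  by lra.
apply: le_trans (half _ _); last by apply/andP; split; [rewrite mulr_ge0//; lra|lra].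
have : K%:R / 2 * (psi v / 2) <= K%:R / 2 * psi u by rewrite ler_wpM2l// divr_ge0// ltW.
by lra.
Qed.

(** The norm depends on the distribution function only, so it is enough to compare
    these, at each height from some index on. *)
Lemma lorentz_fatou (x : R -> R) (x_ : nat -> R -> R) (B : \bar R) :
  measurable_fun `[0 : R, 1] x -> (forall n, measurable_fun `[0 : R, 1] (x_ n)) ->
  (forall s, 0 <= s -> exists n0, forall n, (n0 <= n)%N ->
    dist x s <= dist (x_ n) s) ->
  (forall n, (N (x_ n) <= B)%E) -> (N x <= B)%E.
Proof.
move=> mx mx_ dom NB.
pose f n s := (psi (dist (x_ n) s))%:E.
have m0oo : measurable (`[0 : R, +oo[%classic : set R) by exact: measurable_itv.
have mf n : measurable_fun `[0 : R, +oo[ (f n) by apply: measurable_psi_dist.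
have f0 n s : `[0 : R, +oo[%classic s -> (0 <= f n s)%E.
  by move=> _; apply: psi_dist_ge0.
apply: (@le_trans _ _ (\int[lebesgue_measure]_(s in `[0%R, +oo[) limn_einf (f^~ s))%E).
  rewrite lorentzE//; apply: ge0_le_integral => //.
  - by move=> s _; apply: psi_dist_ge0.
  - exact: measurable_psi_dist.
  - apply: measurableT_comp => //.
    apply: (measurable_fun_limn_esup (f := fun n s => - f n s)%E) => n.
    exact: measurableT_comp.
  move=> s; rewrite /= in_itv/= andbT => s0; have [n0 n0P] := dom s s0.
  rewrite limn_einf_lim; apply: lime_ge; first exact: is_cvg_einfs.
  exists n0 => // n /= n0n; apply: le_ereal_inf_tmp => _ [k /= nk <-].
  rewrite lee_fin; apply: psi_le; rewrite ?prob_ge0 ?prob_le1//.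
    by apply: n0P; exact: leq_trans nk.
  exact: measurable_above.
apply: (le_trans (fatou _ _ _ _)) => //.
rewrite limn_einf_lim; apply: lime_le; first exact: is_cvg_einfs.
apply: nearW => n; apply: (@le_trans _ _ (N (x_ n))) => //.
by apply: ereal_inf_lbound; exists n => //=; rewrite lorentzE.
Qed.

End NoGain.

(** * A sequence whose sums grow almost linearly *)

Section Counterexample.
Variables (R : realType) (psi : Psi R).
Local Notation N := (lorentz_norm psi).

(** Both alternatives give a norm of order K times the norm b psi(1/m) of a single
    spike, as if the terms were equal to each other. *)
Lemma lorentz_sum_ge_no_gain (x : nat -> R -> R) (K m : nat) (b c : R) :
  (forall k, measurable_fun `[0 : R, 1] (x k)) -> independent x ->
  identically_distributed x -> (0 < m)%N -> K%:R * m%:R^-1 <= 1 :> R ->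
  0 <= b -> 0 <= c -> (forall k t, - c <= x k t) ->
  m%:R^-1 <= prob (x 0%N @^-1` `[b + K%:R * c, +oo[) -> no_gain psi K m ->
  ((K%:R / 8 * b * psi m%:R^-1)%:E <= N (fun t => \sum_(k < K) x k t)%R)%E.
Proof.
move=> mx ix idx m0 Km b0 c0 xc pm slow.
have v01 : 0 <= (m%:R^-1 : R) <= 1.
  by rewrite invr_ge0 ler0n/= invf_le1 ?ltr0n// ler1n.
case: slow => slow.
  apply: (@le_trans _ _ (K%:R * b * psi (m%:R^-1 ^+ K))%:E).
    rewrite lee_fin; have := ler_wpM2l (mulr_ge0 (ler0n R K) b0) slow.
    by lra.
  apply: lorentz_sum_ge_all => //; apply: (le_trans pm); apply: le_prob.
  - by apply: measurable_preimage => //; exact: measurable_itv.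
  - by apply: measurable_preimage => //; exact: measurable_itv.
  - move=> t [/= + _]; rewrite !in_itv/= !andbT; apply: le_trans.
    by rewrite lerDl mulr_ge0.
apply: (@le_trans _ _ (b * psi (K%:R * m%:R^-1 / 2))%:E).
  by rewrite lee_fin; have := ler_wpM2l b0 slow; lra.
exact: (lorentz_sum_ge_one psi mx ix idx b0 v01 Km pm c0 xc).
Qed.

(** As a function of the index k: spikes of height c_i carried by the sets where
    k >= m_i, which have measure 1/m_i under the Lueroth index. *)
Definition spikes (c : nat -> R) (m : nat -> nat) (n k : nat) : R :=
  \sum_(i < n) (if (m i <= k)%N then c i else 0).

Section Spikes.
Variables (c : nat -> R) (m : nat -> nat).
Hypothesis c0 : forall i, 0 <= c i.
Hypothesis mi : forall i, (i < m i)%N.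

Let term_ge0 i k : 0 <= (if (m i <= k)%N then c i else 0).
Proof. by case: ifP. Qed.

Lemma spikes_ge0 n k : 0 <= spikes c m n k.
Proof. by apply: sumr_ge0 => i _. Qed.

(** Only the i < m_i <= k contribute, so that the infinite sum of spikes at k is
    a finite sum. *)
Lemma spikes_stable n k : (k < n)%N -> spikes c m n k = spikes c m k.+1 k.
Proof.
move=> kn; rewrite /spikes -(subnKC kn) big_split_ord/= [X in _ + X]big1 ?addr0//.
move=> i _; case: ifP => // mk.
have := leq_trans (mi (k.+1 + i)) mk; rewrite ltnNge.
by rewrite (leq_trans (leqnSn k)) ?leq_addr.
Qed.

Lemma spikes_homo n k k' : (k <= k')%N -> spikes c m n k <= spikes c m n k'.
Proof.
move=> kk'; apply: ler_sum => i _; case: ifPn => [mk|_]; last exact: term_ge0.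
by rewrite (leq_trans mk).
Qed.

Lemma spikes_ge i k : (m i <= k)%N -> c i <= spikes c m k.+1 k.
Proof.
move=> mk; have ik : (i < k.+1)%N by rewrite ltnS (leq_trans (ltnW (mi i))).
rewrite /spikes (bigD1 (Ordinal ik))//= mk lerDl; apply: sumr_ge0 => j _.
exact: term_ge0.
Qed.

Lemma lorentz_spikes n :
  (N (luroth_seq (spikes c m n) 0) <= (\sum_(i < n) c i * psi (m i)%:R^-1)%:E)%E.
Proof.
pose y i := luroth_seq (fun k => if (m i <= k)%N then c i else 0 : R) 0.
have my i : measurable_fun `[0 : R, 1] (y i) by exact: measurable_luroth_seq.
apply: (le_trans (lorentz_sum psi n my)); rewrite -sumEFin; apply: lee_sum => i _.
have m0 : (0 < m i)%N by apply: leq_ltn_trans (mi i).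
have yc u : `|y i u| <= c i.
  by rewrite /y /luroth_seq; case: ifP; rewrite ?normr0// ger0_norm.
apply: (le_trans (lorentz_bounded psi (my i) (c0 i) (c0 i) (fun u _ => yc u))).
have -> : dist (y i) (c i) = 0.
  have -> : dist (y i) (c i) = prob set0.
    congr prob; apply/seteqP; split => // u; rewrite /above/= => h.
    by have := yc u; rewrite leNgt h.
  by rewrite /prob m01E setI0 measure0.
rewrite Psi0 mulr0 addr0 lee_fin ler_wpM2l//; apply: psi_le; first exact: prob_ge0.
  rewrite -prob_luroth_index_ge//; apply: le_prob.
  - exact: measurable_above.
  - exact: (measurable_01 (@measurable_luroth_at R 0 [set k | (m i <= k)%N])).
  - move=> u []; rewrite /above /y /luroth_seq/=; case: ifP => //.
    by rewrite normr0 ltxx.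
by rewrite invf_le1 ?ltr0n// ler1n.
Qed.

Lemma lorentz_spikes_lim (B : R) :
  (forall n, \sum_(i < n) c i * psi (m i)%:R^-1 <= B) ->
  (N (luroth_seq (fun k => spikes c m k.+1 k) 0) <= B%:E)%E.
Proof.
move=> cB; apply: (@lorentz_fatou _ _ _ (fun n => luroth_seq (spikes c m n) 0)).
- exact: measurable_luroth_seq.
- by move=> n; exact: measurable_luroth_seq.
- move=> s s0; set g := luroth_seq _ 0.
  have mA : measurable (`[0, 1]%classic `&` above g s).
    by apply: measurable_above; exact: measurable_luroth_seq.
  (* Once n exceeds an index k0 where the limit is above s, the n-th partial sum
     is above s wherever the limit is, both being nondecreasing in the index. *)
  have [[k0 k0s]|nex] := pselect (exists k, s < spikes c m k.+1 k); last first.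
    exists 0%N => n _; apply: le_prob => //.
      by apply: measurable_above; exact: measurable_luroth_seq.
    move=> t []; rewrite /above/= => sg; exfalso; apply: nex.
    exists (luroth_index t); apply: (lt_le_trans sg).
    by rewrite /g /luroth_seq/= ger0_norm// spikes_ge0.
  exists k0.+1 => n k0n; apply: le_prob => //.
    by apply: measurable_above; exact: measurable_luroth_seq.
  move=> t []; rewrite /above /g /luroth_seq/= !ger0_norm ?spikes_ge0// => sg _.
  set k := luroth_index t in sg *.
  have [kk0|k0k] := leqP k k0; first by rewrite spikes_stable// (leq_ltn_trans kk0).
  by rewrite (lt_le_trans k0s)// -(spikes_stable k0n) spikes_homo// ltnW.
move=> n; apply: (le_trans (lorentz_spikes n)).
by rewrite lee_fin.
Qed.

End Spikes.

Lemma geometric_le2 n : \sum_(i < n) 2^-1 ^+ i <= 2 :> R.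
Proof.
suff : \sum_(i < n) 2^-1 ^+ i = 2 - 2 * 2^-1 ^+ n :> R.
  by move=> ->; rewrite gerBl mulr_ge0// exprn_ge0// invr_ge0.
elim: n => [|n IH]; first by rewrite big_ord0 expr0 mulr1 subrr.
by rewrite big_ord_recr/= IH exprS; lra.
Qed.

(** The factor K + 1 in the last bound makes the spike high compared with what
    centering by a mean of at most 2 / psi 1 can take away from K terms. *)
Let no_gain_choice (q : R) : 0 < q ->
  (forall K (d : R), (2 <= K)%N -> 0 < d ->
    exists m, [/\ (0 < m)%N, m%:R^-1 < d & no_gain psi K m]) ->
  exists Km : nat -> nat * nat, forall i,
    [/\ (0 < (Km i).1)%N, 4 ^+ i <= expR (q * ln ((Km i).1)%:R),
        (i < (Km i).2)%N, ((Km i).1)%:R * ((Km i).2)%:R^-1 <= 1 :> R &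
        2 * (((Km i).1)%:R + 1) * (2 / psi 1) * psi ((Km i).2)%:R^-1 <= 2^-1 ^+ i /\
        no_gain psi (Km i).1 (Km i).2].
Proof.
move=> q0 slow.
pose P i (Km : nat * nat) :=
  [/\ (0 < Km.1)%N, 4 ^+ i <= expR (q * ln (Km.1)%:R),
      (i < Km.2)%N, (Km.1)%:R * (Km.2)%:R^-1 <= 1 :> R &
      2 * ((Km.1)%:R + 1) * (2 / psi 1) * psi (Km.2)%:R^-1 <= 2^-1 ^+ i /\
      no_gain psi Km.1 Km.2].
suff /choice[Km KmP] : forall i, exists Km, P i Km by exists Km.
move=> i; have [n0 n0P] := expR_ln_unbounded (4 ^+ i : R) q0.
pose K := maxn n0 2.
have K2 : (2 <= K)%N by rewrite leq_maxr.
have K0 : 0 < K%:R :> R by rewrite ltr0n (leq_trans _ K2).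
pose A : R := 2 * (K%:R + 1) * (2 / psi 1).
have A0 : 0 < A by rewrite !mulr_gt0 ?invr_gt0 ?psi1_gt0 ?addr_gt0.
have e0 : 0 < 2^-1 ^+ i / A :> R by rewrite divr_gt0// exprn_gt0// invr_gt0.
have [d /andP[d0 _] dP] := psi_small psi e0.
pose d' := Num.min d (Num.min K%:R^-1 i.+1%:R^-1).
have d'0 : 0 < d' by rewrite !lt_min d0 !invr_gt0 K0 ltr0Sn.
have [m [m0 + slow_m]] := slow K d' K2 d'0.
rewrite !lt_min => /and3P[md mK mi]; exists (K, m); split => //=.
- by rewrite (leq_trans _ K2).
- by apply: n0P; [exact: leq_maxl|exact: leq_trans K2].
- by move: mi; rewrite ltf_pV2 ?posrE ?ltr0n// ltr_nat => /ltnW.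
- by rewrite -ler_pdivlMl// mulr1 ltW.
split => //; rewrite -/A mulrC -ler_pdivlMr// ltW// dP ?invr_ge0//.
exact: ltW.
Qed.

(** The i-th spike has norm 2^-i, and the sums of K_i terms see it as a spike of
    norm of order K_i 2^-i. As K_i^(1-1/p) >= 4^i, these sums are not
    O(K_i^(1/p)), whatever subsequence is taken. *)
Lemma Gamma_iid_no_gain (p : R) :
  (forall K (d : R), (2 <= K)%N -> 0 < d ->
    exists m, [/\ (0 < m)%N, m%:R^-1 < d & no_gain psi K m]) ->
  Gamma_iid N p -> p <= 1.
Proof.
move=> slow [p1 Gp]; rewrite leNgt; apply/negP => p_gt1.
pose q := 1 - p^-1.
have q0 : 0 < q by rewrite subr_gt0 invf_lt1// (lt_trans _ p_gt1).
have [Km KmP] := no_gain_choice q0 slow.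
pose K i := (Km i).1; pose m i := (Km i).2.
have m0 i : (0 < m i)%N by case: (KmP i) => _ _ /(leq_ltn_trans (leq0n i)).
have mi i : (i < m i)%N by case: (KmP i).
have pm i : 0 < psi (m i)%:R^-1.
  by apply: psi_gt0; rewrite invr_gt0 ltr0n m0/= invf_le1 ?ltr0n// ler1n.
pose c i : R := 2^-1 ^+ i / psi (m i)%:R^-1.
have c0 i : 0 <= c i by rewrite divr_ge0 ?ltW// exprn_ge0// invr_ge0.
have cpm i : c i * psi (m i)%:R^-1 = 2^-1 ^+ i by rewrite divfK// gt_eqF.
pose a k := spikes c m k.+1 k.
pose g := luroth_seq a 0.
have mg : measurable_fun `[0 : R, 1] g by exact: measurable_luroth_seq.
have Ng : (N g <= 2%:E)%E.
  apply: lorentz_spikes_lim => // n.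
  by under eq_bigr do rewrite cpm; exact: geometric_le2.
have fg : fspace N g by split => //; apply: (le_lt_trans Ng); exact: ltry.
pose mu := mean g.
have a0 k : 0 <= a k by exact: spikes_ge0.
have mu0 : 0 <= mu by apply: mean_ge0 => t _; exact: a0.
have mu_le : mu <= 2 / psi 1.
  rewrite ler_pdivlMr ?psi1_gt0// mulrC -lee_fin.
  by apply: le_trans Ng; apply: le_trans (lorentz_dom_mean fg); rewrite ger0_norm.
pose x := luroth_seq (fun k => a k - mu).
have mx k : measurable_fun `[0 : R, 1] (x k) by exact: measurable_luroth_seq.
have ix : independent x by exact: luroth_seq_independent.
have idx : identically_distributed x by exact: luroth_seq_identical.
have fx k : fspace N (x k).
  split => //; have mid : measurable_fun setT (id : R -> R) by exact: measurable_id.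
  have -> := lorentz_identical psi mx idx k mid.
  apply: (le_lt_trans (lorentz_triangle psi mg (measurable_cst (- mu)))).
  rewrite lte_add_pinfty//; first by case: fg.
  by apply: (le_lt_trans (lorentz_cst psi (- mu))); exact: ltry.
have x0 : mean (x 0%N) = 0.
  rewrite [LHS](meanD (fspace_l1 fg) (l1_cst (- mu))).
  by rewrite -/(cst (- mu)) mean_cst subrr.
have [_ [f hf ->] [_ _ BS]] := Gp x (iid_weakly_null fx ix idx x0) ix idx.
have {BS} := BS _ (subsequence_refl _).
set S := ereal_sup _ => Soo.
have ixf := independent_sub (homo_ltn_inj hf) ix.
have idxf := identically_distributed_sub f idx.
have key i : ((2 ^+ i / 16)%:E <= S)%E.
  have [K0 K4 _ Km1 [cK slow_i]] := KmP i; rewrite -/(K i) -/(m i) in K0 K4 Km1 cK slow_i.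
  (* One mu is lost by centering the spike, and K_i times mu by the other terms,
     each of which is at least - mu. *)
  pose b := c i - ((K i)%:R + 1) * mu.
  have bc : c i / 2 <= b.
    have h1 : ((K i)%:R + 1) * mu <= ((K i)%:R + 1) * (2 / psi 1).
      by rewrite ler_wpM2l// addr_ge0.
    have h2 : 2 * ((K i)%:R + 1) * (2 / psi 1) <= c i by rewrite ler_pdivlMr.
    by rewrite /b; clear - h1 h2; lra.
  have b0 : 0 <= b by apply: le_trans bc; rewrite divr_ge0.
  have xmu k t : - mu <= (x \o f) k t.
    by rewrite /x /luroth_seq/= lerDr a0.
  have prob_x : (m i)%:R^-1 <= prob ((x \o f) 0%N @^-1` `[b + (K i)%:R * mu, +oo[).
    rewrite -(prob_luroth_index_ge R (m0 i)) /=.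
    have mB : measurable (`[b + (K i)%:R * mu, +oo[%classic : set R).
      exact: measurable_itv.
    rewrite (prob_id idx (f 0%N) mB); apply: le_prob.
    - exact: (measurable_01 (@measurable_luroth_at R 0 [set k | (m i <= k)%N])).
    - exact: measurable_preimage.
    move=> t [/= mk _]; rewrite in_itv/= andbT /x /luroth_seq/= /b.
    have : c i <= a (luroth_index t) by exact: spikes_ge.
    by clear; lra.
  have low := lorentz_sum_ge_no_gain (fun k => mx (f k)) ixf idxf (m0 i) Km1 b0 mu0 xmu
    prob_x slow_i.
  have up : ((((K i)%:R `^ (- p^-1)))%:E *
      N (fun t => (\sum_(k < K i) (x \o f) k t)%R) <= S)%E.
    by apply: ereal_sup_ubound; exists (K i).
  apply: le_trans up; apply: le_trans (lee_wpmul2l _ low); last first.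
    by rewrite lee_fin powR_ge0.
  rewrite -EFinM lee_fin powR_natE//.
  set L := ln _ in K4 *.
  have h1 : 2^-1 ^+ i / 2 <= b * psi (m i)%:R^-1.
    by have := ler_wpM2r (ltW (pm i)) bc; rewrite mulrAC cpm.
  have h2 : expR (- p^-1 * L) * (K i)%:R = expR (q * L).
    have -> : (K i)%:R = expR L by rewrite /L lnK// posrE ltr0n.
    by rewrite -expRD /q; congr expR; ring.
  have h3 : expR (q * L) * (2^-1 ^+ i / 2) <= expR (q * L) * (b * psi (m i)%:R^-1).
    by rewrite ler_wpM2l// expR_ge0.
  have h4 : 4 ^+ i * 2^-1 ^+ i <= expR (q * L) * 2^-1 ^+ i.
    by rewrite ler_wpM2r// exprn_ge0// invr_ge0.
  have h5 : 4 ^+ i * 2^-1 ^+ i = 2 ^+ i :> R by rewrite -exprMn; congr (_ ^+ i); lra.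
  rewrite h5 in h4.
  rewrite [leRHS](_ : _ = expR (- p^-1 * L) * (K i)%:R * (b * psi (m i)%:R^-1) / 8); last by ring.
  by rewrite h2; clear - h3 h4; lra.
have Sge0 : (0 <= S)%E by apply: le_trans (key 0%N); rewrite lee_fin divr_ge0.
have Sfin : S \is a fin_num by rewrite ge0_fin_numE.
have [n] : exists n, fine S * 16 < 2 ^+ n.
  exists (Num.truncn (fine S * 16)).+1; apply: (lt_le_trans (truncnS_gt _)).
  by rewrite -natrX ler_nat ltnW// ltn_expl.
rewrite ltNge -ler_pdivrMr// -lee_fin fineK// => /negP; apply; exact: key.
Qed.

End Counterexample.

(** * The characterization *)

Lemma limf_esup_ratio_lt (R : realType) (psi : Psi R) (f : R -> R) (c : R) :
  (limf_esup (fun u : R => (f u / psi u)%:E) (0 : R)^'+ < c%:E)%E ->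
  exists2 d, 0 < d & exists2 c', c' < c & forall u, 0 < u < d -> f u <= c' * psi u.
Proof.
move=> /limf_esup_right_lt[d d0 [c' c'c dP]].
exists (Num.min d 1); first by rewrite lt_min d0 ltr01.
exists c' => // u /andP[u0]; rewrite lt_min => /andP[ud u1].
by rewrite -ler_pdivrMr ?dP ?psi_gt0 ?u0//= ltW.
Qed.

Theorem theorem21 (R : realType) (psi : Psi R) :
  Gamma_iid (lorentz_norm psi) <> [set 1] <->
  exists k l : nat,
    [/\ (2 <= k)%N, (2 <= l)%N,
        (limf_esup (fun u : R => (psi (k%:R * u) / psi u)%:E) (0 : R)^'+
           < k%:R%:E)%E &
        (limf_esup (fun u : R => (psi (u ^+ l) / psi u)%:E) (0 : R)^'+ < 1%:E)%E].
Proof.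
split=> [Gamma_neq|[k [l [k2 l2 dilation power]]] Gamma1].
  apply: contrapT => fail; apply: Gamma_neq; apply/seteqP; split => [p Gp|_ ->].
    apply/eqP; rewrite eq_le (Gamma_iid_no_gain _ Gp) ?(proj1 Gp)// => K d K2 d0.
    apply: no_gain_near => //.
    have [lt|] := pselect (limf_esup (fun u : R => (psi (K%:R * u) / psi u)%:E)
      (0 : R)^'+ < K%:R%:E)%E; last by left.
    (* The pair (K, K) cannot satisfy both conditions. *)
    by right => lt'; apply: fail; exists K, K.
  exact: Gamma_iid_1.
have [d1 d10 [c1 c1k dil]] := limf_esup_ratio_lt dilation.
have [d2 d20 [c2 c21 pow]] := limf_esup_ratio_lt power.
have [e [C [e01 C0] est]] := iid_estimate k2 c1k d10 dil l2 c21 d20 pow.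
have /andP[e0 e1] := e01.
have := Gamma_iid_of_estimate e01 C0 est; rewrite Gamma1 /= => h.
by have := congr1 GRing.inv h; rewrite invrK invr1; lra.
Qed.
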